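(* (1) The formal power series $P^{\mathbb L}_\lambda(\mathbf x|\mathbf b)^+$ $(\lambda\in\mathcal{SP})$ form a formal $\mathbb L[[\mathbf b]]$-basis of $\Gamma^{\mathbb L}(\mathbf x|\mathbf b)$. (2) The formal power series $Q^{\mathbb L}_\lambda(\mathbf x|\mathbf b)$ $(\lambda\in\mathcal{SP})$ form a formal $\mathbb L[[\mathbf b]]$-basis of $\Gamma^{\mathbb L}_+(\mathbf x|\mathbf b)$.
   Context: $\mathbb L$ is the Lazard ring with universal formal group law $F_{\mathbb L}(u,v)=u+v+\sum_{i,j\ge1}a_{i,j}u^iv^j$; $a+_Fb=F_{\mathbb L}(a,b)$ and $\overline a\in\mathbb L[[a]]$ is the formal inverse ($a+_F\overline a=0$). $\mathbf b=(b_1,b_2,\ldots)$ are parameters. For $k\ge1$ put $[t|\mathbf b]^k=\prod_{i=1}^k(t+_Fb_i)$, $[[t|\mathbf b]]^k=(t+_Ft)[t|\mathbf b]^{k-1}$, with $[t|\mathbf b]^0=[[t|\mathbf b]]^0=1$. For $\lambda=(\lambda_1,\ldots,\lambda_r)$ put $[\mathbf x|\mathbf b]^\lambda=\prod_{i=1}^r[x_i|\mathbf b]^{\lambda_i}$, $[[\mathbf x|\mathbf b]]^\lambda=\prod_{i=1}^r[[x_i|\mathbf b]]^{\lambda_i}$. $\mathcal{SP}$ is the set of all strict partitions. For a strict partition $\lambda=(\lambda_1>\cdots>\lambda_r>0)$ and $n\ge r$, $$P^{\mathbb L}_\lambda(x_1,\ldots,x_n|\mathbf b)=\frac1{(n-r)!}\sum_{w\in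 S_n}w\Big[[\mathbf x|\mathbf b]^\lambda\prod_{i=1}^r\prod_{j=i+1}^n\frac{x_i+_Fx_j}{x_i+_F\overline x_j}\Big],$$ and $Q^{\mathbb L}_\lambda(x_1,\ldots,x_n|\mathbf b)$ is defined by the same formula with $[[\mathbf x|\mathbf b]]^\lambda$ in place of $[\mathbf x|\mathbf b]^\lambda$ ($S_n$ permutes only the $x_i$); both are $0$ for $n<r$. They satisfy $P^{\mathbb L}_\lambda(x_1,\ldots,x_{n-2},0,0|\mathbf b)=P^{\mathbb L}_\lambda(x_1,\ldots,x_{n-2}|\mathbf b)$ and $Q^{\mathbb L}_\lambda(x_1,\ldots,x_{n-1},0|\mathbf b)=Q^{\mathbb L}_\lambda(x_1,\ldots,x_{n-1}|\mathbf b)$. Put $P^{\mathbb L}_\lambda(\mathbf x_n|\mathbf b)^+=P^{\mathbb L}_\lambda(x_1,\ldots,x_n|\mathbf b)$ for $n$ even and $=P^{\mathbb L}_\lambda(x_1,\ldots,x_n,0|\mathbf b)$ for $n$ odd. A formal power series $f(x_1,\ldots,x_n)$ over $\mathbb L$ is $\mathbb L$-supersymmetric if it is symmetric and $f(t,\overline t,x_3,\ldots,x_n)=f(0,0,x_3,\ldots,x_n)$. $\Gamma^{\mathbb L}(\mathbf x_n)$ is the ring of all such series, $\Gamma^{\mathbb L}_+(\mathbf x_n)$ the subring of those $f$ for which $f(t,x_2,\ldots,x_n)-f(0,x_2,\ldots,x_n)$ is divisible by $t+_Ft$. $\Gamma^{\mathbb L}(\mathbf x_n|\mathbf b)=\mathbb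 L[[\mathbf b]]\,\hat\otimes_{\mathbb L}\,\Gamma^{\mathbb L}(\mathbf x_n)$ and $\Gamma^{\mathbb L}_+(\mathbf x_n|\mathbf b)=\mathbb L[[\mathbf b]]\,\hat\otimes_{\mathbb L}\,\Gamma^{\mathbb L}_+(\mathbf x_n)$, i.e. formal power series in $b_1,b_2,\ldots$ with coefficients in the respective ring. $\Gamma^{\mathbb L}(\mathbf x|\mathbf b)=\varprojlim_n\Gamma^{\mathbb L}(\mathbf x_n|\mathbf b)$, $\Gamma^{\mathbb L}_+(\mathbf x|\mathbf b)=\varprojlim_n\Gamma^{\mathbb L}_+(\mathbf x_n|\mathbf b)$ along $x_{n+1}=0$, and $P^{\mathbb L}_\lambda(\mathbf x|\mathbf b)^+=\varprojlim_nP^{\mathbb L}_\lambda(\mathbf x_n|\mathbf b)^+$, $Q^{\mathbb L}_\lambda(\mathbf x|\mathbf b)=\varprojlim_nQ^{\mathbb L}_\lambda(\mathbf x_n|\mathbf b)$. ''Formal $\mathbb L[[\mathbf b]]$-basis'' means that every element can be written uniquely as a possibly infinite formal linear combination of the given elements with coefficients in $\mathbb L[[\mathbf b]]$ (such sums converge as formal power series in the $x_i$ and $b_j$, since the element indexed by $\lambda$ has no terms of degree less than $|\lambda|$ in the $x_i$ and $b_j$). *)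

(* Defs.v *)
From HB Require Import structures.
From mathcomp Require Import all_boot all_order all_algebra all_fingroup.
From mathcomp Require Import finmap multiset.
From mathcomp Require Import boolp classical_sets functions cardinality fsbigop.

Set Implicit Arguments.
Unset Strict Implicit.
Unset Printing Implicit Defensive.

Import GRing.Theory.

Local Open Scope classical_set_scope.
Local Open Scope ring_scope.

(* The submultisets of [m], i.e. the monomials dividing the monomial [m].     *)
Definition msubs (V : choiceType) (m : {mset V}%mset) : seq {mset V}%mset :=
  undup [seq seq_mset (mask (t : seq bool) m) | t : (size m).-tuple bool].

Lemma msubs_uniq (V : choiceType) (m : {mset V}%mset) : uniq (msubs m).
Proof. exact: undup_uniq. Qed.

Lemma mem_msubs (V : choiceType) (m k : {mset V}%mset) :
  (k \in msubs m) = (k `<=` m)%mset.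
Proof.
rewrite mem_undup; apply/fintype.imageP/idP => [[t _ ->]|km].
  apply/msubsetP => x; rewrite mset_seqE -(count_mem_mset x m).
  elim: (enum_mset m) (t : seq bool) => [|y s IH] [|[] u] //=.
    by rewrite leq_add2l.
  exact: leq_trans (IH u) (leq_addl _ _).
have : exists2 b : bitseq, size b = size m & seq_mset (mask b m) = k.
  have kc x : (k x <= count_mem x m)%N.
    by rewrite count_mem_mset; move/msubsetP: km.
  elim: (enum_mset m) k {km} kc => [|y s IH] k kc.
    exists [::] => //; apply/msetP => x; rewrite mset_seqE /=.
    by have := kc x; rewrite leqn0 => /eqP ->.
  have [yk|yk] := boolP (y \in k).
    have [x|b sb eb] := IH (k `\ y)%mset.
      rewrite msetB1E; have := kc x; rewrite /= eq_sym.
      by rewrite leq_subLR [x == y]eq_sym.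
    exists (true :: b) => /=; first by rewrite sb.
    by rewrite mset_cons eb msetB1K.
  have [x|b sb eb] := IH k.
    have := kc x; rewrite /=; case: (eqVneq y x) => [<-|//].
    by move: yk => /mset_eq0P ->.
  by exists (false :: b) => //=; rewrite sb.
by case=> b sb <-; exists (Tuple (introT eqP sb)).
Qed.

(* [fps V R] is the ring of formal power series in the variables [V], which   *)
(* may be infinite in number: arbitrary functions on the finitely supported   *)
(* monomials, a monomial being the multiset of its variables.                 *)
Record fps (V : choiceType) (R : Type) :=
  Fps { fps_coef :> {mset V}%mset -> R }.

Lemma fpsP (V : choiceType) (R : Type) (f g : fps V R) : f =1 g <-> f = g.
Proof.
by split=> [|-> //]; case: f g => f [g] fg; congr Fps; apply/funext.
Qed.

Section FpsRing.
Variables (V : choiceType) (R : comNzRingType).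
Implicit Types f g h : fps V R.

HB.instance Definition _ := gen_eqMixin (fps V R).
HB.instance Definition _ := gen_choiceMixin (fps V R).

Definition fps0 : fps V R := Fps (fun=> 0).
Definition fps_opp f : fps V R := Fps (fun m => - f m).
Definition fps_add f g : fps V R := Fps (fun m => f m + g m).
Definition fps1 : fps V R := Fps (fun m => (m == mset0)%:R).
Definition fps_mul f g : fps V R :=
  Fps (fun m => \sum_(k <- msubs m) f k * g (m `\` k)%mset).

Fact fps_addA : associative fps_add.
Proof. by move=> f g h; apply/fpsP => m; rewrite /= addrA. Qed.

Fact fps_addC : commutative fps_add.
Proof. by move=> f g; apply/fpsP => m; rewrite /= addrC. Qed.

Fact fps_add0 : left_id fps0 fps_add.
Proof. by move=> f; apply/fpsP => m; rewrite /= add0r. Qed.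

Fact fps_addN : left_inverse fps0 fps_opp fps_add.
Proof. by move=> f; apply/fpsP => m; rewrite /= addNr. Qed.

HB.instance Definition _ :=
  GRing.isZmodule.Build (fps V R) fps_addA fps_addC fps_add0 fps_addN.

Fact fps_mulC : commutative fps_mul.
Proof.
move=> f g; apply/fpsP => m; rewrite /=.
have pm : perm_eq (msubs m) [seq (m `\` k)%mset | k <- msubs m].
  apply: uniq_perm; rewrite ?msubs_uniq ?map_inj_in_uniq ?msubs_uniq //.
    move=> k l; rewrite !mem_msubs => km lm /(congr1 (msetB m)).
    by rewrite !msetBBK.
  move=> k; rewrite mem_msubs; apply/idP/mapP => [km|[l _ ->]].
    exists (m `\` k)%mset; last by rewrite msetBBK.
    by rewrite mem_msubs; apply/msubsetP => x; rewrite msetE2 leq_subr.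
  by apply/msubsetP => x; rewrite msetE2 leq_subr.
rewrite (perm_big _ pm) big_map [LHS]big_seq [RHS]big_seq.
by apply: eq_bigr => k; rewrite mem_msubs => km; rewrite msetBBK // mulrC.
Qed.

Fact fps_mulA : associative fps_mul.
Proof.
move=> f g h; apply/fpsP => m; rewrite /=.
have sub_trans (k j : {mset V}%mset) :
  j \in msubs m -> (k \in msubs j) = (k \in msubs m) && (k `<=` j)%mset.
  rewrite !mem_msubs => jm; case: (boolP (k `<=` j)%mset) => kj.
    by rewrite (msubset_trans kj jm).
  by rewrite andbF.
under [RHS]eq_big_seq => j jm.
  have -> : \sum_(k <- msubs j) f k * g (j `\` k)%mset =
            \sum_(k <- msubs m | (k `<=` j)%mset) f k * g (j `\` k)%mset.
    rewrite -[RHS]big_filter; apply: perm_big; apply: uniq_perm.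
    - exact: msubs_uniq.
    - by rewrite filter_uniq // msubs_uniq.
    - by move=> k; rewrite mem_filter sub_trans // andbC.
  rewrite mulr_suml; over.
rewrite /= (exchange_big_dep xpredT) //=.
apply: eq_big_seq => k; rewrite mem_msubs => km.
rewrite -[RHS]big_filter mulr_sumr.
have pm : perm_eq [seq j <- msubs m | (k `<=` j)%mset]
                  [seq (k `+` l)%mset | l <- msubs (m `\` k)%mset].
  apply: uniq_perm; rewrite ?filter_uniq ?msubs_uniq //.
    rewrite map_inj_uniq ?msubs_uniq // => l l' /(congr1 (msetB^~ k)).
    by rewrite !msetDKB.
  move=> j; rewrite mem_filter mem_msubs; apply/andP/mapP => [[kj jm]|[l]].
    exists (j `\` k)%mset; last by rewrite msetBDKC.
    by rewrite mem_msubs subset_msetBLR msetBDKC.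
  rewrite mem_msubs => /msubsetP lm ->; split; apply/msubsetP => x.
    by rewrite msetE2 leq_addr.
  move/msubsetP/(_ x): km => kx; move: (lm x); rewrite !msetE2 => lx.
  by rewrite -(subnKC kx) leq_add2l.
rewrite (perm_big _ pm) big_map; apply: eq_bigr => l _.
by rewrite mulrA msetDKB msetBDA.
Qed.

Fact fps_mul1 : left_id fps1 fps_mul.
Proof.
move=> f; apply/fpsP => m; rewrite /=.
rewrite (bigD1_seq mset0) ?msubs_uniq ?mem_msubs ?msub0set //=.
rewrite eqxx mul1r msetB0 big1 ?addr0 // => k /negPf ->.
by rewrite mul0r.
Qed.

Fact fps_mulDl : left_distributive fps_mul fps_add.
Proof.
move=> f g h; apply/fpsP => m; rewrite /= -big_split /=.
by apply: eq_bigr => k _; rewrite mulrDl.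
Qed.

Fact fps_oner_neq0 : fps1 != 0.
Proof.
apply/eqP => /(congr1 (fun f : fps V R => f mset0)) /=; rewrite eqxx.
by apply/eqP; exact: oner_neq0.
Qed.

HB.instance Definition _ := GRing.Zmodule_isComNzRing.Build (fps V R)
  fps_mulA fps_mulC fps_mul1 fps_mulDl fps_oner_neq0.

Definition fvar (v : V) : fps V R :=
  Fps (fun m => (m == [mset v]%mset)%:R).

End FpsRing.

Definition fps_map (V : choiceType) (R S : Type) (phi : R -> S) (f : fps V R) :
  fps V S := Fps (fun m => phi (f m)).

(* The monomial [k] evaluated at [g]: each [v] occurs [k v] times in [k].     *)
Definition mset_eval (V : choiceType) (A : comNzRingType) (g : V -> A)
    (k : {mset V}%mset) : A := \prod_(v <- k) g v.

(* Substitution of [g v] for each variable [v]. For each monomial [m] only    *)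
(* finitely many [k] contribute when, e.g., [V] is finite and the [g v] have  *)
(* no constant term, or the [g v] are pairwise distinct variables.            *)
Definition fsubst (V W : choiceType) (R : comNzRingType) (f : fps V R)
    (g : V -> fps W R) : fps W R :=
  Fps (fun m => \sum_(k \in [set: {mset V}%mset]) f k * mset_eval g k m).

Section FormalGroupLaw.
Variable R : comNzRingType.
Implicit Type F : fps 'I_2 R.

Definition fgl_add F (V : choiceType) (a b : fps V R) : fps V R :=
  fsubst F (fun i => if i == ord0 then a else b).

Definition is_fgl F : Prop :=
  let u : fps 'I_1 R := fvar R ord0 in
  let x (i : nat) : fps 'I_3 R := fvar R (inord i) in
  [/\ fgl_add F u 0 = u,
      fgl_add F 0 u = u,
      fgl_add F (x 0%N) (x 1%N) = fgl_add F (x 1%N) (x 0%N) &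
      fgl_add F (fgl_add F (x 0%N) (x 1%N)) (x 2%N) =
      fgl_add F (x 0%N) (fgl_add F (x 1%N) (x 2%N))].

(* The formal inverse, as a series in one variable; [xget 0] picks the        *)
(* (unique) element of the set.                                               *)
Definition fgl_inv F : fps 'I_1 R :=
  xget 0 [set g : fps 'I_1 R |
    g mset0 = 0 /\ fgl_add F (fvar R ord0) g = 0].

Definition fgl_opp F (V : choiceType) (a : fps V R) : fps V R :=
  fsubst (fgl_inv F) (fun=> a).

End FormalGroupLaw.

(* [F] is the universal formal group law, i.e. [L] is the Lazard ring.        *)
Definition lazard (L : comNzRingType) (F : fps 'I_2 L) : Prop :=
  is_fgl F /\
  forall (S : comNzRingType) (G : fps 'I_2 S), is_fgl G ->
    exists phi : {rmorphism L -> S},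
      fps_map phi F = G /\
      forall psi : {rmorphism L -> S}, fps_map psi F = G -> psi =1 phi.

(* The element (1/c) * \sum_i N i / D i of a ring in which [c] and the [D i]  *)
(* are not zero divisors, when the sum of fractions lies in the ring.         *)
Definition sum_fractions (A : comNzRingType) (I : finType) (c : nat)
    (N D : I -> A) : A :=
  xget 0 [set h : A | h * (c%:R * \prod_i D i) =
                      \sum_i N i * \prod_(j | j != i) D j].

Definition strictpart_pred (s : seq nat) := sorted gtn s && (0%N \notin s).
Definition strictpart := {s : seq nat | strictpart_pred s}.

(* The variables x_1, ..., x_n, b_1, b_2, ..., all numbered from 0.           *)
Definition xb (n : nat) : choiceType := ('I_n + nat)%type.

Section Functions.
Variables (L : comNzRingType) (F : fps 'I_2 L).

Definition xvar n (i : 'I_n) : fps (xb n) L := fvar L (inl i : xb n).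
Definition bvar n (j : nat) : fps (xb n) L := fvar L (inr j : xb n).

Definition xsubst m n (f : fps (xb m) L) (g : 'I_m -> fps (xb n) L) :
    fps (xb n) L :=
  fsubst f (fun v : xb m =>
              match v with inl i => g i | inr j => bvar n j end).

Definition xperm n (w : 'S_n) (f : fps (xb n) L) : fps (xb n) L :=
  xsubst f (fun i => xvar (w i)).

Definition xlast0 n (f : fps (xb n.+1) L) : fps (xb n) L :=
  xsubst f (fun i => if unlift ord_max i is Some j then xvar j else 0).

Definition bpow n (t : fps (xb n) L) (k : nat) : fps (xb n) L :=
  \prod_(i < k) fgl_add F t (bvar n i).

Definition bpow2 n (t : fps (xb n) L) (k : nat) : fps (xb n) L :=
  if k is k'.+1 then fgl_add F t t * bpow t k' else 1.

Definition hl_fun n (pow : fps (xb n) L -> nat -> fps (xb n) L)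
    (lam : seq nat) : fps (xb n) L :=
  let r := size lam in
  if (r <= n)%N then
    sum_fractions (n - r)`!
      (fun w : 'S_n => xperm w
        (\prod_(i < n | (i < r)%N) pow (xvar i) (nth 0%N lam i) *
         \prod_(i < n | (i < r)%N) \prod_(j < n | (i < j)%N)
           fgl_add F (xvar i) (xvar j)))
      (fun w : 'S_n => xperm w
        (\prod_(i < n | (i < r)%N) \prod_(j < n | (i < j)%N)
           fgl_add F (xvar i) (fgl_opp F (xvar j))))
  else 0.

Definition PL (lam : strictpart) (n : nat) : fps (xb n) L :=
  hl_fun (@bpow n) (val lam).

Definition QL (lam : strictpart) (n : nat) : fps (xb n) L :=
  hl_fun (@bpow2 n) (val lam).

Definition PLplus (lam : strictpart) (n : nat) : fps (xb n) L :=
  if odd n then xlast0 (PL lam n.+1) else PL lam n.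

Definition supersymmetric n (f : fps 'I_n L) : Prop :=
  (forall w : 'S_n, fsubst f (fun i => fvar L (w i)) = f) /\
  (* the first variable plays the role of t *)
  (forall i0 i1 : 'I_n, i0 = 0%N :> nat -> i1 = 1%N :> nat ->
     fsubst f (fun i => if i == i1 then fgl_opp F (fvar L i0)
                        else fvar L i) =
     fsubst f (fun i => if (i == i0) || (i == i1) then 0 else fvar L i)).

Definition Gamma n : set (fps 'I_n L) := [set f | supersymmetric f].

Definition Gamma_plus n : set (fps 'I_n L) :=
  [set f | supersymmetric f /\
     forall i0 : 'I_n, i0 = 0%N :> nat ->
       exists g : fps 'I_n L,
         f - fsubst f (fun i => if i == i0 then 0 else fvar L i) =
         fgl_add F (fvar L i0) (fvar L i0) * g].

End Functions.

Section Limits.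
Variable L : comNzRingType.

(* The coefficient of the monomial [m] in the variables b, a series in x.     *)
Definition bcoef n (f : fps (xb n) L) (m : {mset nat}%mset) : fps 'I_n L :=
  Fps (fun k => f (seq_mset (map inl (k : seq 'I_n) ++ map inr (m : seq nat)))).

Definition over_b (G : forall n, set (fps 'I_n L)) n : set (fps (xb n) L) :=
  [set f | forall m, G n (bcoef f m)].

Definition xfamily := forall n : nat, fps (xb n) L.

Definition projlim (G : forall n, set (fps (xb n) L)) : set xfamily :=
  [set f | forall n, G n (f n) /\ xlast0 (f n.+1) = f n].

Definition bscalar n (c : fps nat L) : fps (xb n) L := fsubst c (bvar L n).

(* [s] is the sum of the family [u], convergent coefficient by coefficient.   *)
Definition formal_sum (V I : choiceType) (u : I -> fps V L) (s : fps V L) :=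
  forall m, finite_set [set i | u i m != 0] /\
            s m = \sum_(i \in [set: I]) u i m.

Definition formal_lincomb (I : choiceType) (e : I -> xfamily)
    (c : I -> fps nat L) (f : xfamily) : Prop :=
  forall n, formal_sum (fun i => bscalar n (c i) * e i n) (f n).

Definition formal_basis (M : set xfamily) (I : choiceType)
    (e : I -> xfamily) : Prop :=
  [/\ forall i, M (e i),
      forall c : I -> fps nat L, exists f, formal_lincomb e c f &
      forall f, M f -> exists! c : I -> fps nat L, formal_lincomb e c f].

End Limits.

(* Main.v *)
(* Let A be the ring of polynomials over Z with one variable for each element *)
(* of L; evaluation maps it onto L. By Lazard's lemma on symmetric 2-cocycles *)
(* one builds, degree by degree, a logarithm over the rationals whose group   *)
(* law has coefficients in A, lifts F, and has the variable attached to       *)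
(* a_(1,1) as its coefficient of u v. By universality L is a retract of A, so *)
(* L has no torsion and a_(1,1) is regular modulo 2.                          *)
(*                                                                            *)
(* Multiplied by W = \prod_(i != j) (x_i +_F \bar x_j), the sum over S_n that *)
(* defines P_lambda or Q_lambda becomes (n - r)! times a sum over the         *)
(* injections of {1, ..., r} into {1, ..., n}. That sum is symmetric and      *)
(* vanishes for x_i = x_j, which makes it divisible by W. Setting             *)
(* x_b = \bar x_a, or x_a = 0, kills the injections that reach the            *)
(* specialized variables: this yields supersymmetry and stability.            *)
(*                                                                            *)
(* Giving the variables increasing weights x_1 < ... < x_n < b_j, the initial *)
(* monomial of P_lambda or Q_lambda is x^lambda, by the rearrangement         *)
(* inequality, with coefficient 1 or 2^r. Conversely, the coefficient of      *)
(* t^(2k) in f(t, \bar t, ...) = f(0, 0, ...) shows that a supersymmetric     *)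
(* series whose coefficients of degree < d vanish at the monomials x^mu with  *)
(* mu strict has order at least d. For f in Gamma_+ of order |mu|, the        *)
(* series obtained from f by dropping the monomials without some x_i, i <= r, *)
(* is divisible by \prod_(i <= r) (x_i +_F x_i), these factors being coprime  *)
(* since 2 is regular modulo each of them; hence 2^r divides the coefficient  *)
(* of x^mu. The coordinates of f can then be solved for recursively.          *)

Require Import Defs.
From HB Require Import structures.
From mathcomp Require Import all_boot all_order all_algebra all_fingroup.
From mathcomp Require Import finmap multiset.
From mathcomp Require Import boolp classical_sets functions cardinality fsbigop.
From mathcomp Require Import zify ring.

Set Implicit Arguments.
Unset Strict Implicit.
Unset Printing Implicit Defensive.

Import GRing.Theory.

Local Open Scope classical_set_scope.
Local Open Scope ring_scope.

(** * Formal power series *)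

(** Both statements are instances of one triangularity criterion, [leading_formal_basis]. Let the
    member [e lam] of a family start with [w lam] times x^lam. Comparing the coefficients of x^mu
    b^m for strict mu, the unknown coefficients of a formal combination equal to f satisfy a linear
    system which, by [scoef_triangular], is triangular for the order [rank] with [w mu] on the
    diagonal. Uniqueness holds because [w mu] is regular. Existence holds because the right-hand
    sides are divisible by [w mu], and because a supersymmetric series is determined by its
    coefficients at strict monomials ([Gamma_vanish]).

    The leading terms are computed in [hl_fun_init]. For P the leading coefficient is 1, so
    divisibility is free. For Q it is 2^r, and [Gamma_plus_divisible] provides the divisibility in
    the ring Gamma_+.

    The fractions in the definition of P and Q are removed by [hl_funP]: the function times the
    common denominator W is a sum over injections. [hl_fun_specialize] compares the two sides of
    this identity after a substitution; supersymmetry and stability are its cases [hl_fun_minus] and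
    [hl_fun_zero], and [hl_fun_zero_dvd] gives the divisibility condition that defines Gamma_+.

    The Lazard ring enters through [lazard_regular]: it has no torsion, and a_(1,1) z in 2L implies
    z in 2L. This rests on Lazard's lemma [symmetric_cocycle], which makes it possible to lift F
    along the evaluation map from a polynomial ring over Z onto L ([fgl_lift]); universality then
    splits that map. *)

Lemma fsbig_setT_seq (T : choiceType) (R : nmodType) (s : seq T) (F : T -> R) :
  uniq s -> (forall k, k \notin s -> F k = 0) ->
  \sum_(k \in [set: T]) F k = \sum_(k <- s) F k.
Proof.
move=> us F0; rewrite (@fsbigE _ _ _ _ _ s) //; last by move=> k _; exact: F0.
by apply: eq_bigl => k; rewrite in_setT.
Qed.

Lemma eq_big_support (T : choiceType) (R : nmodType) (s t : seq T) (F : T -> R) :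
  uniq s -> uniq t -> (forall k, F k != 0 -> (k \in s) = (k \in t)) ->
  \sum_(k <- s) F k = \sum_(k <- t) F k.
Proof.
move=> us ut st.
have nz r : \sum_(k <- r) F k = \sum_(k <- r | F k != 0) F k.
  rewrite (bigID (fun k => F k != 0)) /= [X in _ + X]big1 ?addr0 //.
  by move=> k /negbNE/eqP.
rewrite !nz -big_filter -[RHS]big_filter; apply: perm_big; apply: uniq_perm.
- exact: filter_uniq.
- exact: filter_uniq.
by move=> k; rewrite !mem_filter; case: (boolP (F k != 0)) => //= /st.
Qed.

(** * Monomials as multisets, with weights and degrees *)

Section Monomials.
Variable V : choiceType.
Implicit Types (k m p : {mset V}%mset) (w : V -> nat).

Lemma msub_add k m : (k `<=` m)%mset -> exists l, m = (k `+` l)%mset.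
Proof. by move=> km; exists (m `\` k)%mset; rewrite msetBDKC. Qed.

Lemma msetB_add k l : ((k `+` l) `\` k = l)%mset.
Proof. exact: msetDKB. Qed.

Lemma msetDI k : injective (msetD k).
Proof. exact: can_inj (@msetDKB _ k). Qed.

Lemma perm_msetD k m : perm_eq (k `+` m)%mset (k ++ m).
Proof.
apply/allP => x _ /=; apply/eqP.
by rewrite count_cat !count_mem_mset msetE2.
Qed.

Lemma mset_evalD (A : comNzRingType) (g : V -> A) k m :
  mset_eval g (k `+` m)%mset = mset_eval g k * mset_eval g m.
Proof. by rewrite /mset_eval (perm_big _ (perm_msetD k m)) big_cat. Qed.

Lemma mset_eval0 (A : comNzRingType) (g : V -> A) : mset_eval g mset0 = 1.
Proof. by rewrite /mset_eval enum_mset0 big_nil. Qed.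

Lemma mset_evaln (A : comNzRingType) (g : V -> A) n v :
  mset_eval g (msetn n v) = g v ^+ n.
Proof.
rewrite /mset_eval enum_msetn; elim: n => [|n IH]; rewrite ?big_nil //=.
by rewrite big_cons exprS IH.
Qed.

Lemma mset_eval1 (A : comNzRingType) (g : V -> A) v :
  mset_eval g [mset v]%mset = g v.
Proof. exact: mset_evaln. Qed.

Lemma mset_ind (P : {mset V}%mset -> Prop) :
  P mset0 -> (forall v m, P m -> P (v +` m)%mset) -> forall m, P m.
Proof.
move=> P0 PS m; rewrite -(seq_mset_id m); elim: (enum_mset m) => [|v s IH].
  suff -> : seq_mset [::] = mset0 :> {mset V}%mset by [].
  by apply/msetP => x; rewrite mset_seqE mset0E.
by rewrite mset_cons; exact: PS.
Qed.

Definition wt w m : nat := \sum_(v <- m) w v.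

Lemma wtD w k m : wt w (k `+` m)%mset = (wt w k + wt w m)%N.
Proof. by rewrite /wt (perm_big _ (perm_msetD k m)) big_cat. Qed.

Lemma wt0 w : wt w mset0 = 0%N.
Proof. by rewrite /wt enum_mset0 big_nil. Qed.

Lemma wtn w n v : wt w (msetn n v) = (n * w v)%N.
Proof.
by rewrite /wt enum_msetn big_nseq; elim: n => //= n ->; rewrite mulSn.
Qed.

Lemma wt1 w v : wt w [mset v]%mset = w v.
Proof. by rewrite wtn mul1n. Qed.

Lemma wt_sub w k m : (k `<=` m)%mset -> (wt w k <= wt w m)%N.
Proof. by move=> /msub_add[l ->]; rewrite wtD leq_addr. Qed.

Definition deg m : nat := size m.

Lemma degE m : deg m = wt (fun=> 1%N) m.
Proof. by rewrite /wt /deg sum1_size. Qed.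

Lemma degD k m : deg (k `+` m)%mset = (deg k + deg m)%N.
Proof. by rewrite !degE wtD. Qed.

Lemma deg0 : deg mset0 = 0%N.
Proof. by rewrite degE wt0. Qed.

Lemma degn n v : deg (msetn n v) = n.
Proof. by rewrite degE wtn muln1. Qed.

Lemma deg_eq0 m : (deg m == 0%N) = (m == mset0).
Proof. exact: size_mset_eq0. Qed.

Lemma mem_mset_split v m : v \in m -> exists l, m = (v +` l)%mset.
Proof. by move=> vm; exists (m `\ v)%mset; rewrite msetB1K. Qed.

Lemma mset_le_deg m v : (m v <= deg m)%N.
Proof. by rewrite -count_mem_mset /deg count_size. Qed.

End Monomials.

(** Sealed copy of [fvar], so that unification does not unfold a variable into its coefficient
    function. *)
HB.lock Definition pvar (V : choiceType) (R : comNzRingType) (v : V) : fps V R :=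
  fvar R v.
Arguments pvar {V} R v.

Lemma pvarE (V : choiceType) (R : comNzRingType) : @fvar V R = pvar R.
Proof. by rewrite pvar.unlock. Qed.

Lemma pvar_coef (V : choiceType) (R : comNzRingType) (v : V) m :
  pvar R v m = (m == [mset v]%mset)%:R.
Proof. by rewrite -pvarE. Qed.

(** * Coefficients, the order filtration and initial monomials *)

Section Coefficients.
Variables (V : choiceType) (R : comNzRingType).
Implicit Types (f g h : fps V R) (k m p : {mset V}%mset) (w : V -> nat).

Lemma fcoefM f g m : (f * g) m = \sum_(k <- msubs m) f k * g (m `\` k)%mset.
Proof. by []. Qed.

Lemma fcoefD f g m : (f + g) m = f m + g m. Proof. by []. Qed.
Lemma fcoefN f m : (- f) m = - f m. Proof. by []. Qed.
Lemma fcoefB f g m : (f - g) m = f m - g m. Proof. by []. Qed.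
Lemma fcoef0 m : (0 : fps V R) m = 0. Proof. by []. Qed.
Lemma fcoef1 m : (1 : fps V R) m = (m == mset0)%:R. Proof. by []. Qed.

Lemma fcoef_sum I (r : seq I) (P : pred I) (E : I -> fps V R) m :
  (\sum_(i <- r | P i) E i) m = \sum_(i <- r | P i) E i m.
Proof. by elim/big_rec2: _ => // i x y _ <-. Qed.

Lemma fcoefMn f n m : (f *+ n) m = f m *+ n.
Proof. by elim: n => //= n IH; rewrite !mulrS fcoefD IH. Qed.

Definition fpsX m : fps V R := mset_eval (pvar R) m.

Lemma fpsXD k m : fpsX (k `+` m)%mset = fpsX k * fpsX m.
Proof. exact: mset_evalD. Qed.

Lemma coef_varM v f m :
  (pvar R v * f) m = if v \in m then f (m `\ v)%mset else 0.
Proof.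
rewrite fcoefM; case: (boolP (v \in m)) => vm.
  rewrite (bigD1_seq [mset v]%mset) ?msubs_uniq ?mem_msubs ?msub1set //=.
  rewrite pvar_coef eqxx mul1r big1 ?addr0 // => k; rewrite pvar_coef => /negPf ->; exact: mul0r.
rewrite big_seq big1 // => k; rewrite mem_msubs => km.
rewrite pvar_coef; case: eqP km => [->|_ _]; last exact: mul0r.
by rewrite msub1set (negPf vm).
Qed.

Lemma coef_XM p f m :
  (fpsX p * f) m = if (p `<=` m)%mset then f (m `\` p)%mset else 0.
Proof.
elim/mset_ind: p m => [|v p IH] m.
  by rewrite /fpsX mset_eval0 mul1r msub0set msetB0.
rewrite fpsXD /fpsX mset_eval1 -/(fpsX p) -mulrA coef_varM.
case: (boolP (v \in m)) => [/mem_mset_split[l ->]|vm].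
  rewrite IH msetB_add; have -> : (v +` p `<=` v +` l)%mset = (p `<=` l)%mset.
    by apply/msubsetP/msubsetP => pl x; have := pl x; rewrite !msetE2 leq_add2l.
  by rewrite msetBDl.
case: ifP => // /msubsetP/(_ v); rewrite !msetE2 msetnxx.
by move: vm => /mset_eq0P ->.
Qed.

Lemma coef_XM_add p f m : (fpsX p * f) (p `+` m)%mset = f m.
Proof.
rewrite coef_XM msetB_add ifT //.
by apply/msubsetP => x; rewrite msetE2 leq_addr.
Qed.

Lemma coef_X p m : fpsX p m = (m == p)%:R.
Proof.
rewrite -[fpsX p]mulr1 coef_XM fcoef1.
case: ifP => [/msub_add[l ->]|pm]; last first.
  by case: eqP pm => [->|//]; rewrite msubset_refl.
rewrite msetB_add; congr (_%:R); apply: congr1; apply/eqP/eqP => [->|].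
  by rewrite msetD0.
by move=> /(congr1 (msetB^~ p)); rewrite msetB_add msetBxx.
Qed.

Definition fpsC (c : R) : fps V R := Fps (fun m => if m == mset0 then c else 0).

Lemma coef_CM c f m : (fpsC c * f) m = c * f m.
Proof.
rewrite fcoefM (bigD1_seq mset0) ?msubs_uniq ?mem_msubs ?msub0set //=.
rewrite eqxx msetB0 big1 ?addr0 // => k /negPf ->; exact: mul0r.
Qed.

Lemma fpsCE c m : fpsC c m = c *+ (m == mset0).
Proof. by rewrite /=; case: eqP. Qed.

Fact fpsC_zmod : zmod_morphism fpsC.
Proof. by move=> a b; apply/fpsP => m; rewrite fcoefB !fpsCE mulrnBl. Qed.

Fact fpsC_monoid : monoid_morphism fpsC.
Proof.
split=> [|a b]; apply/fpsP => m; rewrite ?coef_CM !fpsCE ?mulrnAr //.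
Qed.

HB.instance Definition _ :=
  GRing.isZmodMorphism.Build R (fps V R) fpsC fpsC_zmod.
HB.instance Definition _ :=
  GRing.isMonoidMorphism.Build R (fps V R) fpsC fpsC_monoid.

(** The filtration by weight: f has order at least d. For the constant weight 1 this is the usual
    order. *)
Definition vge w d f := forall m, (wt w m < d)%N -> f m = 0.

Lemma vge0 w f : vge w 0 f. Proof. by []. Qed.

Lemma vgeW w d e f : (e <= d)%N -> vge w d f -> vge w e f.
Proof. by move=> ed fd m me; apply: fd; apply: leq_trans me ed. Qed.

Lemma vge_zero w d : vge w d (0 : fps V R). Proof. by []. Qed.

Lemma vgeD w d f g : vge w d f -> vge w d g -> vge w d (f + g).
Proof. by move=> fd gd m md; rewrite fcoefD fd // gd // addr0. Qed.

Lemma vgeN w d f : vge w d f -> vge w d (- f).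
Proof. by move=> fd m md; rewrite fcoefN fd // oppr0. Qed.

Lemma vgeB w d f g : vge w d f -> vge w d g -> vge w d (f - g).
Proof. by move=> fd gd; apply: vgeD => //; exact: vgeN. Qed.

Lemma vge_sum w d I (r : seq I) (P : pred I) (E : I -> fps V R) :
  (forall i, P i -> vge w d (E i)) -> vge w d (\sum_(i <- r | P i) E i).
Proof.
by move=> H m md; rewrite fcoef_sum big1 // => i Pi; exact: H.
Qed.

Lemma vgeM w d e f g : vge w d f -> vge w e g -> vge w (d + e) (f * g).
Proof.
move=> fd ge m mde; rewrite fcoefM big_seq big1 // => k.
rewrite mem_msubs => /msub_add[l lE]; rewrite lE msetB_add.
have [kd|dk] := ltnP (wt w k) d; first by rewrite fd // mul0r.
rewrite ge ?mulr0 //; move: mde; rewrite lE wtD; lia.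
Qed.

Lemma vgeMl w d f g : vge w d f -> vge w d (f * g).
Proof. by move=> fd; rewrite -(addn0 d); apply: vgeM. Qed.

Lemma vgeMr w d f g : vge w d g -> vge w d (f * g).
Proof. by rewrite mulrC; exact: vgeMl. Qed.

Lemma vgeX w d f n : vge w d f -> vge w (n * d) (f ^+ n).
Proof.
move=> fd; elim: n => // n IH; rewrite exprS mulSn; exact: vgeM.
Qed.

Lemma vge_eq0 w f : (forall d, vge w d f) -> f = 0.
Proof. by move=> H; apply/fpsP => m; rewrite (H (wt w m).+1). Qed.

Lemma vge_var w v : vge w (w v) (pvar R v).
Proof.
move=> m md; rewrite pvar_coef; case: eqP md => // ->; by rewrite wt1 ltnn.
Qed.

Lemma vge_nconst f : f mset0 = 0 <-> vge (fun=> 1%N) 1 f.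
Proof.
split=> [f0 m|H]; last by apply: H; rewrite wt0.
by rewrite ltnS leqn0 -degE deg_eq0 => /eqP ->.
Qed.

(** That is, f equals c X^p plus terms of strictly larger weight. The monomial p is alone in its
    weight, which makes initial terms multiplicative. *)
Definition init w f c p :=
  f p = c /\ forall m, (wt w m <= wt w p)%N -> m != p -> f m = 0.

Lemma init_vge w f c p : init w f c p -> vge w (wt w p) f.
Proof.
case=> _ f0 m mp; apply: f0; first exact: ltnW.
by apply: contraTneq mp => ->; rewrite ltnn.
Qed.

Lemma init_eqD w f g c p :
  init w f c p -> vge w (wt w p).+1 g -> init w (f + g) c p.
Proof.
move=> [fc f0] g0; split=> [|m mp mne].
  by rewrite fcoefD fc g0 ?addr0.
by rewrite fcoefD f0 // g0 ?addr0 // ltnS.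
Qed.

(** If k and l contribute to the product in weight at most that of p + q, both must have minimal
    weight, so k = p and l = q. *)
Lemma initM w f g c d p q :
  init w f c p -> init w g d q -> init w (f * g) (c * d) (p `+` q)%mset.
Proof.
move=> fi gi; have [fc f0] := fi; have [gd g0] := gi.
have key m k : (wt w m <= wt w (p `+` q)%mset)%N -> (k `<=` m)%mset ->
    f k * g (m `\` k)%mset != 0 -> k = p /\ m = (p `+` q)%mset.
  move=> mpq /msub_add[l lE]; move: mpq; rewrite lE msetB_add !wtD => mpq nz.
  have kp : (wt w p <= wt w k)%N.
    rewrite leqNgt; apply: contra_neqN nz => kp.
    by rewrite (init_vge fi) // mul0r.
  have lq : (wt w q <= wt w l)%N.
    rewrite leqNgt; apply: contra_neqN nz => lq.
    by rewrite (init_vge gi) // mulr0.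
  have ekp : k = p.
    apply/eqP; apply: contra_neqT nz => ne.
    by rewrite f0 ?mul0r //; lia.
  have elq : l = q.
    apply/eqP; apply: contra_neqT nz => ne.
    by rewrite g0 ?mulr0 //; lia.
  by rewrite ekp elq.
split=> [|m mpq mne].
  rewrite fcoefM (bigD1_seq p) ?msubs_uniq ?mem_msubs //=; last first.
    by apply/msubsetP => x; rewrite msetE2 leq_addr.
  rewrite msetB_add fc gd big_seq_cond big1 ?addr0 // => k.
  rewrite mem_msubs => /andP[kpq kp]; apply/eqP; apply: contraNT kp => nz.
  by apply/eqP; have [] := key _ _ (leqnn _) kpq nz.
rewrite fcoefM big_seq big1 // => k; rewrite mem_msubs => km.
apply/eqP; apply: contraNT mne => nz; apply/eqP.
by have [] := key _ _ mpq km nz.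
Qed.

Lemma init1 w : init w 1 1 mset0.
Proof.
by split=> [|m _ /negPf mne]; rewrite fcoef1 ?eqxx ?mne.
Qed.

Lemma init_prod w (I : Type) (r : seq I) (P : pred I) (E : I -> fps V R)
    (c : I -> R) (p : I -> {mset V}%mset) :
  (forall i, P i -> init w (E i) (c i) (p i)) ->
  init w (\prod_(i <- r | P i) E i) (\prod_(i <- r | P i) c i)
         (\big[@msetD V/mset0]_(i <- r | P i) p i).
Proof.
move=> H; elim: r => [|i r IH]; first by rewrite !big_nil; exact: init1.
by rewrite !big_cons; case: ifP => // Pi; apply: initM => //; exact: H.
Qed.

Lemma init_var w v : init w (pvar R v) 1 [mset v]%mset.
Proof.
by split=> [|m _ /negPf mne]; rewrite pvar_coef ?eqxx ?mne.
Qed.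

Lemma initMn w f n c p : init w f c p -> init w (f *+ n) (c *+ n) p.
Proof.
by move=> [fc f0]; split=> [|m mp mne]; rewrite fcoefMn ?fc ?f0 ?mul0rn.
Qed.

Lemma initN w f c p : init w f c p -> init w (- f) (- c) p.
Proof.
by move=> [fc f0]; split=> [|m mp mne]; rewrite fcoefN ?fc ?f0 ?oppr0.
Qed.

(** Here K is an ideal modulo which c is regular. The coefficient of f h at p + m is c times that of
    h at m, plus products f_k h_l with k heavier than p, hence l lighter than m, to which the
    induction on weight applies. The ideals used are 0 and 2L. *)
Lemma mul_init_ideal w f h c p d (K : R -> Prop) :
  K 0 -> (forall a b, K a -> K b -> K (a - b)) -> (forall a b, K b -> K (a * b)) ->
  (forall z, K (c * z) -> K z) -> init w f c p ->
  (forall m, (wt w m < d + wt w p)%N -> K ((f * h) m)) ->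
  forall m, (wt w m < d)%N -> K (h m).
Proof.
move=> K0 KB KM Kc [fc f0] Kfh.
have KD a b : K a -> K b -> K (a + b).
  by move=> Ka Kb; rewrite -(opprK b) -[- b]sub0r; apply: (KB) => //; apply: KB.
move=> m; move: {2}(wt w m) (leqnn (wt w m)) => e.
elim/ltn_ind: e m => e IH m me md.
apply: Kc.
have := Kfh (p `+` m)%mset; rewrite wtD addnC ltn_add2r => /(_ md).
rewrite fcoefM (bigD1_seq p) ?msubs_uniq ?mem_msubs //=; last first.
  by apply/msubsetP => x; rewrite msetE2 leq_addr.
rewrite msetB_add fc => /KB H; rewrite -[c * _](addrK
  (\sum_(i <- msubs (p `+` m)%mset | i != p) f i * h ((p `+` m) `\` i)%mset)).
apply: H; rewrite big_seq_cond; elim/big_rec: _ => // k a.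
rewrite mem_msubs => /andP[/msub_add[l lE] kp] Ka; apply: KD => //.
rewrite lE msetB_add.
have [kle|klt] := leqP (wt w k) (wt w p); first by rewrite f0 // mul0r.
have lm : (wt w l < wt w m)%N.
  by have := congr1 (wt w) lE; rewrite !wtD; lia.
by apply: KM; apply: (IH (wt w l)) => //; lia.
Qed.

Lemma mul_init_vge w f h c p d :
  (forall z, c * z = 0 -> z = 0) -> init w f c p ->
  vge w (d + wt w p) (f * h) -> vge w d h.
Proof.
move=> rc fi fh; apply: (mul_init_ideal _ _ _ rc fi fh) => //.
  by move=> a b -> ->; rewrite subr0.
by move=> a b ->; rewrite mulr0.
Qed.

Lemma init_regular w f c p :
  (forall z, c * z = 0 -> z = 0) -> init w f c p ->
  forall h, f * h = 0 -> h = 0.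
Proof.
move=> rc fi h fh0; apply: (@vge_eq0 w) => d.
by apply: (mul_init_vge rc fi); rewrite fh0.
Qed.

Lemma init_div w f h c e p q :
  (forall z, c * z = 0 -> z = 0) -> init w f c p ->
  init w (f * h) (c * e) (p `+` q)%mset -> init w h e q.
Proof.
move=> rc fi fhi; have [fc f0] := fi; have [fhc fh0] := fhi.
have hq : vge w (wt w q) h.
  apply: (mul_init_vge rc fi); rewrite addnC -wtD; exact: init_vge fhi.
have ch m : (wt w m <= wt w q)%N -> (f * h) (p `+` m)%mset = c * h m.
  move=> mq; rewrite fcoefM (bigD1_seq p) ?msubs_uniq ?mem_msubs //=; last first.
    by apply/msubsetP => x; rewrite msetE2 leq_addr.
  rewrite msetB_add fc big_seq_cond big1 ?addr0 // => k.
  rewrite mem_msubs => /andP[/msub_add[l lE] kp]; rewrite lE msetB_add.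
  have [kle|klt] := leqP (wt w k) (wt w p); first by rewrite f0 // mul0r.
  rewrite hq ?mulr0 //.
  by have := congr1 (wt w) lE; rewrite !wtD; lia.
have inj z z' : c * z = c * z' -> z = z'.
  move=> /eqP; rewrite -subr_eq0 -mulrBr => /eqP /rc /eqP.
  by rewrite subr_eq0 => /eqP.
split=> [|m mq mne]; first by apply: inj; rewrite -ch.
apply: inj; rewrite -ch // mulr0 fh0 ?wtD ?leq_add2l //.
by apply: contra_neq mne => /msetDI.
Qed.

End Coefficients.

(** * Substitution *)

(* Sealed versions of the substitution operators: the unifier would otherwise *)
(* unfold them down to computations on multisets.                             *)
HB.lock Definition psub (V W : choiceType) (R : comNzRingType) (f : fps V R)
  (g : V -> fps W R) : fps W R := fsubst f g.
HB.lock Definition fadd (R : comNzRingType) (F : fps 'I_2 R) (V : choiceType)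
  (a b : fps V R) : fps V R := fgl_add F a b.
HB.lock Definition fopp (R : comNzRingType) (F : fps 'I_2 R) (V : choiceType)
  (a : fps V R) : fps V R := fgl_opp F a.

Section Unlock.
Variables (V W : choiceType) (R : comNzRingType) (F : fps 'I_2 R).
Lemma psubE : @fsubst V W R = @psub V W R.
Proof. by rewrite psub.unlock. Qed.
Lemma faddE : @fgl_add R F V = @fadd R F V.
Proof. by rewrite fadd.unlock. Qed.
Lemma foppE : @fgl_opp R F V = @fopp R F V.
Proof. by rewrite fopp.unlock. Qed.
Lemma fadd_psub (a b : fps V R) :
  fadd F a b = psub F (fun i => if i == ord0 then a else b).
Proof. by rewrite -faddE psub.unlock. Qed.
Lemma fopp_psub (a : fps V R) : fopp F a = psub (fgl_inv F) (fun=> a).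
Proof. by rewrite -foppE psub.unlock. Qed.
Lemma psub_coef (f : fps V R) (g : V -> fps W R) m :
  psub f g m = \sum_(k \in [set: {mset V}%mset]) f k * mset_eval g k m.
Proof. by rewrite -psubE. Qed.
End Unlock.

Section Substitution.
Variables (V W : choiceType) (R : comNzRingType).
Implicit Types (f : fps V R) (g : V -> fps W R).

Definition nconst (U : choiceType) (f : fps U R) := f mset0 = 0.

(** Together these conditions leave finitely many contributions to each coefficient of [psub f g],
    even with infinitely many variables b_j. *)
Definition admissible g :=
  (forall v, nconst (g v)) /\ (forall m, finite_set [set v | g v m != 0]).

Lemma coefM_neq0 (U : choiceType) (f g : fps U R) m : (f * g) m != 0 ->
  exists k l, [/\ m = (k `+` l)%mset, f k != 0 & g l != 0].
Proof.
move=> nz; apply: contrapT => H; move/eqP: nz; apply.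
rewrite fcoefM big_seq big1 // => k; rewrite mem_msubs => /msub_add[l lE].
rewrite lE msetB_add.
have [fk|fk] := eqVneq (f k) 0; first by rewrite fk mul0r.
have [gl|gl] := eqVneq (g l) 0; first by rewrite gl mulr0.
by case: H; exists k, l.
Qed.

Lemma mset_eval_neq0 g k m : mset_eval g k m != 0 -> forall v, v \in k ->
  exists2 a, (a `<=` m)%mset & g v a != 0.
Proof.
elim/mset_ind: k m => [|u k IH] m; first by move=> _ v; rewrite in_mset0.
rewrite mset_evalD mset_eval1 => /coefM_neq0[a [b [-> ga kb]]] v.
rewrite in_mset1D => /orP[/eqP ->|vk].
  by exists a => //; apply/msubsetP => x; rewrite msetE2 leq_addr.
have [c cb gc] := IH _ kb v vk; exists c => //.
apply: msubset_trans cb _; apply/msubsetP => x.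
by rewrite msetE2 leq_addl.
Qed.

Lemma vge_mset_eval w g d k : (forall v, vge w d (g v)) ->
  vge w (d * deg k) (mset_eval g k).
Proof.
move=> gd; elim/mset_ind: k => [|v k IH]; first by rewrite deg0 muln0.
rewrite mset_evalD mset_eval1 degD -[X in vge w X]addn0 addn0 mulnDr.
rewrite degn muln1; exact: vgeM.
Qed.

Lemma deg_mset_eval g k : (forall v, nconst (g v)) ->
  vge (fun=> 1%N) (deg k) (mset_eval g k).
Proof.
by move=> H; rewrite -(mul1n (deg k)); apply: vge_mset_eval => v; apply/vge_nconst/H.
Qed.

(** A contributing k involves only variables v such that g v has a nonzero coefficient at some
    divisor of m, and there are finitely many of them; its degree is at most that of m, the g v
    having no constant term. So M may be any monomial containing each of these variables at least
    deg m times, and substitution becomes a finite sum over [msubs M]. *)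
Lemma admissible_bound g m : admissible g ->
  exists M : {mset V}%mset, forall k a, (a `<=` m)%mset ->
    mset_eval g k a != 0 -> (k `<=` M)%mset.
Proof.
move=> [g0 gfin].
have [s sP] : exists s : seq V, forall v a, (a `<=` m)%mset -> g v a != 0 -> v \in s.
  have [s sP] : exists s : seq V, forall v a, a \in msubs m -> g v a != 0 -> v \in s.
    elim: (msubs m) => [|b r [s sP]]; first by exists [::].
    have [t tP] : exists t : seq V, forall v, g v b != 0 -> v \in t.
      exists (fset_set [set v | g v b != 0]) => v gv.
      by rewrite in_fset_set ?inE.
    exists (s ++ t) => v a; rewrite inE mem_cat => /orP[/eqP -> /tP ->|ar gva].
      by rewrite orbT.
    by rewrite (sP v a).
  by exists s => v a am; apply: sP; rewrite mem_msubs.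
exists (seq_mset (flatten (nseq (deg m) s))) => k a am nz.
apply/msubsetP => v; rewrite mset_seqE count_flatten map_nseq sumn_nseq.
have [vk|] := boolP (v \in k); last by move/mset_eq0P ->.
have [b ba gb] := mset_eval_neq0 nz vk.
have vs : (0 < count_mem v s)%N.
  by rewrite -has_count has_pred1; apply: sP gb; apply: msubset_trans ba am.
have km : (deg k <= deg m)%N.
  rewrite leqNgt; apply: contra_neqN nz => mk; apply: (deg_mset_eval (k := k)) => //.
  by rewrite -degE; apply: leq_ltn_trans mk; rewrite !degE; exact: wt_sub.
apply: leq_trans (leq_trans (mset_le_deg k v) km) _.
by rewrite leq_pmull.
Qed.

Lemma coef_psub f g m a (M : {mset V}%mset) :
  (forall k a, (a `<=` m)%mset -> mset_eval g k a != 0 -> (k `<=` M)%mset) ->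
  (a `<=` m)%mset ->
  psub f g a = \sum_(k <- msubs M) f k * mset_eval g k a.
Proof.
move=> HM am; rewrite psub_coef; apply: fsbig_setT_seq; first exact: msubs_uniq.
move=> k; rewrite mem_msubs => kM; apply/eqP; apply: contraNT kM => nz.
by apply: HM am _; apply: contra_neq nz => ->; rewrite mulr0.
Qed.

Lemma psub_is_zmod g : admissible g -> zmod_morphism (fun f => psub f g).
Proof.
move=> ag f f'; apply/fpsP => m; have [M HM] := admissible_bound m ag.
rewrite fcoefB !(coef_psub _ HM) ?msubset_refl // -sumrB.
by apply: eq_bigr => k _; rewrite fcoefB mulrBl.
Qed.

(* Both sides are the sum of [f j * f' l * phi (j `+` l)] over all pairs.     *)
Lemma convolution_sum (A : comNzRingType) (T : choiceType) (f f' : fps T A)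
    (phi : {mset T}%mset -> A) (K J J' : seq {mset T}%mset) :
  uniq K -> uniq J -> uniq J' ->
  (forall j l, f j * f' l * phi (j `+` l)%mset != 0 ->
    [/\ j \in J, l \in J' & (j `+` l)%mset \in K]) ->
  \sum_(k <- K) (f * f') k * phi k =
  \sum_(j <- J) \sum_(l <- J') f j * f' l * phi (j `+` l)%mset.
Proof.
move=> uK uJ uJ' H; pose t (p : {mset T}%mset * {mset T}%mset) :=
  f p.1 * f' p.2 * phi (p.1 `+` p.2)%mset.
rewrite (_ : \sum_(j <- J) _ = \sum_(p <- [seq (j, l) | j <- J, l <- J']) t p); last by rewrite big_allpairs.
transitivity (\sum_(p <- [seq (j, (k `\` j)%mset) | k <- K, j <- msubs k]) t p).
  rewrite big_allpairs_dep; apply: eq_bigr => k _; rewrite fcoefM mulr_suml.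
  rewrite big_seq [RHS]big_seq; apply: eq_bigr => j.
  by rewrite mem_msubs => /msub_add[l ->]; rewrite msetB_add.
apply: eq_big_support => [||[j l]].
- apply: allpairs_uniq_dep => // [k _|]; first exact: msubs_uniq.
  move=> [k j] [k' j'] /allpairsPdep[x [y [_ yx [-> ->]]]].
  move=> /allpairsPdep[x' [y' [_ yx' [-> ->]]]] [yy' e].
  move: yx yx' e; rewrite !mem_msubs yy' => /msub_add[z ->] /msub_add[z' ->].
  by rewrite !msetB_add => ->.
- by apply: allpairs_uniq => // -[a b] [c d].
move=> /[dup] nz /H[jJ lJ' jlK]; rewrite [RHS](_ : _ = true); last first.
  by apply/allpairsP; exists (j, l).
apply/allpairsPdep; exists (j `+` l)%mset, j; split=> //; last by rewrite msetB_add.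
by rewrite mem_msubs; apply/msubsetP => x; rewrite msetE2 leq_addr.
Qed.

Lemma psubM g : admissible g -> {morph (fun f => psub f g) : x y / x * y}.
Proof.
move=> ag f f'; apply/fpsP => m; have [M HM] := admissible_bound m ag.
rewrite (coef_psub _ HM) ?msubset_refl //.
rewrite (@convolution_sum _ _ _ _ _ _ (msubs M) (msubs M)) ?msubs_uniq //; last first.
  move=> j l nz; have jlM : (j `+` l `<=` M)%mset.
    by apply: (HM _ m); rewrite ?msubset_refl //; apply: contra_neq nz => ->; rewrite mulr0.
  rewrite !mem_msubs; split=> //; apply: msubset_trans jlM;
    by apply/msubsetP => x; rewrite msetE2 ?leq_addr ?leq_addl.
rewrite fcoefM.
transitivity (\sum_(a <- msubs m) \sum_(j <- msubs M) \sum_(l <- msubs M)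
    f j * f' l * (mset_eval g j a * mset_eval g l (m `\` a)%mset)).
  rewrite [RHS]exchange_big; apply: eq_bigr => j _ /=.
  rewrite [RHS]exchange_big; apply: eq_bigr => l _ /=.
  by rewrite mset_evalD fcoefM mulr_sumr.
rewrite big_seq [RHS]big_seq; apply: eq_bigr => a; rewrite mem_msubs => am.
rewrite !(coef_psub _ HM) //; last first.
  by apply/msubsetP => x; rewrite msetE2 leq_subr.
rewrite mulr_suml; apply: eq_bigr => j _; rewrite mulr_sumr; apply: eq_bigr => l _.
by rewrite mulrACA.
Qed.

Lemma psub_X g k : admissible g -> psub (fpsX R k) g = mset_eval g k.
Proof.
move=> ag; apply/fpsP => m; rewrite psub_coef (@fsbig_setT_seq _ _ [:: k]) //.
  by rewrite big_seq1 coef_X eqxx mul1r.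
by move=> l; rewrite inE coef_X => /negPf ->; rewrite mul0r.
Qed.

Lemma psub_var g v : admissible g -> psub (pvar R v) g = g v.
Proof. by move=> ag; rewrite -(mset_eval1 (pvar R)) psub_X // mset_eval1. Qed.

Lemma psub1 g : admissible g -> psub 1 g = 1.
Proof. by move=> ag; rewrite -(mset_eval0 (pvar R)) psub_X // mset_eval0. Qed.

Definition subst_of g (ag : admissible g) f := psub f g.

HB.instance Definition _ g (ag : admissible g) :=
  GRing.isZmodMorphism.Build (fps V R) (fps W R) (subst_of ag) (psub_is_zmod ag).
HB.instance Definition _ g (ag : admissible g) :=
  GRing.isMonoidMorphism.Build (fps V R) (fps W R) (subst_of ag)
    (conj (psub1 ag) (psubM ag)).

Section Admissible.
Variables (g : V -> fps W R) (ag : admissible g).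
Lemma psub0 : psub 0 g = 0. Proof. exact: (raddf0 (subst_of ag)). Qed.
Lemma psubD f1 f2 : psub (f1 + f2) g = psub f1 g + psub f2 g.
Proof. exact: (raddfD (subst_of ag)). Qed.
Lemma psubB f1 f2 : psub (f1 - f2) g = psub f1 g - psub f2 g.
Proof. exact: (raddfB (subst_of ag)). Qed.
Lemma psubN f1 : psub (- f1) g = - psub f1 g.
Proof. exact: (raddfN (subst_of ag)). Qed.
Lemma psubMn f1 n : psub (f1 *+ n) g = psub f1 g *+ n.
Proof. exact: (raddfMn (subst_of ag)). Qed.
Lemma psub_sum I (r : seq I) (P : pred I) (E : I -> fps V R) :
  psub (\sum_(i <- r | P i) E i) g = \sum_(i <- r | P i) psub (E i) g.
Proof. exact: (raddf_sum (subst_of ag)). Qed.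
Lemma psub_mul f1 f2 : psub (f1 * f2) g = psub f1 g * psub f2 g.
Proof. exact: psubM. Qed.
Lemma psub_prod I (r : seq I) (P : pred I) (E : I -> fps V R) :
  psub (\prod_(i <- r | P i) E i) g = \prod_(i <- r | P i) psub (E i) g.
Proof. exact: (rmorph_prod (subst_of ag)). Qed.
Lemma psubXn f1 n : psub (f1 ^+ n) g = psub f1 g ^+ n.
Proof. exact: (rmorphXn (subst_of ag)). Qed.

Lemma psubC c : psub (fpsC _ c) g = fpsC _ c.
Proof.
apply/fpsP => m; rewrite psub_coef (@fsbig_setT_seq _ _ [:: mset0]) //.
  by rewrite big_seq1 /= eqxx mset_eval0 fcoef1; case: eqP; rewrite ?mulr1 ?mulr0.
by move=> l; rewrite inE /= => /negPf ->; rewrite mul0r.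
Qed.

Lemma nconst_psub f : nconst f -> nconst (psub f g).
Proof.
move=> f0; rewrite /nconst psub_coef fsbig1 // => k _.
have [->|k0] := eqVneq k mset0; first by rewrite f0 mul0r.
rewrite (deg_mset_eval (k := k)) ?mulr0 //; first by case: ag.
by rewrite wt0 lt0n deg_eq0.
Qed.
End Admissible.

End Substitution.

Section Composition.
Variables (U V W : choiceType) (R : comNzRingType).

Lemma psub_mset_eval (g : U -> fps V R) (h : V -> fps W R) k : admissible h ->
  psub (mset_eval g k) h = mset_eval (fun u => psub (g u) h) k.
Proof. by move=> ah; rewrite /mset_eval psub_prod. Qed.

Lemma psub_comp (f : fps U R) (g : U -> fps V R) (h : V -> fps W R) :
  admissible g -> admissible h ->
  psub (psub f g) h = psub f (fun u => psub (g u) h).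
Proof.
move=> ag ah; apply/fpsP => m; have [M HM] := admissible_bound m ah.
have [M' HM'] := admissible_bound M ag.
rewrite (coef_psub _ HM) ?msubset_refl //.
have E k : psub (mset_eval g k) h m =
           \sum_(j <- msubs M) mset_eval g k j * mset_eval h j m.
  by rewrite (coef_psub _ HM) ?msubset_refl.
rewrite [RHS]psub_coef (@fsbig_setT_seq _ _ (msubs M')) ?msubs_uniq //; last first.
  move=> k; rewrite mem_msubs => kM'; rewrite -psub_mset_eval // E.
  rewrite big_seq big1 ?mulr0 // => j; rewrite mem_msubs => jM.
  have [->|nz] := eqVneq (mset_eval g k j) 0; first by rewrite mul0r.
  by rewrite (HM' k j) in kM'.
transitivity (\sum_(j <- msubs M) \sum_(k <- msubs M')
   f k * (mset_eval g k j * mset_eval h j m)).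
  rewrite big_seq [RHS]big_seq; apply: eq_bigr => j; rewrite mem_msubs => jM.
  rewrite (coef_psub _ HM') // mulr_suml.
  by apply: eq_bigr => k _; rewrite mulrA.
rewrite exchange_big; apply: eq_bigr => k _ /=.
by rewrite -mulr_sumr -psub_mset_eval // E.
Qed.

Lemma psub_id (f : fps V R) : psub f (pvar R) = f.
Proof.
apply/fpsP => m; rewrite psub_coef (@fsbig_setT_seq _ _ [:: m]) //.
  by rewrite big_seq1 -/(fpsX R m) coef_X eqxx mulr1.
move=> k; rewrite inE -/(fpsX R k) coef_X eq_sym => /negPf ->; exact: mulr0.
Qed.

Lemma eq_psub (f : fps U R) (g g' : U -> fps V R) :
  g =1 g' -> psub f g = psub f g'.
Proof. by move=> gg'; congr (psub f _); apply/funext. Qed.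

Lemma mset_eval_congr (g g' : U -> fps V R) d k :
  (forall v, nconst (g v)) -> (forall v, nconst (g' v)) ->
  (forall v, vge (fun=> 1%N) d (g v - g' v)) ->
  vge (fun=> 1%N) (d + deg k - 1)%N (mset_eval g k - mset_eval g' k).
Proof.
move=> g0 g'0 gg'; elim/mset_ind: k => [|u k IH].
  by rewrite !mset_eval0 subrr; exact: vge_zero.
rewrite !mset_evalD !mset_eval1 degD degn addnCA add1n subSS subn0.
rewrite (_ : _ - _ = (g u - g' u) * mset_eval g k +
                     g' u * (mset_eval g k - mset_eval g' k)); last by ring.
apply: vgeD; first by apply: vgeM => //; exact: deg_mset_eval.
apply: (@vgeW _ _ _ (1 + (d + deg k - 1))%N); first by lia.
by apply: vgeM => //; apply/vge_nconst/g'0.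
Qed.

(** Telescoping a monomial of degree k >= r leaves one factor of order d and k - 1 factors of order
    at least 1. *)
Lemma psub_congr (f : fps U R) (g g' : U -> fps V R) r d :
  vge (fun=> 1%N) r f ->
  (forall v, nconst (g v)) -> (forall v, nconst (g' v)) ->
  (forall v, vge (fun=> 1%N) d (g v - g' v)) ->
  vge (fun=> 1%N) (d + r - 1)%N (psub f g - psub f g').
Proof.
move=> fr g0 g'0 gg' m md; apply/eqP; rewrite fcoefB subr_eq0 !psub_coef; apply/eqP.
apply: eq_fsbigr => k _; have [kr|rk] := ltnP (deg k) r.
  by rewrite fr -?degE // !mul0r.
congr (_ * _); apply/eqP; rewrite -subr_eq0 -fcoefB.
by rewrite (mset_eval_congr g0 g'0 gg') //; lia.
Qed.

Lemma vge_psub (f : fps U R) (g : U -> fps V R) r :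
  vge (fun=> 1%N) r f -> (forall v, nconst (g v)) ->
  vge (fun=> 1%N) r (psub f g).
Proof.
move=> fr g0 m md; rewrite psub_coef fsbig1 // => k _.
have [kr|rk] := ltnP (deg k) r; first by rewrite fr -?degE // mul0r.
by rewrite (deg_mset_eval (k := k)) ?mulr0 //; exact: leq_trans md rk.
Qed.

End Composition.

Lemma admissible_fin (X : finType) (W : choiceType) (R : comNzRingType)
  (h : X -> fps W R) : (forall v, nconst (h v)) -> admissible h.
Proof. by move=> h0; split=> // m; exact: finite_finset. Qed.

Lemma admissible_var (V : choiceType) (R : comNzRingType) :
  admissible (pvar R : V -> fps V R).
Proof.
split=> [v|m].
  by rewrite /nconst pvar_coef; case: eqP => // /(congr1 (@deg V)); rewrite deg0 degn.
apply: (@sub_finite_set _ _ [set` enum_mset m]); last exact: finite_seq.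
move=> v; rewrite /= pvar_coef; case: (m =P [mset v]%mset) => [-> _|]; rewrite ?eqxx //.
exact: mset11.
Qed.

(** Banach's fixed point theorem for the degree filtration. *)
Lemma fps_fixpoint (V : choiceType) (R : comNzRingType)
    (phi : fps V R -> fps V R) :
  (forall f, nconst f -> nconst (phi f)) ->
  (forall f g d, nconst f -> nconst g -> vge (fun=> 1%N) d (f - g) ->
    vge (fun=> 1%N) d.+1 (phi f - phi g)) ->
  exists f, nconst f /\ phi f = f.
Proof.
move=> phi0 phiC; pose x n := iter n phi 0.
have x0 n : nconst (x n) by elim: n => //= n IH; exact: phi0.
have xS n : vge (fun=> 1%N) n (x n.+1 - x n).
  by elim: n => [|n IH]; [exact: vge0|exact: (phiC _ _ _ (x0 n.+1) (x0 n) IH)].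
have xD n k : vge (fun=> 1%N) n (x (n + k)%N - x n).
  elim: k => [|k IH]; first by rewrite addn0 subrr; exact: vge_zero.
  rewrite addnS -[x (n + k).+1](subrK (x (n + k)%N)) -addrA; apply: vgeD => //.
  by apply: vgeW (xS _); rewrite leq_addr.
(* All iterates from index deg m + 1 on have the same coefficient at m. *)
pose f : fps V R := Fps (fun m => x (deg m).+1 m).
have fx n : vge (fun=> 1%N) n (f - x n).
  move=> m mn; rewrite -degE in mn; rewrite fcoefB /=.
  have := xD (deg m).+1 (n - (deg m).+1)%N; rewrite subnKC // => /(_ m).
  rewrite -degE ltnSn => /(_ isT); rewrite fcoefB => /eqP.
  by rewrite subr_eq0 => /eqP ->; rewrite subrr.
have f0 : nconst f := x0 _.
exists f; split=> //; apply/eqP; rewrite -subr_eq0; apply/eqP.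
apply: (@vge_eq0 _ _ (fun=> 1%N)) => -[|n]; first exact: vge0.
rewrite (_ : _ - _ = (phi f - x n.+1) - (f - x n.+1)); last by ring.
apply: vgeB => //; exact: (phiC _ _ _ f0 (x0 n)).
Qed.

Section Map.
Variables (V W : choiceType) (R S : comNzRingType) (phi : {rmorphism R -> S}).

Lemma fps_map_zmod : zmod_morphism (fps_map phi : fps V R -> fps V S).
Proof. by move=> f g; apply/fpsP => m; rewrite /= rmorphB. Qed.

Lemma fps_map_monoid : monoid_morphism (fps_map phi : fps V R -> fps V S).
Proof.
split=> [|f g]; apply/fpsP => m; first by rewrite /= rmorph_nat.
by rewrite /= rmorph_sum; apply: eq_bigr => k _; rewrite rmorphM.
Qed.

HB.instance Definition _ :=
  GRing.isZmodMorphism.Build (fps V R) (fps V S) (fps_map phi) fps_map_zmod.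
HB.instance Definition _ :=
  GRing.isMonoidMorphism.Build (fps V R) (fps V S) (fps_map phi) fps_map_monoid.

Lemma fps_map_var v : fps_map phi (pvar R v) = pvar S v :> fps V S.
Proof. by apply/fpsP => m; rewrite /= !pvar_coef rmorph_nat. Qed.

End Map.

Lemma fps_map_mset_eval (V W : choiceType) (R S : comNzRingType)
    (phi : {rmorphism R -> S}) (g : V -> fps W R) k :
  fps_map phi (mset_eval g k) = mset_eval (fun v => fps_map phi (g v)) k.
Proof. by rewrite /mset_eval rmorph_prod. Qed.

Lemma fps_map_psub (V W : choiceType) (R S : comNzRingType)
    (phi : {rmorphism R -> S}) (f : fps V R) (g : V -> fps W R) :
  admissible g ->
  fps_map phi (psub f g) = psub (fps_map phi f) (fun v => fps_map phi (g v)).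
Proof.
move=> ag; apply/fpsP => m; have [M HM] := admissible_bound m ag.
rewrite [RHS]psub_coef (@fsbig_setT_seq _ _ (msubs M)) ?msubs_uniq //; last first.
  move=> k; rewrite mem_msubs => kM; rewrite -fps_map_mset_eval /=.
  have [->|nz] := eqVneq (mset_eval g k m) 0; first by rewrite rmorph0 mulr0.
  by rewrite (HM k m) ?msubset_refl in kM.
transitivity (phi (psub f g m)) => //.
rewrite (coef_psub _ HM) ?msubset_refl // rmorph_sum.
by apply: eq_bigr => k _; rewrite rmorphM -fps_map_mset_eval.
Qed.

(** * Formal group laws *)

Section FglTheory.
Variables (R : comNzRingType) (F : fps 'I_2 R).

Lemma nconst_pair (V : choiceType) (a b : fps V R) : nconst a -> nconst b ->
  forall i : 'I_2, nconst (if i == ord0 then a else b).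
Proof. by move=> a0 b0 i; case: ifP. Qed.

Lemma admissible_pair (V : choiceType) (a b : fps V R) : nconst a -> nconst b ->
  admissible (fun i : 'I_2 => if i == ord0 then a else b).
Proof. by move=> a0 b0; exact: admissible_fin (nconst_pair a0 b0). Qed.

Lemma fgl_psub (V W : choiceType) (a b : fps V R) (g : V -> fps W R) :
  nconst a -> nconst b -> admissible g ->
  psub (fadd F a b) g = fadd F (psub a g) (psub b g).
Proof.
move=> a0 b0 ag; rewrite !fadd_psub psub_comp //; last first.
  exact: admissible_pair.
by apply: eq_psub => i; case: ifP.
Qed.

Lemma mset_I2 (m : {mset 'I_2}%mset) :
  m = (msetn (m ord0) ord0 `+` msetn (m ord_max) ord_max)%mset.
Proof.
apply/msetP => i; rewrite msetE2 !msetnE.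
by case: (unliftP ord0 i) => [j|] ->; rewrite ?ord1 /= ?addn0 //; congr (m _); exact/val_inj.
Qed.

Hypothesis HF : is_fgl F.

Let fgl_axioms : let u := pvar R (ord0 : 'I_1) in
  let x (i : nat) := pvar R (inord i : 'I_3) in
  [/\ fadd F u 0 = u, fadd F 0 u = u,
      fadd F (x 0%N) (x 1%N) = fadd F (x 1%N) (x 0%N) &
      fadd F (fadd F (x 0%N) (x 1%N)) (x 2%N) =
      fadd F (x 0%N) (fadd F (x 1%N) (x 2%N))].
Proof. by move: HF; rewrite /is_fgl !pvarE !faddE. Qed.

Lemma fgl_coef_left n : F (msetn n ord0) = (n == 1%N)%:R.
Proof.
have [H _ _ _] := fgl_axioms.
have := congr1 (fun f : fps 'I_1 R => f (msetn n ord0)) H.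
rewrite fadd_psub pvar_coef psub_coef (@fsbig_setT_seq _ _ [:: msetn n ord0]) //; last first.
  move=> k; rewrite inE [k]mset_I2 mset_evalD !mset_evaln.
  rewrite [X in X ^+ k ord0]/= [X in X ^+ k ord_max]/=.
  case: (k ord_max) => [|j]; last by rewrite exprS mul0r mulr0 fcoef0 mulr0.
  rewrite msetn0 msetD0 expr0 mulr1 -mset_evaln -/(fpsX _ _) coef_X => ne.
  case: eqP => [/(congr1 (@deg _))|_]; last by rewrite mulr0.
  by rewrite !degn => nE; rewrite nE eqxx in ne.
rewrite big_seq1 mset_evaln [X in X ^+ n]/= -mset_evaln -/(fpsX _ _) coef_X eqxx mulr1 => ->.
congr (_%:R); congr nat_of_bool; apply/eqP/eqP => [/(congr1 (@deg _))|->] //.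
by rewrite !degn.
Qed.

Lemma fgl_coef_right n : F (msetn n ord_max) = (n == 1%N)%:R.
Proof.
have [_ H _ _] := fgl_axioms.
have := congr1 (fun f : fps 'I_1 R => f (msetn n ord0)) H.
rewrite fadd_psub pvar_coef psub_coef (@fsbig_setT_seq _ _ [:: msetn n ord_max]) //; last first.
  move=> k; rewrite inE [k]mset_I2 mset_evalD !mset_evaln.
  rewrite [X in X ^+ k ord0]/= [X in X ^+ k ord_max]/=.
  case: (k ord0) => [|j]; last by rewrite exprS mul0r mul0r fcoef0 mulr0.
  rewrite msetn0 mset0D expr0 mul1r -mset_evaln -/(fpsX _ _) coef_X => ne.
  case: eqP => [/(congr1 (@deg _))|_]; last by rewrite mulr0.
  by rewrite !degn => nE; rewrite nE eqxx in ne.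
rewrite big_seq1 mset_evaln [X in X ^+ n]/= -mset_evaln -/(fpsX _ _) coef_X eqxx mulr1 => ->.
congr (_%:R); congr nat_of_bool; apply/eqP/eqP => [/(congr1 (@deg _))|->] //.
by rewrite !degn.
Qed.

(** The series H in F(u, v) = u + v + u v H(u, v); its constant term is a_(1,1). *)
Definition fgl_tail : fps 'I_2 R :=
  locked (Fps (fun m => F (ord0 +` (ord_max +` m))%mset)).

Lemma fgl_tailE m : fgl_tail m = F (ord0 +` (ord_max +` m))%mset.
Proof. by rewrite /fgl_tail -lock. Qed.

Lemma fgl_decomp : F = pvar R ord0 + pvar R ord_max +
                       pvar R ord0 * (pvar R ord_max * fgl_tail).
Proof.
have e1 n (i : 'I_2) : (msetn n i == [mset i]%mset) = (n == 1%N).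
  by apply/eqP/eqP => [/(congr1 (@deg _))|->] //; rewrite !degn.
apply/fpsP => m; rewrite !fcoefD !coef_varM !pvar_coef.
case: (boolP (ord0 \in m)) => [/mem_mset_split[l ->]|m0]; last first.
  rewrite addr0 [m]mset_I2; move/mset_eq0P: m0 => ->.
  rewrite msetn0 mset0D fgl_coef_right /= e1.
  case: (_ =P [mset ord0]%mset) => [/(congr1 (fun m : {mset 'I_2}%mset => m ord0))|_]; first by rewrite !msetnE.
  by rewrite add0r.
rewrite msetB_add; case: (boolP (ord_max \in l)) => [/mem_mset_split[k ->]|l1].
  rewrite msetB_add fgl_tailE ?pvar_coef.
  case: eqP => [/(congr1 (@deg _))|_]; first by rewrite !degD !degn.
  case: eqP => [/(congr1 (@deg _))|_]; first by rewrite !degD !degn.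
  by rewrite !add0r.
rewrite [l]mset_I2; move/mset_eq0P: l1 => ->; rewrite msetn0 msetD0 addr0.
have -> : (ord0 +` msetn (l ord0) ord0 = msetn (l ord0).+1 ord0 :> {mset 'I_2})%mset.
  by apply/msetP => x; rewrite msetE2 !msetnE; case: ifP.
rewrite fgl_coef_left /= e1 [X in _ + X](_ : _ = 0) ?addr0 //.
by case: (_ =P [mset ord_max]%mset) => //= /(congr1 (fun m : {mset 'I_2}%mset => m ord0)); rewrite !msetnE.
Qed.

Section Series.
Variable V : choiceType.
Implicit Types a b c : fps V R.

Definition fgl_rest a b := psub fgl_tail (fun i => if i == ord0 then a else b).

Lemma fgl_addE a b : nconst a -> nconst b ->
  fadd F a b = a + b + a * b * fgl_rest a b.
Proof.
move=> a0 b0; have ag := admissible_pair a0 b0.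
rewrite fadd_psub [X in psub X _ = _]fgl_decomp.
rewrite (psubD ag) (psubD ag) (psub_mul ag) (psub_mul ag).
rewrite -/(fgl_rest a b).
rewrite (psub_var ord0 ag) (psub_var ord_max ag).
by rewrite mulrA.
Qed.

Lemma nconstM a b : nconst a -> nconst (a * b).
Proof.
by move=> /vge_nconst a0; apply/vge_nconst; exact: vgeMl.
Qed.

Lemma nconstD a b : nconst a -> nconst b -> nconst (a + b).
Proof. by rewrite /nconst fcoefD => -> ->; rewrite addr0. Qed.

Lemma nconstN a : nconst a -> nconst (- a).
Proof. by rewrite /nconst fcoefN => ->; rewrite oppr0. Qed.

Lemma nconst0 : nconst (0 : fps V R). Proof. by []. Qed.

Lemma nconst_fgl a b : nconst a -> nconst b -> nconst (fadd F a b).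
Proof.
move=> a0 b0; rewrite fgl_addE //; apply: nconstD; first exact: nconstD.
by rewrite -mulrA; exact: nconstM.
Qed.

Lemma nconst_var v : nconst (pvar R v : fps V R).
Proof. by case: (admissible_var V R). Qed.
End Series.

Lemma fgl_inv_exists : exists g : fps 'I_1 R,
  nconst g /\ fadd F (pvar R ord0) g = 0.
Proof.
set u : fps 'I_1 R := pvar R ord0.
have u0 : nconst u := nconst_var _.
(* The equation u +_F g = 0 reads g = - u - u g H(u, g), and the factor u makes the right-hand side
   contracting. *)
have [||g [g0 gE]] := @fps_fixpoint _ R (fun g => - u - u * (g * fgl_rest u g)).
- by move=> g g0; apply: nconstD; [exact: nconstN|apply: nconstN; exact: nconstM].
- move=> f g d f0 g0 fg; cbv beta.
  have -> : - u - u * (f * fgl_rest u f) - (- u - u * (g * fgl_rest u g)) =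
      - (u * ((f - g) * fgl_rest u f + g * (fgl_rest u f - fgl_rest u g))) by ring.
  apply: vgeN; rewrite -[d.+1]add1n; apply: vgeM; first exact/vge_nconst.
  apply: vgeD; first exact: vgeMl.
  apply: (@vgeW _ _ _ (1 + (d + 0 - 1))%N); first by lia.
  apply: vgeM; first exact/vge_nconst.
  apply: psub_congr; first exact: vge0.
  + exact: nconst_pair.
  + exact: nconst_pair.
  by move=> i; case: ifP => // _; rewrite subrr; exact: vge_zero.
exists g; split=> //; rewrite fgl_addE // -[X in _ + X + _]gE; ring.
Qed.

Lemma fgl_invP : nconst (fgl_inv F) /\ fadd F (pvar R ord0) (fgl_inv F) = 0.
Proof.
have [g gP] := fgl_inv_exists.
have [|g0 gE] := @xgetPex _ 0 [set g : fps 'I_1 R |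
    g mset0 = 0 /\ fgl_add F (fvar R ord0) g = 0]; last by rewrite -pvarE -faddE.
by exists g; rewrite /= pvarE faddE.
Qed.

Section Series2.
Variable V : choiceType.
Implicit Types a b c : fps V R.

Let adm1 a : nconst a -> admissible (fun _ : 'I_1 => a).
Proof. by move=> a0; exact: admissible_fin. Qed.

Lemma nconst_opp a : nconst a -> nconst (fopp F a).
Proof.
by move=> a0; rewrite fopp_psub; apply: nconst_psub; [exact: adm1|case: fgl_invP].
Qed.

Lemma fgl_addC a b : nconst a -> nconst b -> fadd F a b = fadd F b a.
Proof.
move=> a0 b0; have [_ _ H _] := fgl_axioms.
have ag : admissible (fun i : 'I_3 => if i == 0%N :> nat then a else b).
  by apply: admissible_fin => i; case: ifP.
have := congr1 (fun f => psub f (fun i : 'I_3 => if i == 0%N :> nat then a else b)) H.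
have v0 i : nconst (pvar R (inord i : 'I_3)) by exact: nconst_var.
by rewrite !fgl_psub // !psub_var // !inordK.
Qed.

Lemma fgl_addA a b c : nconst a -> nconst b -> nconst c ->
  fadd F a (fadd F b c) = fadd F (fadd F a b) c.
Proof.
move=> a0 b0 c0; have [_ _ _ H] := fgl_axioms.
pose g (i : 'I_3) := if i == 0%N :> nat then a else if i == 1%N :> nat then b else c.
have ag : admissible g by apply: admissible_fin => i; rewrite /g; do 2![case: ifP => // _].
have v0 i : nconst (pvar R (inord i : 'I_3)) by exact: nconst_var.
have := congr1 (fun f => psub f g) H.
by rewrite !fgl_psub ?psub_var /g ?inordK //; apply: nconst_fgl; exact: v0.
Qed.

Lemma fgl_addr0 a : nconst a -> fadd F a 0 = a.
Proof. by move=> a0; rewrite fgl_addE // mulr0 mul0r !addr0. Qed.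

Lemma fgl_add0r a : nconst a -> fadd F 0 a = a.
Proof. by move=> a0; rewrite fgl_addE // !mul0r addr0 add0r. Qed.

Lemma fgl_addN a : nconst a -> fadd F a (fopp F a) = 0.
Proof.
move=> a0; have [i0 H] := fgl_invP; have ag := adm1 a0.
have := congr1 (fun f => psub f (fun _ : 'I_1 => a)) H.
rewrite fopp_psub fgl_psub //; last exact: nconst_var.
by rewrite psub0 // psub_var.
Qed.

Lemma fgl_addNr a : nconst a -> fadd F (fopp F a) a = 0.
Proof.
by move=> a0; rewrite fgl_addC ?fgl_addN //; exact: nconst_opp.
Qed.

Lemma fgl_oppK a : nconst a -> fopp F (fopp F a) = a.
Proof.
move=> a0; have n0 := nconst_opp a0; have nn0 := nconst_opp n0.
rewrite -[LHS]fgl_add0r // -(fgl_addN a0) -fgl_addA //.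
by rewrite fgl_addN // fgl_addr0.
Qed.

Lemma fgl_addNK a b : nconst a -> nconst b ->
  fadd F (fadd F a (fopp F b)) b = a.
Proof.
move=> a0 b0; have n0 := nconst_opp b0.
by rewrite -fgl_addA // fgl_addNr // fgl_addr0.
Qed.

(** From a + o + a o H = 0 one gets o = a (-1 - o H); substituting this for o in a o H exhibits o +
    a as a multiple of a^2. *)
Lemma fgl_oppE a : nconst a -> exists J, fopp F a = - a + a ^+ 2 * J.
Proof.
move=> a0; have n0 := nconst_opp a0.
have := fgl_addN a0; rewrite fgl_addE //.
set o := fopp F a; set H := fgl_rest _ _ => E.
have oE : o = a * (-1 - o * H).
  by rewrite -[LHS](subr0) -E; ring.
exists (- (-1 - o * H) * H); rewrite -[LHS](subr0) -E {3}oE; ring.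
Qed.

Lemma fgl_opp0 : fopp F 0 = 0 :> fps V R.
Proof. by have [J ->] := fgl_oppE (nconst0 V); rewrite expr2 !mul0r oppr0 addr0. Qed.

Lemma fgl_rest_coef0 a : nconst a ->
  fgl_rest a a mset0 = F (ord0 +` [mset ord_max])%mset.
Proof.
move=> a0; rewrite /fgl_rest psub_coef (@fsbig_setT_seq _ _ [:: mset0]) //.
  by rewrite big_seq1 mset_eval0 fcoef1 eqxx mulr1 fgl_tailE msetD0.
move=> k; rewrite inE => k0; rewrite (deg_mset_eval (k := k)) ?mulr0 //.
  by move=> i; case: ifP.
by rewrite wt0 lt0n deg_eq0.
Qed.
End Series2.

Lemma opp_psub (V W : choiceType) (a : fps V R) (g : V -> fps W R) :
  nconst a -> admissible g ->
  psub (fopp F a) g = fopp F (psub a g).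
Proof. by move=> a0 ag; rewrite !fopp_psub psub_comp //; exact: admissible_fin. Qed.

End FglTheory.

(** * Symmetric 2-cocycles *)

Section BinomialsModPrime.
Variable p : nat.
Hypothesis p_pr : prime p.
Local Open Scope nat_scope.

(** With N = p^w m, p^w divides j C(N, j) = N C(N - 1, j - 1) but not j. *)
Lemma prime_dvd_bin_mul w m j : 0 < j < p ^ w -> p %| 'C(p ^ w * m, j).
Proof.
move=> /andP[j0 jw]; have p0 := prime_gt0 p_pr.
have [->|m0] := posnP m; first by rewrite muln0 bin0n; case: j j0 jw.
have := mul_bin_diag (p ^ w * m) j.-1; rewrite prednK // => E.
have : p ^ w %| j * 'C(p ^ w * m, j) by rewrite -E -mulnA dvdn_mulr.
apply: contraLR => pC; rewrite Gauss_dvdl.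
  by apply/negP => /(dvdn_leq j0); rewrite leqNgt jw.
by rewrite coprimeXl // prime_coprime.
Qed.

Lemma bin_mul_add_mod w m r : r < p ^ w -> 'C(p ^ w * m + r, r) = 1 %[mod p].
Proof.
move=> rw; rewrite -binomial.Vandermonde big_ord_recl bin0 subn0 binn mul1n /=.
rewrite -modnDmr; set s := \sum_(i < r) _.
suff /eqP -> : p %| s by rewrite addn0.
apply: dvdn_sum => i _; rewrite dvdn_mulr // prime_dvd_bin_mul //=.
exact: leq_ltn_trans (ltn_ord i) rw.
Qed.

Lemma prime_ndvd_bin_add w m r : r < p ^ w -> ~~ (p %| 'C(p ^ w * m + r, r)).
Proof.
move=> rw; rewrite /dvdn (bin_mul_add_mod _ rw) modn_small //; exact: prime_gt1.
Qed.

(** In Vandermonde's expansion every term but the last is divisible by p. The last one is C(p^w m,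
    p^w) = m C(p^w m - 1, p^w - 1), and its second factor is prime to p by [prime_ndvd_bin_add]. *)
Lemma prime_ndvd_bin_pow w m r : r < p ^ w -> ~~ (p %| m) ->
  ~~ (p %| 'C(p ^ w * m + r, p ^ w)).
Proof.
move=> rw pm; have p0 := prime_gt0 p_pr; have pw0 : 0 < p ^ w by rewrite expn_gt0 p0.
have m0 : 0 < m by case: m pm => //; rewrite dvdn0.
rewrite -binomial.Vandermonde big_ord_recr /= subnn bin0 muln1.
rewrite dvdn_addr; last first.
  apply: dvdn_sum => -[[|i] /= iw] _; first by rewrite subn0 (@bin_small r) ?muln0 ?dvdn0.
  by rewrite dvdn_mulr // prime_dvd_bin_mul.
have [m' mE] : exists m', m = m'.+1 by exists m.-1; rewrite prednK.
have -> : 'C(p ^ w * m, p ^ w) = m * 'C(p ^ w * m' + (p ^ w).-1, (p ^ w).-1).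
  apply/eqP; rewrite -(eqn_pmul2l pw0) mulnA.
  have := mul_bin_diag (p ^ w * m) (p ^ w).-1; rewrite prednK // => <-.
  by rewrite (_ : (p ^ w * m).-1 = p ^ w * m' + (p ^ w).-1)%N // mE mulnS; lia.
rewrite Euclid_dvdM // negb_or pm prime_ndvd_bin_add //.
by rewrite ltn_predL.
Qed.
End BinomialsModPrime.

(* The relations satisfied modulo [K] by the coefficients [a i] of            *)
(* [x^i y^(n-i)] in a symmetric 2-cocycle of degree [n].                      *)
Definition cocycle (B : zmodType) (K : B -> Prop) (n : nat) (a : nat -> B) :=
  (forall i j k, (0 < i)%N -> (0 < j)%N -> (0 < k)%N -> (i + j + k = n)%N ->
     K (a (i + j)%N *+ 'C(i + j, i) - a i *+ 'C(j + k, j))) /\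
  (forall i, (0 < i < n)%N -> K (a i - a (n - i)%N)).

Definition subgroup (B : zmodType) (K : B -> Prop) :=
  K 0 /\ forall a b, K a -> K b -> K (a - b).

Section Subgroup.
Variables (B : zmodType) (K : B -> Prop).
Hypothesis HK : subgroup K.

Lemma subgroupN a : K a -> K (- a).
Proof. by case: HK => K0 KB Ka; rewrite -sub0r; apply: KB. Qed.

Lemma subgroupD a b : K a -> K b -> K (a + b).
Proof.
move=> Ka Kb; rewrite -[b]opprK; by case: HK => _ KB; apply: KB => //; exact: subgroupN.
Qed.

Lemma subgroupMn a n : K a -> K (a *+ n).
Proof.
move=> Ka; elim: n => [|n IH]; first by case: HK.
by rewrite mulrS; exact: subgroupD.
Qed.

Lemma subgroup_sym a b : K (a - b) -> K (b - a).
Proof. by move/subgroupN; rewrite opprB. Qed.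

Lemma subgroup_trans b a c : K (a - b) -> K (b - c) -> K (a - c).
Proof. by move=> ab bc; have := subgroupD ab bc; rewrite addrA subrK. Qed.
End Subgroup.

(** * Lazard's lemma *)

Section CocycleLemma.
Variable n : nat.

(** After localization at p, a_i is a multiple of a_q. The same s and t serve all groups, subgroups
    and cocycles, so that such a relation also holds for the integral cocycle [bin_red]. *)
Definition proportional p i q := exists s t, ~~ (p %| s)%N /\
  forall (B : zmodType) (K : B -> Prop) a, subgroup K -> cocycle K n a ->
    K (a i *+ s - a q *+ t).

Lemma proportional_refl p i : prime p -> proportional p i i.
Proof.
move=> p_pr; exists 1%N, 1%N; split; first by rewrite dvdn1 neq_ltn prime_gt1 ?orbT.
by move=> B K a [K0 _] _; rewrite subrr.
Qed.

Lemma proportional_trans p i j q : prime p ->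
  proportional p i j -> proportional p j q -> proportional p i q.
Proof.
move=> p_pr [s [t [ps H]]] [s' [t' [ps' H']]]; exists (s * s')%N, (t * t')%N.
split; first by rewrite Euclid_dvdM // negb_or ps.
move=> B K a HK Ca; apply: (subgroup_trans HK (b := a j *+ (t * s'))).
  by rewrite !mulrnA -mulrnBl; apply: subgroupMn => //; exact: (H B K).
by rewrite mulnC !(mulnC t) !mulrnA -mulrnBl; apply: subgroupMn => //; exact: (H' B K).
Qed.

Lemma proportional_sym_index p i : prime p -> (0 < i < n)%N ->
  proportional p i (n - i)%N.
Proof.
move=> p_pr i0n; exists 1%N, 1%N; split; first by rewrite dvdn1 neq_ltn prime_gt1 ?orbT.
by move=> B K a HK [_ H]; rewrite !mulr1n; exact: H.
Qed.

(** The cocycle relation for (i, j - i, n - j) reads a_j C(j, i) = a_i C(n - i, j - i).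
    [proportional_up] uses the same relation when the other binomial is prime to p. *)
Lemma proportional_down p i j : (0 < i)%N -> (i < j)%N -> (j < n)%N ->
  ~~ (p %| 'C(j, i))%N -> proportional p j i.
Proof.
move=> i0 ij jn pC; exists 'C(j, i), 'C(n - i, j - i); split=> //.
move=> B K a HK [H _]; have := H i (j - i)%N (n - j)%N.
rewrite (subnKC (ltnW ij)) (_ : j - i + (n - j) = n - i)%N; last by lia.
by move=> X; apply: X; lia.
Qed.

Lemma proportional_up p i j : (0 < i)%N -> (i < j)%N -> (j < n)%N ->
  ~~ (p %| 'C(n - i, n - j))%N -> proportional p i j.
Proof.
move=> i0 ij jn pC; exists 'C(n - i, j - i), 'C(j, i); split.
  by rewrite -bin_sub; [rewrite (_ : n - i - (j - i) = n - j)%N //; lia|lia].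
move=> B K a HK [H _]; apply: subgroup_sym => //.
have := H i (j - i)%N (n - j)%N.
rewrite (subnKC (ltnW ij)) (_ : j - i + (n - j) = n - i)%N; last by lia.
by move=> X; apply: X; lia.
Qed.

(** Let q = p^v be the largest power of p below n, and x the exact power of p dividing i. One passes
    from i down to x since C(i, x) is prime to p. If n - q < x, one passes up from x to q since C(n
    - x, n - q) is prime to p. Otherwise one passes from x to n - x by symmetry and then down to q:
    the quotient of n - x by q lies between 1 and p - 1, so C(n - x, q) is prime to p. *)
Lemma proportional_pow p i v : prime p -> (0 < i < n)%N ->
  (p ^ v < n)%N -> (n <= p ^ v.+1)%N -> proportional p i (p ^ v)%N.
Proof.
move=> p_pr /andP[i0 iN] qn nq; have p0 := prime_gt0 p_pr.
have p1 := prime_gt1 p_pr.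
set q := (p ^ v)%N in qn *; pose w := logn p i; pose x := (p ^ w)%N.
have q0 : (0 < q)%N by rewrite expn_gt0 p0.
have x0 : (0 < x)%N by rewrite expn_gt0 p0.
have xi : (x %| i)%N by rewrite pfactor_dvdn.
have xlei : (x <= i)%N by apply: dvdn_leq.
have step1 : proportional p i x.
  have [<-|xnei] := eqVneq x i; first exact: proportional_refl.
  apply: proportional_down => //; first by rewrite ltn_neqAle xnei.
  have iE : i = (p ^ w * (i %/ x) + 0)%N by rewrite addn0 mulnC divnK.
  rewrite {1}iE; apply: prime_ndvd_bin_pow => //.
  by rewrite -/x dvdn_divRL // -expnS pfactor_dvdn // ltnn.
apply: proportional_trans step1 _ => //.
have wv : (w <= v)%N.
  rewrite -ltnS -(ltn_exp2l _ _ p1); apply: leq_ltn_trans xlei _.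
  exact: leq_trans nq.
have [wv'|] := ltnP w v; last first.
  move=> vw; rewrite /x (_ : w = v); first exact: proportional_refl.
  by apply/eqP; rewrite eqn_leq wv.
have xq : (x < q)%N by rewrite ltn_exp2l.
have xdq : (x %| q)%N by rewrite dvdn_exp2l // ltnW.
have [rx|xr] := ltnP (n - q) x.
  apply: proportional_up => //.
  have -> : (n - x = p ^ w * (q %/ x - 1) + (n - q))%N.
    by rewrite mulnBr muln1 -/x [(x * _)%N]mulnC divnK //; lia.
  exact: prime_ndvd_bin_add.
apply: (proportional_trans (j := (n - x)%N)) => //.
  by apply: proportional_sym_index => //; lia.
have [->|ne] := eqVneq (n - x)%N q; first exact: proportional_refl.
apply: proportional_down => //; [lia|lia|].
rewrite (divn_eq (n - x) q) mulnC; apply: prime_ndvd_bin_pow => //.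
  by rewrite ltn_mod.
have d0 : (0 < (n - x) %/ q)%N by rewrite divn_gt0 //; lia.
apply/negP => /(dvdn_leq d0); apply/negP; rewrite -ltnNge ltn_divLR //.
by rewrite -expnS; lia.
Qed.

Definition bin_gcd := \big[gcdn/0%N]_(i < n.+1 | (0 < i < n)%N) 'C(n, i).

(** Coefficients of the primitive polynomial ((x + y)^n - x^n - y^n) / [bin_gcd], which generates
    the symmetric 2-cocycles of degree n. *)
Definition bin_red i := ('C(n, i) %/ bin_gcd)%N.

Lemma bin_gcd_dvd i : (0 < i < n)%N -> (bin_gcd %| 'C(n, i))%N.
Proof.
move=> i0n; have iS : (i < n.+1)%N by lia.
by apply: (@biggcdn_inf _ (Ordinal iS)).
Qed.

Lemma bin_redE i : (0 < i < n)%N -> (bin_red i * bin_gcd = 'C(n, i))%N.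
Proof. by move=> i0n; rewrite divnK // bin_gcd_dvd. Qed.

Lemma bin_gcd_gt0 : (1 < n)%N -> (0 < bin_gcd)%N.
Proof.
move=> n1; have i1 : (0 < 1 < n)%N by [].
have := bin_redE i1; rewrite bin1 => E; rewrite lt0n; apply/eqP => d0.
by rewrite d0 muln0 in E; lia.
Qed.

Lemma bin_red_coprime p : (1 < n)%N -> prime p ->
  exists2 i, (0 < i < n)%N & ~~ (p %| bin_red i)%N.
Proof.
move=> n1 p_pr; apply: contrapT => H.
have : (p * bin_gcd %| bin_gcd)%N.
  rewrite {2}/bin_gcd; apply/dvdn_biggcdP => i i0n; rewrite -bin_redE //.
  apply: dvdn_mul => //; apply/negPn/negP => pi; apply: H.
  by exists (val i).
move/(dvdn_leq (bin_gcd_gt0 n1)); rewrite -{2}[bin_gcd]mul1n leq_pmul2r ?bin_gcd_gt0 //.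
by rewrite leqNgt prime_gt1.
Qed.

Lemma PoszMn (m k : nat) : m%:Z *+ k = (m * k)%N%:Z.
Proof. by rewrite -mulr_natr natz PoszM. Qed.

Lemma bin_red_cocycle : cocycle (fun z : int => z = 0) n (fun i => (bin_red i)%:Z).
Proof.
split=> [i j k i0 j0 k0 ijk|i i0n].
  apply/eqP; rewrite subr_eq0 !PoszMn eqz_nat.
  have n1 : (1 < n)%N by lia.
  rewrite -(eqn_pmul2r (bin_gcd_gt0 n1)) -!(mulnAC _ bin_gcd) !bin_redE //; try lia.
  have -> : (j + k = n - i)%N by lia.
  have := bin_fact (_ : i <= n)%N; have := bin_fact (_ : i + j <= n)%N.
  have := bin_fact (_ : i <= i + j)%N; have := bin_fact (_ : j <= n - i)%N.
  rewrite addKn => /(_ ltac:(lia)) e1 /(_ ltac:(lia)) e2 /(_ ltac:(lia)) e3 /(_ ltac:(lia)) e4.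
  have e5 : (n - i - j = n - (i + j))%N by lia.
  rewrite e5 in e1.
  have f1 := fact_gt0 i; have f2 := fact_gt0 j; have f3 := fact_gt0 (n - (i + j)).
  rewrite -(eqn_pmul2r (_ : 0 < i`! * j`! * (n - (i + j))`!)%N) ?muln_gt0 ?f1 ?f2 ?f3 //.
  apply/eqP; transitivity (n`!).
    rewrite -e3 -e2; ring.
  rewrite -e4 -e1; ring.
apply/eqP; rewrite subr_eq0 eqz_nat /bin_red bin_sub //; lia.
Qed.

(** The integers s for which s a is a multiple of [bin_red] modulo K form an ideal of Z. It contains
    1 as soon as it contains, for each prime p, an element prime to p. *)
Theorem symmetric_cocycle (B : zmodType) (K : B -> Prop) (a : nat -> B) :
  (1 < n)%N -> subgroup K -> cocycle K n a ->
  exists c, forall i, (0 < i < n)%N -> K (a i - c *+ bin_red i).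
Proof.
move=> n1 HK Ca.
pose I s := exists c, forall i, (0 < i < n)%N -> K (a i *+ s - c *+ bin_red i).
have IB s s' : I s -> I s' -> (s' <= s)%N -> I (s - s')%N.
  move=> [c Hc] [c' Hc'] ss; exists (c - c') => i i0n.
  rewrite mulrnBr // mulrnBl (_ : _ - _ = (a i *+ s - c *+ bin_red i) -
     (a i *+ s' - c' *+ bin_red i)); last first.
    by rewrite !opprB addrACA [RHS]addrACA; congr (_ + _); exact: addrC.
  by case: HK => _; apply; [exact: Hc|exact: Hc'].
have IM s k : I s -> I (k * s)%N.
  move=> [c Hc]; exists (c *+ k) => i i0n.
  by rewrite mulnC !mulrnA (mulrnAC c) -mulrnBl; apply: subgroupMn => //; exact: Hc.
have Ip p : prime p -> exists2 s, I s & ~~ (p %| s)%N.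
  move=> p_pr; pose v := trunc_log p n.-1.
  have p1 := prime_gt1 p_pr.
  have nv : (p ^ v <= n.-1 < p ^ v.+1)%N by apply: trunc_log_bounds => //; lia.
  have qn : (p ^ v < n)%N by lia.
  have nq : (n <= p ^ v.+1)%N by lia.
  set q := (p ^ v)%N in qn.
  have H i : (0 < i < n)%N -> proportional p i q.
    by move=> i0n; exact: proportional_pow.
  (* S is a common multiple, still prime to p, of the denominators s of all the indices i. *)
  have [S [pS HS]] : exists S, ~~ (p %| S)%N /\ forall i, (0 < i < n)%N ->
      exists s t, [/\ (s %| S)%N, ~~ (p %| s)%N &
        forall (B : zmodType) (K : B -> Prop) a, subgroup K -> cocycle K n a ->
        K (a i *+ s - a q *+ t)].
    have : forall m, exists S, ~~ (p %| S)%N /\ forall i, (i < m)%N -> (0 < i < n)%N ->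
      exists s t, [/\ (s %| S)%N, ~~ (p %| s)%N &
        forall (B : zmodType) (K : B -> Prop) a, subgroup K -> cocycle K n a ->
        K (a i *+ s - a q *+ t)].
      elim=> [|m [S [pS HS]]].
        by exists 1%N; split=> //; rewrite dvdn1 neq_ltn p1 orbT.
      have [mn|mn] := boolP (0 < m < n)%N; last first.
        exists S; split=> // i; rewrite ltnS leq_eqVlt => /orP[/eqP ->|]; last exact: HS.
        by move=> mn'; rewrite mn' in mn.
      have [s [t [ps Hs]]] := H _ mn; exists (S * s)%N.
      split; first by rewrite Euclid_dvdM // negb_or pS.
      move=> i; rewrite ltnS leq_eqVlt => /orP[/eqP -> _|im i0n].
        by exists s, t; rewrite dvdn_mull.
      have [s' [t' [dS ps' Hs']]] := HS _ im i0n.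
      by exists s', t'; rewrite dvdn_mulr.
    move=> /(_ n)[S [pS HS]]; exists S; split=> // i i0n; apply: HS => //.
    by case/andP: i0n.
  (* The same t relates the integers [bin_red i] and [bin_red q]. Hence a_i S [bin_red q] agrees
     with (a_q S) [bin_red i] modulo K, and the factor S [bin_red q] belongs to the ideal. *)
  have rel i : (0 < i < n)%N -> exists t, (bin_red i * S = bin_red q * t)%N /\
      K (a i *+ S - a q *+ t).
    move=> i0n; have [s [t [/dvdnP[k ->] ps Hs]]] := HS _ i0n.
    exists (k * t)%N; split.
      have HZ : subgroup (fun z : int => z = 0).
        by split=> // x y -> ->; rewrite subr0.
      move: (Hs int _ _ HZ bin_red_cocycle) => /eqP.
      rewrite subr_eq0 !PoszMn eqz_nat => /eqP E.
      by rewrite mulnCA E mulnCA.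
    by rewrite mulnC (mulnC k) !mulrnA -mulrnBl; apply: subgroupMn => //; exact: (Hs B K).
  have pq : ~~ (p %| bin_red q)%N.
    have [i i0n pi] := bin_red_coprime n1 p_pr; have [t [E _]] := rel i i0n.
    apply: contra pi => pq; have : (p %| bin_red i * S)%N by rewrite E dvdn_mulr.
    by rewrite Euclid_dvdM // (negPf pS) orbF.
  exists (S * bin_red q)%N; last by rewrite Euclid_dvdM // negb_or pS.
  exists (a q *+ S) => i i0n; have [t [E Kt]] := rel i i0n.
  rewrite -!mulrnA (mulnC S (bin_red i)) E (mulnC (bin_red q)) !mulrnA -mulrnBl.
  exact: subgroupMn.
have [s0 Is0 s0gt] : exists2 s, I s & (0 < s)%N.
  have [s Is ps] := Ip 2 isT; exists s => //.
  by case: s ps {Is} => //; rewrite dvdn0.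
have exI : exists s, `[< I s >] && (0 < s)%N by exists s0; rewrite s0gt andbT; apply/asboolP.
(* The least positive element g of the ideal divides every element. If g > 1, this contradicts the
   existence of an element prime to the smallest prime factor of g. *)
case: (ex_minnP exI) => g /andP[/asboolP Ig g0] gmin.
suff g1 : g = 1%N by case: Ig => [c]; rewrite g1 => b; exists c => i /b; rewrite mulr1n.
apply/eqP; rewrite eqn_leq g0 andbT leqNgt; apply/negP => g1.
have [s Is] := Ip _ (pdiv_prime g1); apply/negP; rewrite negbK.
apply: dvdn_trans (pdiv_dvd g) _.
apply/negPn/negP => gs; have : (g <= s %% g)%N.
  apply: gmin; rewrite lt0n gs andbT; apply/asboolP.
  have -> : (s %% g = s - s %/ g * g)%N by rewrite {2}(divn_eq s g) addKn.
  by apply: IB => //; [exact: IM|exact: leq_divM].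
by rewrite leqNgt ltn_mod g0.
Qed.
End CocycleLemma.

(** * Regularity in the Lazard ring *)

Lemma indic_neq0 (R : comNzRingType) (b : bool) : (b%:R : R) != 0 -> b.
Proof. by case: b => //; rewrite mulr0n eqxx. Qed.

(** * Integer polynomials with one variable for each element of the ring *)

Section FiniteSupport.
Variable L : comNzRingType.

Definition fin_supp : {pred fps L int} :=
  fun f => `[< finite_set [set k | f k != 0] >].

Lemma fin_suppP (f : fps L int) :
  reflect (exists s : seq {mset L}%mset, forall k, f k != 0 -> k \in s)
          (f \in fin_supp).
Proof.
apply: (iffP (asboolP _)) => [fs|[s Hs]].
  by exists (fset_set [set k | f k != 0]) => k fk; rewrite in_fset_set ?inE.
by apply: (@sub_finite_set _ _ [set` s]); [move=> k /= /Hs|exact: finite_seq].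
Qed.

Fact fin_supp_subring : GRing.subring_closed fin_supp.
Proof.
split=> [|f g /fin_suppP[s Hs] /fin_suppP[t Ht]|f g /fin_suppP[s Hs] /fin_suppP[t Ht]].
- apply/fin_suppP; exists [:: mset0] => k; rewrite fcoef1 inE.
  exact: indic_neq0.
- apply/fin_suppP; exists (s ++ t) => k; rewrite mem_cat fcoefB => nz.
  have [f0|/Hs -> //] := eqVneq (f k) 0; rewrite Ht ?orbT //.
  by apply: contra_neq nz => g0; rewrite f0 g0 subr0.
- apply/fin_suppP; exists [seq (j `+` l)%mset | j <- s, l <- t] => k.
  move=> /coefM_neq0[j [l [-> /Hs js /Ht lt]]].
  by apply/allpairsP; exists (j, l).
Qed.

HB.instance Definition _ :=
  GRing.isSubringClosed.Build (fps L int) fin_supp fin_supp_subring.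

(** Polynomials are the series of finite support, so the ring structure is inherited. Taking all
    elements of L as variables makes evaluation onto ([ip_eval_var]). *)
Record intpoly := IntPoly { ip_val : fps L int; _ : ip_val \in fin_supp }.

HB.instance Definition _ := [isSub for ip_val].
HB.instance Definition _ := [Choice of intpoly by <:].
HB.instance Definition _ := [SubChoice_isSubComNzRing of intpoly by <:].

Definition ip_eval (a : intpoly) : L :=
  \sum_(k \in [set: {mset L}%mset])
    fps_map (intr : int -> L) (val a) k * mset_eval (fun z => z) k.

Lemma ip_supp (a : intpoly) : exists s : seq {mset L}%mset, uniq s /\
  forall k, val a k != 0 -> k \in s.
Proof.
have /fin_suppP[s Hs] := valP a.
by exists (undup s); split=> [|k /Hs]; rewrite ?undup_uniq ?mem_undup.
Qed.

Lemma ip_evalE (a : intpoly) (s : seq {mset L}%mset) : uniq s ->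
  (forall k, val a k != 0 -> k \in s) ->
  ip_eval a = \sum_(k <- s) fps_map (intr : int -> L) (val a) k * mset_eval (fun z => z) k.
Proof.
move=> us Hs; apply: fsbig_setT_seq => // k ks /=.
have [->|/Hs ks'] := eqVneq (val a k) 0; first by rewrite mul0r.
by rewrite ks' in ks.
Qed.

Fact ip_eval_zmod : zmod_morphism ip_eval.
Proof.
move=> a b; have [s [us Hs]] := ip_supp a; have [t [ut Ht]] := ip_supp b.
have ust := undup_uniq (s ++ t).
rewrite !(ip_evalE ust).
- rewrite -sumrB; apply: eq_bigr => k _ /=.
  by rewrite rmorphB mulrBl.
- by move=> k /Ht; rewrite mem_undup mem_cat orbC => ->.
- by move=> k /Hs; rewrite mem_undup mem_cat => ->.
- move=> k; rewrite mem_undup mem_cat /= => nz.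
  have [f0|/Hs -> //] := eqVneq (val a k) 0; rewrite Ht ?orbT //.
  by apply: contra_neq nz => g0; rewrite f0 g0 subr0.
Qed.

Fact ip_eval_monoid : monoid_morphism ip_eval.
Proof.
split=> [|a b].
  rewrite (@ip_evalE _ [:: mset0]) //.
    by rewrite big_seq1 mset_eval0 mulr1 /= eqxx.
  by move=> k; rewrite /= inE; exact: indic_neq0.
have [s [us Hs]] := ip_supp a; have [t [ut Ht]] := ip_supp b.
pose st := undup [seq (j `+` l)%mset | j <- s, l <- t].
have Hst j l : j \in s -> l \in t -> (j `+` l)%mset \in st.
  by move=> js lt; rewrite mem_undup; apply/allpairsP; exists (j, l).
rewrite (ip_evalE (s := st)) ?undup_uniq //; last first.
  by move=> k /coefM_neq0[j [l [-> /Hs js /Ht lt]]]; exact: Hst.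
rewrite (ip_evalE us Hs) (ip_evalE ut Ht) (_ : val (a * b) = val a * val b) //.
rewrite rmorphM (convolution_sum (J := s) (J' := t)) ?undup_uniq //.
  rewrite mulr_suml; apply: eq_bigr => j _; rewrite mulr_sumr.
  by apply: eq_bigr => l _; rewrite mset_evalD mulrACA.
move=> j l nz; have js : j \in s.
  by apply: Hs; apply: contra_neq nz => /= ->; rewrite !mul0r.
have lt : l \in t.
  by apply: Ht; apply: contra_neq nz => /= ->; rewrite mulr0 mul0r.
by split=> //; exact: Hst.
Qed.

HB.instance Definition _ :=
  GRing.isZmodMorphism.Build intpoly L ip_eval ip_eval_zmod.
HB.instance Definition _ :=
  GRing.isMonoidMorphism.Build intpoly L ip_eval ip_eval_monoid.

Fact pvar_fin_supp (z : L) : pvar int z \in fin_supp.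
Proof.
apply/fin_suppP; exists [:: [mset z]%mset] => k.
by rewrite pvar_coef inE; exact: indic_neq0.
Qed.

Definition ip_var z : intpoly := IntPoly (pvar_fin_supp z).

Lemma ip_eval_var z : ip_eval (ip_var z) = z.
Proof.
rewrite (@ip_evalE _ [:: [mset z]%mset]) //.
  by rewrite big_seq1 mset_eval1 /= pvar_coef eqxx mul1r.
by move=> k; rewrite /= pvar_coef inE; exact: indic_neq0.
Qed.

Definition ip_rat (a : intpoly) : fps L rat := fps_map (intr : int -> rat) (val a).

Fact ip_rat_zmod : zmod_morphism ip_rat.
Proof. by move=> a b; rewrite /ip_rat !rmorphB. Qed.

Fact ip_rat_monoid : monoid_morphism ip_rat.
Proof. by split=> [|a b]; rewrite /ip_rat ?rmorph1 // !rmorphM. Qed.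

HB.instance Definition _ :=
  GRing.isZmodMorphism.Build intpoly (fps L rat) ip_rat ip_rat_zmod.
HB.instance Definition _ :=
  GRing.isMonoidMorphism.Build intpoly (fps L rat) ip_rat ip_rat_monoid.

Lemma ip_rat_inj : injective ip_rat.
Proof.
move=> a b ab; apply: val_inj; apply/fpsP => k.
by have /intr_inj := congr1 (fun f : fps L rat => f k) ab.
Qed.

Lemma rat_fps_div n (b : fps L rat) : (0 < n)%N -> exists c, c *+ n = b.
Proof.
move=> n0; exists (fpsC L (n%:R^-1) * b); apply/fpsP => k.
rewrite fcoefMn coef_CM -mulrnAl -[X in X * _]mulr_natr mulVf ?mul1r //.
by rewrite Num.Theory.pnatr_eq0 -lt0n.
Qed.

(** The kernel of evaluation, transported to the rational series in which logarithms live. It is the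
    subgroup to which [symmetric_cocycle] is applied. *)
Definition ip_ker (b : fps L rat) := exists2 a, ip_eval a = 0 & ip_rat a = b.

Lemma ip_ker_subgroup : subgroup ip_ker.
Proof.
split=> [|_ _ [a a0 <-] [b b0 <-]]; first by exists 0; rewrite rmorph0.
exists (a - b); last by rewrite (rmorphB ip_rat).
by rewrite ip_eval_zmod a0 b0 subr0.
Qed.

Lemma ip_mulrn_eq0 (a : intpoly) n : (0 < n)%N -> a *+ n = 0 -> a = 0.
Proof.
move=> n0 an; apply: val_inj; apply/fpsP => k.
have := congr1 (fun f : intpoly => val f k) an.
rewrite rmorphMn fcoefMn /= => /eqP.
by rewrite Num.Theory.mulrn_eq0 eqn0Ngt n0 => /eqP.
Qed.

Lemma ip_var_regular z (a b : intpoly) : ip_var z * a = b *+ 2 ->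
  exists c, a = c *+ 2.
Proof.
move=> ab.
have H k : val a k = val b (z +` k)%mset *+ 2.
  have := congr1 (fun f : intpoly => val f (z +` k)%mset) ab.
  rewrite (_ : val (ip_var z * a) = pvar int z * val a) //.
  by rewrite rmorphMn fcoefMn => <-; rewrite coef_varM mset1D1 msetB_add.
have [s [_ Hs]] := ip_supp a.
pose c : fps L int := Fps (fun k => val b (z +` k)%mset).
have cs : c \in fin_supp.
  apply/fin_suppP; exists s => k /= ck; apply: Hs; rewrite H.
  by rewrite Num.Theory.mulrn_eq0 negb_or.
exists (IntPoly cs); apply: val_inj; apply/fpsP => k.
by rewrite rmorphMn fcoefMn H.
Qed.

End FiniteSupport.

Notation dge := (vge (fun=> 1%N)).

(** * Logarithms and the group laws they define *)

Section Logarithm.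
Variable B : comNzRingType.
Implicit Types l : fps 'I_1 B.

Definition app (V : choiceType) l (a : fps V B) : fps V B :=
  psub l (fun _ : 'I_1 => a).

Definition islog l := dge 2 (l - pvar B ord0).

Section App.
Variable V : choiceType.
Implicit Types a b : fps V B.

Lemma admissible1 a : nconst a -> admissible (fun _ : 'I_1 => a).
Proof. by move=> a0; exact: admissible_fin. Qed.

Definition logrest l a := app (l - pvar B ord0) a.

Lemma appE l a : nconst a -> app l a = a + logrest l a.
Proof.
move=> a0; have ag := admissible1 a0.
by rewrite /logrest /app psubB // psub_var // addrC subrK.
Qed.

Lemma logrest_congr l a b d : islog l -> nconst a -> nconst b -> dge d (a - b) ->
  dge d.+1 (logrest l a - logrest l b).
Proof.
move=> Hl a0 b0 ab; apply: (@vgeW _ _ _ (d + 2 - 1)%N); first by lia.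
exact: psub_congr.
Qed.

(** l(a) - l(b) differs from a - b by a term of order one higher than a - b, because l is the
    identity modulo degree 2. *)
Lemma app_dge l a b d : islog l -> nconst a -> nconst b ->
  dge d (app l a - app l b) -> dge d (a - b).
Proof.
move=> Hl a0 b0; elim: d => [|d IH] H; first exact: vge0.
have ab : dge d (a - b) by apply: IH; exact: vgeW H.
rewrite (_ : a - b = (app l a - app l b) - (logrest l a - logrest l b)); last first.
  by rewrite !appE //; ring.
by apply: vgeB => //; exact: logrest_congr.
Qed.

Lemma app_inj l a b : islog l -> nconst a -> nconst b -> app l a = app l b -> a = b.
Proof.
move=> Hl a0 b0 ab; apply/eqP; rewrite -subr_eq0; apply/eqP.
apply: (@vge_eq0 _ _ (fun=> 1%N)) => d; apply: (app_dge Hl) => //.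
by rewrite ab subrr; exact: vge_zero.
Qed.

Lemma nconst_log l : islog l -> nconst l.
Proof.
move=> Hl; have := Hl mset0; rewrite wt0 => /(_ isT).
rewrite fcoefB [X in _ - X](_ : _ = 0) ?subr0 //; exact: nconst_var.
Qed.

Lemma nconst_app l a : islog l -> nconst a -> nconst (app l a).
Proof. by move=> Hl a0; apply: nconst_psub; [exact: admissible1|exact: nconst_log]. Qed.

Lemma app_solve l c : islog l -> nconst c -> exists a, nconst a /\ app l a = c.
Proof.
move=> Hl c0; have [||a [a0 aE]] := @fps_fixpoint V B (fun a => c - logrest l a).
- move=> a a0; apply: nconstD => //; apply: nconstN.
  apply: nconst_psub; first exact: admissible1.
  by apply/vge_nconst; exact: vgeW Hl.
- move=> a b d a0 b0 ab; cbv beta.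
  rewrite (_ : _ - _ = - (logrest l a - logrest l b)); last by ring.
  by apply: vgeN; exact: logrest_congr.
by exists a; split=> //; rewrite appE // -{1}aE subrK.
Qed.

Lemma app0 l : islog l -> app l (0 : fps V B) = 0.
Proof.
move=> Hl; apply/fpsP => m; rewrite psub_coef fsbig1 // => k _.
elim/mset_ind: k => [|v k _]; first by rewrite (nconst_log Hl) mul0r.
by rewrite mset_evalD mset_eval1 mul0r fcoef0 mulr0.
Qed.

End App.

Lemma app_psub (V W : choiceType) l (a : fps V B) (g : V -> fps W B) :
  nconst a -> admissible g -> psub (app l a) g = app l (psub a g).
Proof. by move=> a0 ag; rewrite /app psub_comp //; exact: admissible1. Qed.

Definition log_of l (G : fps 'I_2 B) :=
  nconst G /\ app l G = app l (pvar B ord0) + app l (pvar B ord_max).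

Section LogFgl.
Variables (l : fps 'I_1 B) (G : fps 'I_2 B).
Hypotheses (Hl : islog l) (HG : log_of l G).

Lemma nconst_add_log (V : choiceType) (a b : fps V B) : nconst a -> nconst b ->
  nconst (fadd G a b).
Proof.
move=> a0 b0; rewrite fadd_psub; apply: nconst_psub; last by case: HG.
exact: admissible_pair.
Qed.

Lemma app_add (V : choiceType) (a b : fps V B) : nconst a -> nconst b ->
  app l (fadd G a b) = app l a + app l b.
Proof.
move=> a0 b0; have ag := admissible_pair a0 b0; have [G0 GE] := HG.
rewrite fadd_psub -app_psub // GE psubD // !app_psub ?psub_var //; exact: nconst_var.
Qed.

(** The injective map [app l] turns each axiom into the corresponding law of addition. *)
Lemma log_is_fgl : is_fgl G.
Proof.
have v0 (V : choiceType) (v : V) : nconst (pvar B v) := nconst_var B v.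
have n0 (V : choiceType) : nconst (0 : fps V B) := nconst0 B V.
rewrite /is_fgl !pvarE !faddE; split; apply: (app_inj Hl) => //.
- exact: nconst_add_log.
- by rewrite app_add // app0 // addr0.
- exact: nconst_add_log.
- by rewrite app_add // app0 // add0r.
- exact: nconst_add_log.
- exact: nconst_add_log.
- by rewrite !app_add // addrC.
- by apply: nconst_add_log => //; exact: nconst_add_log.
- by apply: nconst_add_log => //; exact: nconst_add_log.
- by rewrite !app_add ?addrA //; exact: nconst_add_log.
Qed.

Lemma log_dge2 : dge 2 (G - (pvar B ord0 + pvar B ord_max)).
Proof.
have v0 (V : choiceType) (v : V) : nconst (pvar B v) := nconst_var B v.
have [G0] := HG; rewrite !appE // => E.
rewrite (_ : _ - _ = logrest l (pvar B ord0) + logrest l (pvar B ord_max) -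
   logrest l G); last by rewrite -{1}[G](addrK (logrest l G)) E; ring.
have H (a : fps 'I_2 B) : nconst a -> dge 2 (logrest l a).
  by move=> a0; exact: vge_psub.
by apply: vgeB; [apply: vgeD; exact: H|exact: H].
Qed.

Lemma log_exists (l' : fps 'I_1 B) : islog l' -> exists G', log_of l' G'.
Proof.
move=> Hl'; have [||G' [G'0 E]] := @app_solve 'I_2 l' (app l' (pvar B ord0) + app l' (pvar B ord_max)).
- exact: Hl'.
- by apply: nconstD; apply: nconst_app => //; exact: nconst_var.
by exists G'.
Qed.

Lemma log_agree (l' : fps 'I_1 B) G' d : islog l' -> log_of l' G' ->
  dge d (l' - l) -> dge d (G' - G).
Proof.
move=> Hl' [G'0 E'] ll'; have [G0 E] := HG.
apply: (app_dge Hl) => //.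
have H (a : fps 'I_2 B) : nconst a -> dge d (app l' a - app l a).
  move=> a0; rewrite /app -psubB; last exact: admissible1.
  exact: vge_psub.
have v0 (v : 'I_2) : nconst (pvar B v) := nconst_var B v.
rewrite (_ : _ - _ = (app l' (pvar B ord0) - app l (pvar B ord0)) +
  (app l' (pvar B ord_max) - app l (pvar B ord_max)) - (app l' G' - app l G')).
  by apply: vgeB; [apply: vgeD; exact: H|exact: H].
rewrite E E'; ring.
Qed.

(* Changing the coefficient of degree [n] of the logarithm changes the group  *)
(* law by a multiple of [x^n + y^n - (x + y)^n] in degree [n].                *)
Lemma log_perturb c n G' : (1 < n)%N ->
  let l' := l + fpsC _ c * pvar B ord0 ^+ n in
  islog l' /\ (log_of l' G' -> dge n.+1 (G' - G - fpsC _ c *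
    (pvar B ord0 ^+ n + pvar B ord_max ^+ n - (pvar B ord0 + pvar B ord_max) ^+ n))).
Proof.
move=> n1 l'.
have v0 (V : choiceType) (v : V) : nconst (pvar B v) := nconst_var B v.
have xn : dge n (fpsC _ c * pvar B (ord0 : 'I_1) ^+ n).
  apply: vgeMr; rewrite -[n in dge n]muln1; apply: vgeX; apply/vge_nconst; exact: v0.
have Hl' : islog l'.
  rewrite /islog /l' addrAC; apply: vgeD => //; exact: vgeW xn.
split=> // HG'; have [G'0 E'] := HG'; have [G0 E] := HG.
have appl' (a : fps 'I_2 B) : nconst a -> app l' a = app l a + fpsC _ c * a ^+ n.
  move=> a0; have ag := admissible1 a0.
  by rewrite /app /l' psubD // psub_mul // psubC // psubXn // psub_var.
have dG : dge n (G' - G).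
  by apply: (log_agree Hl' HG'); rewrite /l' addrC addKr.
have d2 : dge 2 (G' - (pvar B ord0 + pvar B ord_max)).
  rewrite (_ : _ - _ = (G' - G) + (G - (pvar B ord0 + pvar B ord_max))); last by ring.
  by apply: vgeD; [exact: vgeW dG|exact: log_dge2].
set u := pvar B ord0; set v := pvar B ord_max.
have dpow : dge n.+1 (G' ^+ n - (u + v) ^+ n).
  have := @psub_congr 'I_1 'I_2 B (pvar B ord0 ^+ n) (fun=> G') (fun=> u + v) n 2.
  have uv0 : nconst (u + v) by apply: nconstD; exact: v0.
  rewrite !psubXn; [|exact: admissible1|exact: admissible1].
  rewrite !psub_var; [|exact: admissible1|exact: admissible1].
  rewrite (_ : 2 + n - 1 = n.+1)%N; last by lia.
  move=> H; apply: H => // m; rewrite -[n in (_ < n)%N]muln1.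
  by apply: (@vgeX _ _ _ 1); apply/vge_nconst; exact: v0.
have L0 := logrest_congr Hl G'0 G0 dG.
move: E'; rewrite !appl' // => E'.
rewrite (_ : _ - _ = - (fpsC _ c * (G' ^+ n - (u + v) ^+ n)) -
   (logrest l G' - logrest l G)).
  by apply: vgeB => //; apply: vgeN; exact: vgeMr.
have E1 : G' = app l u + fpsC _ c * u ^+ n + (app l v + fpsC _ c * v ^+ n) -
    fpsC _ c * G' ^+ n - logrest l G'.
  by rewrite -E' appE //; ring.
have E2 : G = app l u + app l v - logrest l G by rewrite -E appE //; ring.
rewrite {1}E1 {1}E2; ring.
Qed.

End LogFgl.
End Logarithm.

(** * Associators and the cocycle relation *)

Section Associator.
Variable B : comNzRingType.
Implicit Types (Phi Gam : fps 'I_2 B).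

Let X := pvar B (inord 0 : 'I_3).
Let Y := pvar B (inord 1 : 'I_3).
Let Z := pvar B (inord 2 : 'I_3).
Let u := pvar B (ord0 : 'I_2).
Let v := pvar B (ord_max : 'I_2).

Definition associator Phi :=
  fadd Phi (fadd Phi X Y) Z - fadd Phi X (fadd Phi Y Z).

Definition coboundary Gam :=
  fadd Gam X Y + fadd Gam (X + Y) Z - fadd Gam Y Z - fadd Gam X (Y + Z).

Lemma fadd_coefsD (V : choiceType) Phi Gam (a b : fps V B) :
  nconst a -> nconst b -> fadd (Phi + Gam) a b = fadd Phi a b + fadd Gam a b.
Proof. by move=> a0 b0; rewrite !fadd_psub psubD //; exact: admissible_pair. Qed.

Lemma fadd_linear (V : choiceType) Phi (a b : fps V B) : nconst a -> nconst b ->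
  fadd Phi a b = a + b + fadd (Phi - (u + v)) a b.
Proof.
move=> a0 b0; have ag := admissible_pair a0 b0.
by rewrite !fadd_psub psubB // psubD // !psub_var //= addrC subrK.
Qed.

Lemma fadd_congr (V : choiceType) Phi (a b a' b' : fps V B) r d :
  nconst a -> nconst b -> nconst a' -> nconst b' ->
  dge r Phi -> dge d (a - a') -> dge d (b - b') ->
  dge (d + r - 1)%N (fadd Phi a b - fadd Phi a' b').
Proof.
move=> a0 b0 a'0 b'0 Hr aa bb; rewrite !fadd_psub; apply: psub_congr => //.
- exact: nconst_pair.
- exact: nconst_pair.
by move=> i; case: ifP.
Qed.

Lemma fadd_dge (V : choiceType) Phi (a b : fps V B) r :
  nconst a -> nconst b -> dge r Phi -> dge r (fadd Phi a b).
Proof.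
by move=> a0 b0 Hr; rewrite fadd_psub; apply: vge_psub => //; exact: nconst_pair.
Qed.

(** Modulo degree n + 1, [Gam] depends only on the linear parts of its arguments, and [Phi], being u
    + v modulo degree 2, transmits a perturbation of order n unchanged. *)
Lemma associator_perturb Phi Gam n : (1 < n)%N ->
  dge 2 (Phi - (u + v)) -> dge n Gam ->
  dge n.+1 (associator (Phi + Gam) - associator Phi - coboundary Gam).
Proof.
move=> n1 HPhi HGam.
have X0 : nconst X by exact: nconst_var.
have Y0 : nconst Y by exact: nconst_var.
have Z0 : nconst Z by exact: nconst_var.
have D2 (a b : fps 'I_3 B) : nconst a -> nconst b ->
    dge 2 (fadd Phi a b - (a + b)).
  move=> a0 b0; rewrite fadd_linear // [_ + fadd _ _ _]addrC addrK.
  exact: fadd_dge.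
have N0 (a b : fps 'I_3 B) : nconst a -> nconst b -> nconst (fadd Phi a b).
  move=> a0 b0; rewrite -[fadd _ _ _](subrK (a + b)); apply: nconstD.
    by apply/vge_nconst; apply: vgeW (D2 _ _ a0 b0).
  exact: nconstD.
have G0 (a b : fps 'I_3 B) : nconst a -> nconst b -> nconst (fadd Gam a b).
  move=> a0 b0; apply/vge_nconst; apply: (@vgeW _ _ _ n); first by lia.
  exact: fadd_dge.
have shift (a b a' b' : fps 'I_3 B) : nconst a -> nconst b -> nconst a' -> nconst b' ->
    dge n (a - a') -> dge n (b - b') ->
    dge n.+1 (fadd Phi a b - fadd Phi a' b' - (a - a') - (b - b')).
  move=> a0 b0 a'0 b'0 aa bb.
  rewrite (fadd_linear _ a0) // (fadd_linear _ a'0) //.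
  rewrite (_ : _ - _ = fadd (Phi - (u + v)) a b - fadd (Phi - (u + v)) a' b'); last by ring.
  apply: (@vgeW _ _ _ (n + 2 - 1)%N); first by lia.
  exact: fadd_congr.
have shiftG (a b a' b' : fps 'I_3 B) : nconst a -> nconst b -> nconst a' -> nconst b' ->
    dge 2 (a - a') -> dge 2 (b - b') -> dge n.+1 (fadd Gam a b - fadd Gam a' b').
  move=> a0 b0 a'0 b'0 aa bb.
  apply: (@vgeW _ _ _ (2 + n - 1)%N); first by lia.
  exact: fadd_congr.
have z2 (a : fps 'I_3 B) d : dge d (a - a) by rewrite subrr; exact: vge_zero.
pose a := fadd Phi X Y; pose g := fadd Gam X Y.
pose b := fadd Phi Y Z; pose h := fadd Gam Y Z.
have a0 : nconst a by exact: N0.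
have b0 : nconst b by exact: N0.
have g0 : nconst g by exact: G0.
have h0 : nconst h by exact: G0.
have ag0 := nconstD a0 g0; have bh0 := nconstD b0 h0.
have XY0 := nconstD X0 Y0; have YZ0 := nconstD Y0 Z0.
have g2 : dge n g by exact: fadd_dge.
have h2 : dge n h by exact: fadd_dge.
have e1 := shift (a + g) Z a Z ag0 Z0 a0 Z0.
have e2 := shift X (b + h) X b X0 bh0 X0 b0.
have e3 := shiftG (a + g) Z (X + Y) Z ag0 Z0 XY0 Z0.
have e4 := shiftG X (b + h) X (Y + Z) X0 bh0 X0 YZ0.
rewrite /associator /coboundary !fadd_coefsD -/a -/g -/b -/h //; try exact: nconstD.
have ra : a + g - a = g by ring.
have rb : b + h - b = h by ring.
rewrite ra in e1; rewrite rb in e2.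
have {}e1 := e1 g2 (z2 _ _); have {}e2 := e2 (z2 _ _) h2.
have {}e3 : dge n.+1 (fadd Gam (a + g) Z - fadd Gam (X + Y) Z).
  apply: e3 => //; rewrite addrAC; apply: vgeD; [exact: D2|exact: vgeW g2].
have {}e4 : dge n.+1 (fadd Gam X (b + h) - fadd Gam X (Y + Z)).
  apply: e4 => //; rewrite addrAC; apply: vgeD; [exact: D2|exact: vgeW h2].
have := vgeB (vgeD e1 e3) (vgeD e2 e4); congr (vge _ _ _); ring.
Qed.

Definition mono2 i j : {mset 'I_2}%mset := (msetn i ord0 `+` msetn j ord_max)%mset.
Definition mono3 i j k : {mset 'I_3}%mset :=
  (msetn i (inord 0) `+` (msetn j (inord 1) `+` msetn k (inord 2)))%mset.

Lemma deg_mono2 i j : deg (mono2 i j) = (i + j)%N.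
Proof. by rewrite degD !degn. Qed.

Lemma deg_mono3 i j k : deg (mono3 i j k) = (i + (j + k))%N.
Proof. by rewrite !degD !degn. Qed.

Lemma mono2_inj i j i' j' : mono2 i j = mono2 i' j' -> i = i' /\ j = j'.
Proof.
move=> E; split.
  by have := congr1 (fun m : {mset 'I_2}%mset => m ord0) E; rewrite !msetE2 !msetnE /= !addn0.
by have := congr1 (fun m : {mset 'I_2}%mset => m ord_max) E; rewrite !msetE2 !msetnE.
Qed.

Lemma mono3_coef i j k : [/\ mono3 i j k (inord 0) = i, mono3 i j k (inord 1) = j
  & mono3 i j k (inord 2) = k].
Proof.
by split; rewrite !msetE2 !msetnE -!(inj_eq val_inj) /= !inordK //= ?addn0.
Qed.

Lemma mono3_eq i j k i' j' k' :
  (mono3 i j k == mono3 i' j' k') = [&& i == i', j == j' & k == k'].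
Proof.
apply/eqP/and3P => [E|[/eqP -> /eqP -> /eqP ->] //].
have [a1 a2 a3] := mono3_coef i j k; have [b1 b2 b3] := mono3_coef i' j' k'.
by split; apply/eqP; [rewrite -a1 E|rewrite -a2 E|rewrite -a3 E].
Qed.

Lemma coef_mono3 i j k i' j' k' :
  (X ^+ i' * (Y ^+ j' * Z ^+ k')) (mono3 i j k) =
  [&& i == i', j == j' & k == k']%:R.
Proof.
rewrite /X /Y /Z -!mset_evaln -!mset_evalD -[mset_eval _ _]/(fpsX B (mono3 i' j' k')).
by rewrite coef_X mono3_eq.
Qed.

Lemma mset_eval_pair (V : choiceType) (a b : fps V B) p :
  mset_eval (fun i : 'I_2 => if i == ord0 then a else b) p =
  a ^+ p ord0 * b ^+ p ord_max.
Proof. by rewrite {1}[p]mset_I2 mset_evalD !mset_evaln /=. Qed.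

Lemma coef_fadd_single (V : choiceType) Gam (a b : fps V B) m i j c :
  (forall i' j', (a ^+ i' * b ^+ j') m = c *+ ((i' == i) && (j' == j))) ->
  fadd Gam a b m = Gam (mono2 i j) * c.
Proof.
move=> H; rewrite fadd_psub psub_coef (@fsbig_setT_seq _ _ [:: mono2 i j]) //.
  rewrite big_seq1 mset_eval_pair H !msetE2 !msetnE /= ?addn0 ?add0n.
  by rewrite !eqxx mulr1n.
move=> p; rewrite inE mset_eval_pair H => pij.
rewrite (_ : (_ && _) = false) ?mulr0n ?mulr0 //; apply: contraNF pij.
by move=> /andP[/eqP <- /eqP <-]; rewrite {1}[p]mset_I2.
Qed.

Lemma coef_fadd_none (V : choiceType) Gam (a b : fps V B) m :
  (forall i' j', (a ^+ i' * b ^+ j') m = 0) -> fadd Gam a b m = 0.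
Proof.
by move=> H; rewrite fadd_psub psub_coef fsbig1 // => p _; rewrite mset_eval_pair H mulr0.
Qed.

(** A monomial divisible by X, Y and Z can occur only in Gam(X + Y, Z) and Gam(X, Y + Z); the
    binomials come from expanding X + Y and Y + Z. *)
Lemma coef_coboundary Gam i j k : (0 < i)%N -> (0 < j)%N -> (0 < k)%N ->
  coboundary Gam (mono3 i j k) =
  Gam (mono2 (i + j) k) *+ 'C(i + j, i) - Gam (mono2 i (j + k)) *+ 'C(j + k, j).
Proof.
move=> i0 j0 k0; rewrite /coboundary !fcoefB fcoefD.
rewrite (@coef_fadd_none _ Gam X Y); last first.
  move=> i' j'; rewrite -[Y ^+ j']mulr1 -(expr0 Z) coef_mono3.
  by rewrite (gtn_eqF k0) !andbF.
rewrite (@coef_fadd_none _ Gam Y Z); last first.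
  move=> i' j'; rewrite -[_ * _]mul1r -(expr0 X) coef_mono3.
  by rewrite (gtn_eqF i0).
rewrite add0r subr0; congr (_ - _); rewrite -[RHS]mulr_natr.
  apply: coef_fadd_single => a b; rewrite exprDn mulr_suml fcoef_sum.
  under eq_bigr => s _ do rewrite mulrnAl fcoefMn -mulrA coef_mono3.
  have [aE|ne] := eqVneq a (i + j)%N; last first.
    rewrite big1 //= => s _; case: (i =P _) => //= [iE|]; last by rewrite mul0rn.
    case: (j =P _) => //= [jE|]; last by rewrite mul0rn.
    by case/eqP: ne; rewrite iE jE subnK // -ltnS.
  have js : (j < a.+1)%N by rewrite aE ltnS leq_addl.
  rewrite (bigD1 (Ordinal js)) //= big1 ?addr0; last first.
    move=> s sj; case: (j =P _) => [jE|]; rewrite ?andbF ?mul0rn //=.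
    by case/eqP: sj; apply: val_inj.
  rewrite aE addnK !eqxx /= -bin_sub ?leq_addl // addnK eq_sym.
  by case: (b == k); rewrite ?mulr1n ?mul0rn ?mulr0n.
apply: coef_fadd_single => a b; rewrite exprDn mulr_sumr fcoef_sum.
under eq_bigr => s _ do rewrite mulrnAr fcoefMn coef_mono3.
rewrite [a == i]eq_sym; case: (i == a) => /=; last by rewrite big1 // => s _; rewrite mul0rn.
have [bE|ne] := eqVneq b (j + k)%N; last first.
  rewrite big1 //= => s _; case: (j =P _) => //= [iE|]; last by rewrite mul0rn.
  case: (k =P _) => //= [jE|]; last by rewrite mul0rn.
  by case/eqP: ne; rewrite iE jE subnK // -ltnS.
have ks : (k < b.+1)%N by rewrite bE ltnS leq_addl.
rewrite (bigD1 (Ordinal ks)) //= big1 ?addr0; last first.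
  move=> s sj; case: (k =P _) => [jE|]; rewrite ?andbF ?mul0rn //=.
  by case/eqP: sj; apply: val_inj.
by rewrite bE addnK !eqxx /= -bin_sub ?leq_addl // addnK.
Qed.

Lemma coef_binomial2 n i : (0 < i < n)%N ->
  (u ^+ n + v ^+ n - (u + v) ^+ n) (mono2 i (n - i)%N) = - ('C(n, i)%:R).
Proof.
move=> /andP[i0 iN].
have C a b : (u ^+ a * v ^+ b) (mono2 i (n - i)%N) = ((a == i) && (b == n - i)%N)%:R.
  rewrite /u /v -!mset_evaln -!mset_evalD -[mset_eval _ _]/(fpsX B (mono2 a b)).
  rewrite coef_X; congr (_%:R); congr nat_of_bool.
  apply/eqP/andP => [/mono2_inj[-> ->] //|[/eqP -> /eqP ->] //].
rewrite fcoefB fcoefD exprDn fcoef_sum.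
rewrite -[u ^+ n]mulr1 -(expr0 v) C -[v ^+ n]mul1r -(expr0 u) C.
rewrite (gtn_eqF iN) (ltn_eqF i0) /= addr0 sub0r; congr (- _).
have js : (n - i < n.+1)%N by rewrite ltnS leq_subr.
rewrite (bigD1 (Ordinal js)) //= big1 ?addr0; last first.
  move=> s sj; rewrite fcoefMn C; case: (nat_of_ord s =P (n - i)%N) => [jE|].
    by case/eqP: sj; apply: val_inj.
  by rewrite andbF mul0rn.
by rewrite fcoefMn C subKn 1?ltnW // !eqxx bin_sub // ltnW.
Qed.

End Associator.

Lemma fgl_swap (R : comNzRingType) (G : fps 'I_2 R) i j : is_fgl G ->
  G (mono2 i j) = G (mono2 j i).
Proof.
move=> HG; pose u := pvar R (ord0 : 'I_2); pose v := pvar R (ord_max : 'I_2).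
have C a b : (u ^+ a * v ^+ b) (mono2 i j) = 1 *+ ((a == i) && (b == j)).
  rewrite /u /v -!mset_evaln -!mset_evalD -[mset_eval _ _]/(fpsX R (mono2 a b)).
  rewrite coef_X; congr (_%:R); congr nat_of_bool.
  by apply/eqP/andP => [/mono2_inj[-> ->] //|[/eqP -> /eqP ->] //].
have [u0 v0] : nconst u /\ nconst v by split; exact: nconst_var.
have := congr1 (fun f : fps 'I_2 R => f (mono2 i j)) (fgl_addC HG u0 v0).
rewrite (coef_fadd_single G C) (@coef_fadd_single _ _ G v u _ j i 1) ?mulr1 //.
by move=> a b; rewrite mulrC C andbC.
Qed.

Section FglMap.
Variables (R S : comNzRingType) (phi : {rmorphism R -> S}).

Lemma fps_map_fadd (V : choiceType) (G : fps 'I_2 R) (a b : fps V R) :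
  nconst a -> nconst b ->
  fps_map phi (fadd G a b) = fadd (fps_map phi G) (fps_map phi a) (fps_map phi b).
Proof.
move=> a0 b0; rewrite !fadd_psub fps_map_psub; last exact: admissible_pair.
by apply: eq_psub => i; case: ifP.
Qed.

Lemma fps_map_inj (V : choiceType) : injective phi ->
  injective (fps_map phi : fps V R -> fps V S).
Proof.
move=> phiI f g fg; apply/fpsP => m; apply: phiI.
exact: (congr1 (fun h : fps V S => h m) fg).
Qed.

Lemma is_fgl_map_inj (G : fps 'I_2 R) : injective phi -> nconst G ->
  is_fgl (fps_map phi G) -> is_fgl G.
Proof.
move=> phiI G0; rewrite /is_fgl !pvarE !faddE.
have v0 (V : choiceType) (v : V) : nconst (pvar R v) := nconst_var R v.
have z0 (V : choiceType) : nconst (0 : fps V R) := nconst0 R V.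
have ad (V : choiceType) (a b : fps V R) : nconst a -> nconst b -> nconst (fadd G a b).
  by move=> a0 b0; rewrite fadd_psub; apply: nconst_psub => //; exact: admissible_pair.
by move=> [h1 h2 h3 h4]; split; apply: (fps_map_inj phiI);
   rewrite !fps_map_fadd ?rmorph0 ?fps_map_var //; apply: ad.
Qed.

Lemma fps_map_associator (G : fps 'I_2 R) : nconst G ->
  fps_map phi (associator G) = associator (fps_map phi G).
Proof.
move=> G0.
have v0 (V : choiceType) (v : V) : nconst (pvar R v) := nconst_var R v.
have ad (V : choiceType) (a b : fps V R) : nconst a -> nconst b -> nconst (fadd G a b).
  by move=> a0 b0; rewrite fadd_psub; apply: nconst_psub => //; exact: admissible_pair.
by rewrite /associator [LHS]fps_map_zmod !fps_map_fadd ?fps_map_var //; apply: ad.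
Qed.
End FglMap.

Lemma fgl_associator0 (R : comNzRingType) (G : fps 'I_2 R) : is_fgl G ->
  associator G = 0.
Proof.
move=> HG; rewrite /associator (fgl_addA HG) ?subrr //; exact: nconst_var.
Qed.

Lemma fgl_nconst (R : comNzRingType) (G : fps 'I_2 R) : is_fgl G -> nconst G.
Proof.
by move=> HG; rewrite /nconst -(msetn0 (ord0 : 'I_2)) fgl_coef_left.
Qed.

Lemma fgl_dge2 (R : comNzRingType) (G : fps 'I_2 R) : is_fgl G ->
  dge 2 (G - (pvar R ord0 + pvar R ord_max)).
Proof.
move=> HG; rewrite {1}(fgl_decomp HG) addrC addKr.
apply: (@vgeM _ _ _ 1 1); first by apply/vge_nconst; exact: nconst_var.
by apply: vgeMl; apply/vge_nconst; exact: nconst_var.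
Qed.

(** * Lifting a group law to integer polynomials *)

Section Lift.
Variables (L : comNzRingType) (F : fps 'I_2 L).
Hypothesis HF : is_fgl F.

Let B := fps L rat : comNzRingType.
Let uv := mono2 1 1.

Definition lifted (G : fps 'I_2 B) m :=
  exists a : intpoly L, ip_rat a = G m /\ ip_eval a = F m.

(** Besides the lifting up to degree n, the coefficient of u v is kept equal to a polynomial
    variable, which is regular modulo 2 by [ip_var_regular]. *)
Definition lift_stage n (l : fps 'I_1 B) := islog l /\ exists G, [/\ log_of l G,
  forall m, (deg m <= n)%N -> lifted G m & G uv = ip_rat (ip_var (F uv))].

Lemma lifted_axis G (m : {mset 'I_2}%mset) : is_fgl G -> m ord0 = 0%N \/ m ord_max = 0%N -> lifted G m.
Proof.
move=> HG; rewrite [m]mset_I2 !msetE2 !msetnE /= ?addn0 ?add0n.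
case=> ->; rewrite msetn0 ?mset0D ?msetD0.
  by exists ((m ord_max == 1%N)%:R); rewrite !rmorph_nat !fgl_coef_right.
by exists ((m ord0 == 1%N)%:R); rewrite !rmorph_nat !fgl_coef_left.
Qed.

Lemma islog_var : islog (pvar B ord0).
Proof. by rewrite /islog subrr; exact: vge_zero. Qed.

Lemma lift_stage2 : exists l, lift_stage 2 l.
Proof.
pose X := ip_rat (ip_var (F uv)) : B.
(* The additive law changes by c (u^2 + v^2 - (u + v)^2) = - 2 c u v, which has to be X u v. *)
have [c cE] : exists c : B, c *+ 2 = - X by exact: rat_fps_div.
have HG0 : log_of (pvar B ord0) (pvar B ord0 + pvar B ord_max).
  have v0 (v : 'I_2) : nconst (pvar B v) := nconst_var B v.
  split; first by apply: nconstD.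
  by rewrite /app !psub_var //; apply: admissible1 => //; exact: nconstD.
have uv1 : (0 < 1 < 2)%N by [].
pose l := pvar B (ord0 : 'I_1) + fpsC _ c * pvar B ord0 ^+ 2.
have Hl : islog l by have [] := @log_perturb B _ _ islog_var HG0 c 2 0 isT.
have [G HG] := log_exists Hl; exists l; split=> //; exists G.
have [_ H] := @log_perturb B _ _ islog_var HG0 c 2 G isT.
have GE : G uv = X.
  have := H HG uv; rewrite -degE deg_mono2 => /(_ isT) /eqP.
  rewrite fcoefB coef_CM coef_binomial2 // fcoefB fcoefD !pvar_coef.
  have e0 : (uv == [mset ord0])%mset = false.
    by apply/eqP => /(congr1 (@deg _)); rewrite deg_mono2 degn.
  have e1 : (uv == [mset ord_max])%mset = false.
    by apply/eqP => /(congr1 (@deg _)); rewrite deg_mono2 degn.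
  by rewrite e0 e1 mulr0n addr0 ?subr0 bin1 mulrN opprK mulr_natr cE subr_eq0 => /eqP.
have Gfgl := log_is_fgl Hl HG; split=> // m.
have [m0|m0] := posnP (m ord0); first by move=> _; apply: (lifted_axis Gfgl); left.
have [m1|m1] := posnP (m ord_max); first by move=> _; apply: (lifted_axis Gfgl); right.
rewrite [m]mset_I2; move: (m ord0) (m ord_max) m0 m1 => i j i0 j0.
rewrite -/(mono2 i j) deg_mono2 => ij; have [-> ->] : i = 1%N /\ j = 1%N by lia.
by exists (ip_var (F uv)); rewrite GE ip_eval_var.
Qed.

(** The gap between G and a polynomial lift of F that agrees with G up to degree n is, in degree n +
    1, a symmetric 2-cocycle modulo the kernel of evaluation. Lazard's lemma says that a change of
    logarithm cancels it modulo that kernel. *)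
Lemma lift_step n l : (1 < n)%N -> lift_stage n l ->
  exists c, lift_stage n.+1 (l + fpsC _ c * pvar B ord0 ^+ n.+1).
Proof.
move=> n1 [Hl [G [HG Glift GX]]]; have Gfgl := log_is_fgl Hl HG.
have /choice[Phi HPhi] : forall m : {mset 'I_2}%mset, exists a : intpoly L,
    ip_eval a = F m /\ ((deg m <= n)%N -> ip_rat a = G m).
  move=> m; have [mn|mn] := leqP (deg m) n.
    by have [a [a1 a2]] := Glift m mn; exists a.
  by exists (ip_var (F m)); rewrite ip_eval_var.
have [PhiA PhiAE] : exists P : fps 'I_2 (intpoly L), forall m, P m = Phi m by exists (Fps Phi).
have [PhiB PhiBE] : exists P : fps 'I_2 B, P = fps_map (@ip_rat L) PhiA by exists (fps_map (@ip_rat L) PhiA).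
have evalPhi : fps_map (@ip_eval L) PhiA = F.
  by apply/fpsP => m /=; rewrite PhiAE; case: (HPhi m).
pose Gam := G - PhiB.
have dGam : dge n.+1 Gam.
  move=> m; rewrite -degE ltnS => mn; rewrite fcoefB PhiBE /= PhiAE.
  by have [_ ->] := HPhi m; rewrite ?subrr.
have PhiB2 : dge 2 (PhiB - (pvar B ord0 + pvar B ord_max)).
  rewrite (_ : _ - _ = (G - (pvar B ord0 + pvar B ord_max)) - Gam); last first.
    by rewrite /Gam; ring.
  by apply: vgeB; [exact: (fgl_dge2 Gfgl)|by apply: vgeW dGam; lia].
have PhiA0 : nconst PhiA.
  apply: (@ip_rat_inj L); rewrite rmorph0 PhiAE; have [_] := HPhi mset0.
  by rewrite deg0 => /(_ isT) /= ->; exact: (fgl_nconst Gfgl).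
(* The associator of the polynomial lift evaluates to the associator of F, which is 0. *)
have kerA m : ip_ker ((associator PhiB) m).
  exists ((associator PhiA) m); last by rewrite PhiBE -fps_map_associator.
  have E : fps_map (@ip_eval L) (associator PhiA) = associator F.
    by rewrite -evalPhi; exact: fps_map_associator.
  rewrite (fgl_associator0 HF) in E.
  exact: (congr1 (fun f : fps 'I_3 L => f m) E).
have HK := ip_ker_subgroup L.
pose N := n.+1; have N1 : (1 < N)%N by lia.
pose d i := Gam (mono2 i (N - i)%N).
have coc : cocycle (@ip_ker L) N d.
  split=> [i j k i0 j0 k0 ijk|i i0N].
    have NE : (N - (i + j) = k)%N by lia.
    have NE' : (N - i = j + k)%N by lia.
    rewrite /d NE NE' -coef_coboundary //.
    have PG : PhiB + Gam = G by rewrite /Gam addrC subrK.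
    have : dge N.+1 (associator G - associator PhiB - coboundary Gam).
      by rewrite -{1}PG; exact: associator_perturb.
    rewrite (fgl_associator0 Gfgl) => /(_ (mono3 i j k)).
    rewrite -degE deg_mono3 addnA ijk => /(_ (leqnn _)).
    rewrite sub0r fcoefB fcoefN => /eqP; rewrite subr_eq0 => /eqP <-.
    by apply: subgroupN.
  rewrite /d !fcoefB PhiBE /= !PhiAE subKn; last by lia.
  rewrite (fgl_swap _ _ Gfgl) [X in ip_ker X](_ : _ =
    - (ip_rat (Phi (mono2 i (N - i)%N)) - ip_rat (Phi (mono2 (N - i)%N i)))); last by ring.
  apply: (subgroupN HK).
  exists (Phi (mono2 i (N - i)%N) - Phi (mono2 (N - i)%N i)).
    by rewrite ip_eval_zmod !(proj1 (HPhi _)) (fgl_swap _ _ HF) subrr.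
  by rewrite ip_rat_zmod.
have [c0 Hc0] := symmetric_cocycle N1 HK coc.
(* Division by [bin_gcd], possible over the rationals, turns c0 [bin_red i] into c C(N, i), which is
   what adding c x^N to the logarithm subtracts from the law. *)
have [c cE] := rat_fps_div c0 (bin_gcd_gt0 N1).
exists c; set l' := _ + _.
have [Hl' _] := @log_perturb B _ _ Hl HG c N 0 N1.
have [G' HG'] := log_exists Hl'; split=> //; exists G'.
have [_ H] := @log_perturb B _ _ Hl HG c N G' N1.
have {}H := H HG'.
have low m : (deg m < N)%N -> G' m = G m.
  move=> mN; have := @log_agree B _ _ Hl HG _ G' N Hl' HG'.
  rewrite addrC addKr => /(_ _ m); rewrite -degE mN fcoefB => E.
  apply/eqP; rewrite -subr_eq0; apply/eqP; apply: E => //.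
  apply: vgeMr; apply: (@vgeW _ _ _ (N * 1)%N); first by rewrite muln1.
  by apply: vgeX; apply/vge_nconst; exact: nconst_var.
split=> // [m mN|]; last by rewrite low // deg_mono2.
have G'fgl := log_is_fgl Hl' HG'.
have [mlt|mge] := ltnP (deg m) N; first by rewrite /lifted low //; exact: Glift.
have [m0|m0] := posnP (m ord0); first by apply: (lifted_axis G'fgl); left.
have [m1|m1] := posnP (m ord_max); first by apply: (lifted_axis G'fgl); right.
have dm : deg m = (m ord0 + m ord_max)%N by rewrite {1}[m]mset_I2 deg_mono2.
have dN : deg m = N by apply/eqP; rewrite eqn_leq mN.
have mE : m = mono2 (m ord0) (N - m ord0)%N.
  by rewrite -dN dm addKn {1}[m]mset_I2.
have md : (0 < m ord0 < N)%N by rewrite m0 -dN dm -[X in (X < _)%N]addn0 ltn_add2l.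
move: (m ord0) mE md => i -> md {m0 m1 dm dN mge mN m}.
have := H (mono2 i (N - i)%N); rewrite -degE deg_mono2 subnKC; last by lia.
move=> /(_ (leqnn _)) /eqP.
rewrite fcoefB coef_CM fcoefB coef_binomial2 // mulrN mulr_natr.
rewrite -(bin_redE md) mulnC mulrnA cE opprK -addrA addr_eq0 => /eqP E.
have [a a0 aE] := Hc0 i md.
exists (a + Phi (mono2 i (N - i)%N)).
rewrite (rmorphD (@ip_eval L)) (rmorphD (@ip_rat L)) /= a0 add0r.
split; last by case: (HPhi (mono2 i (N - i)%N)).
by rewrite aE E /d /Gam fcoefB PhiBE /= PhiAE; ring.
Qed.

(** Index n is at stage n + 2, and the step to index n + 1 adds a term of degree n + 3, so the
    sequence converges. *)
Fixpoint lift_seq (l : fps 'I_1 B) n : fps 'I_1 B :=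
  if n is n'.+1 then
    let l' := lift_seq l n' in
    l' + fpsC _ (xget 0 [set c | lift_stage n'.+3
                          (l' + fpsC _ c * pvar B ord0 ^+ n'.+3)]) *
         pvar B ord0 ^+ n'.+3
  else l.

Lemma lift_seqP l n : lift_stage 2 l -> lift_stage n.+2 (lift_seq l n).
Proof.
move=> H2; elim: n => //= n IH.
have [|c] := @xgetPex _ 0 [set c | lift_stage n.+3
    (lift_seq l n + fpsC _ c * pvar B ord0 ^+ n.+3)].
  by have [c Hc] := lift_step (isT : (1 < n.+2)%N) IH; exists c.
by [].
Qed.

Lemma fgl_lift : exists FA : fps 'I_2 (intpoly L),
  [/\ is_fgl FA, fps_map (@ip_eval L) FA = F & FA uv = ip_var (F uv)].
Proof.
have [l0 Hl0] := lift_stage2.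
pose ls := lift_seq l0; have Hls n : lift_stage n.+2 (ls n) := lift_seqP n Hl0.
have lsD n k : dge n.+3 (ls (n + k)%N - ls n).
  elim: k => [|k IH]; first by rewrite addn0 subrr; exact: vge_zero.
  rewrite addnS /ls /= -/ls addrAC; apply: vgeD => //; apply: vgeMr.
  apply: (@vgeW _ _ _ ((n + k).+3 * 1)%N); first by lia.
  by apply: vgeX; apply/vge_nconst; exact: nconst_var.
pose l : fps 'I_1 B := Fps (fun m => ls (deg m) m).
have lls n : dge n.+3 (l - ls n).
  move=> m; rewrite -degE fcoefB /= => mn.
  have [nm|mn'] := leqP n (deg m).
    by rewrite -(subnKC nm) -fcoefB; apply: lsD; rewrite -degE.
  rewrite -(subnKC (ltnW mn')) -opprB -fcoefB lsD ?oppr0 // -degE; lia.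
have Hl : islog l.
  rewrite /islog (_ : _ - _ = (l - ls 0%N) + (ls 0%N - pvar B ord0)); last by ring.
  by apply: vgeD; [exact: vgeW (lls 0%N)|case: (Hls 0%N)].
have [G HG] := log_exists Hl; have Gfgl := log_is_fgl Hl HG.
have GE n : exists Gn, [/\ log_of (ls n) Gn, forall m, (deg m <= n.+2)%N -> lifted Gn m,
    Gn uv = ip_rat (ip_var (F uv)) & dge n.+3 (G - Gn)].
  have [Hn [Gn [H1 H2 H3]]] := Hls n; exists Gn; split=> //.
  exact: (log_agree Hn H1 Hl HG).
have lG m : lifted G m.
  have [Gn [_ H2 _ H4]] := GE (deg m).
  have := H4 m; rewrite -degE => /(_ (leqW (leqW (leqnn _)))).
  rewrite fcoefB => /eqP; rewrite subr_eq0 => /eqP E.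
  by rewrite /lifted E; apply: H2; lia.
have /choice[Phi HPhi] := lG.
pose FA : fps 'I_2 (intpoly L) := Fps Phi.
have GFA : fps_map (@ip_rat L) FA = G by apply/fpsP => m /=; case: (HPhi m).
exists FA; split.
- apply: (is_fgl_map_inj (phi := @ip_rat L) (@ip_rat_inj L)).
    by apply: (@ip_rat_inj L); rewrite rmorph0; have [/= -> _] := HPhi mset0; exact: (fgl_nconst Gfgl).
  by rewrite GFA.
- by apply/fpsP => m /=; case: (HPhi m).
apply: (@ip_rat_inj L); have [Gn [_ _ H3 H4]] := GE 0%N; have [/= -> _] := HPhi uv.
have := H4 uv; rewrite -degE deg_mono2 => /(_ isT).
by rewrite fcoefB H3 => /eqP; rewrite subr_eq0 => /eqP.
Qed.

End Lift.

(** Universality gives [phi] from L to the polynomial ring that carries F to its lift. By the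
    uniqueness clause, evaluation after [phi] is the identity, so both properties descend from
    polynomials, where the image of a_(1,1) is a variable. *)
Theorem lazard_regular (L : comNzRingType) (F : fps 'I_2 L) : lazard F ->
  (forall (z : L) n, (0 < n)%N -> z *+ n = 0 -> z = 0) /\
  (forall z y : L, F (mono2 1 1) * z = y *+ 2 -> exists x, z = x *+ 2).
Proof.
move=> [HF univ]; have [FA [FAfgl FAE FA1]] := fgl_lift HF.
have [phi [phiE _]] := univ _ FA FAfgl.
have qphi z : ip_eval (phi z) = z.
  have [id0 [_ uniq0]] := univ L F HF.
  pose q := (@ip_eval L : {rmorphism intpoly L -> L}) \o phi.
  have -> : ip_eval (phi z) = id0 z.
    apply: (uniq0 q); rewrite -[RHS]FAE -phiE.
    by apply/fpsP.
  apply/esym; apply: (uniq0 (idfun : {rmorphism L -> L})).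
  by apply/fpsP.
split=> [z n n0 zn|z y zy].
  rewrite -(qphi z) (@ip_mulrn_eq0 _ (phi z) n) ?rmorph0 //.
  by rewrite -rmorphMn zn rmorph0.
have [|c cE] := @ip_var_regular L (F (mono2 1 1)) (phi z) (phi y).
  by rewrite -FA1 -phiE /= -rmorphM zy rmorphMn.
by exists (ip_eval c); rewrite -(qphi z) cE raddfMn.
Qed.

#[global] Hint Resolve nconst0 nconst_var : core.

(** * Regular series and divisibility *)

Definition reg (A : comNzRingType) (f : A) := forall h, f * h = 0 -> h = 0.

Section Regular.
Variable A : comNzRingType.
Implicit Types f g : A.

Lemma reg1 : reg (1 : A). Proof. by move=> h; rewrite mul1r. Qed.

Lemma regM f g : reg f -> reg g -> reg (f * g).
Proof. by move=> rf rg h; rewrite -mulrA => /rf /rg. Qed.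

Lemma reg_prod (I : Type) (r : seq I) (P : pred I) (E : I -> A) :
  (forall i, P i -> reg (E i)) -> reg (\prod_(i <- r | P i) E i).
Proof. by move=> H; elim/big_ind: _ => //; [exact: reg1|exact: regM]. Qed.

Lemma regI f g h : reg f -> f * g = f * h -> g = h.
Proof.
by move=> rf /eqP; rewrite -subr_eq0 -mulrBr => /eqP /rf /eqP; rewrite subr_eq0 => /eqP.
Qed.

Lemma reg_factor f g : reg (f * g) -> reg f.
Proof. by move=> H h fh; apply: H; rewrite mulrAC fh mul0r. Qed.
End Regular.

Section Replace.
Variables (V : choiceType) (R : comNzRingType).
Implicit Types (f h a : fps V R).

Definition repl (v0 : V) a : V -> fps V R :=
  fun v => if v == v0 then a else pvar R v.

Lemma replE v0 a v : repl v0 a v = if v == v0 then a else pvar R v.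
Proof. by []. Qed.

Lemma admissible_repl v0 a : nconst a -> admissible (repl v0 a).
Proof.
move=> a0; split=> [v|m]; rewrite /repl.
  by case: ifP => // _; exact: nconst_var.
apply: (@sub_finite_set _ _ [set` v0 :: enum_mset m]); last exact: finite_seq.
move=> v /=; rewrite inE; case: (v =P v0) => [//|_] /=.
rewrite pvar_coef; case: (m =P [mset v]%mset) => [->|_]; last by rewrite mulr0n eqxx.
by rewrite mset11.
Qed.

Lemma psub_repl_var v0 a v : nconst a ->
  psub (pvar R v) (repl v0 a) = if v == v0 then a else pvar R v.
Proof. by move=> a0; rewrite psub_var //; exact: admissible_repl. Qed.

Lemma coef_repl0 v0 f m :
  psub f (repl v0 0) m = if v0 \in m then 0 else f m.
Proof.
have E k : mset_eval (repl v0 0) k = if v0 \in k then 0 else fpsX R k.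
  elim/mset_ind: k => [|v k IH]; first by rewrite in_mset0 /fpsX !mset_eval0.
  rewrite mset_evalD mset_eval1 IH in_mset1D /repl eq_sym.
  case: (v0 =P v) => /= [_|_]; first by rewrite mul0r.
  by case: ifP => _; rewrite ?mulr0 // fpsXD /fpsX mset_eval1.
rewrite psub_coef (@fsbig_setT_seq _ _ [:: m]) //.
  rewrite big_seq1 E; case: ifP => _; rewrite ?fcoef0 ?mulr0 //.
  by rewrite coef_X eqxx mulr1.
move=> k; rewrite inE E => km; case: ifP => _; rewrite ?fcoef0 ?mulr0 //.
by rewrite coef_X eq_sym (negPf km) mulr0.
Qed.

Lemma repl0_factor v0 f : psub f (repl v0 0) = 0 -> exists g, f = pvar R v0 * g.
Proof.
move=> f0; exists (Fps (fun m => f (v0 +` m)%mset)).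
apply/fpsP => m; rewrite coef_varM /=.
have := congr1 (fun h : fps V R => h m) f0; rewrite coef_repl0 fcoef0.
by case: ifP => // vm _; rewrite msetB1K.
Qed.

Definition indep v0 a := forall c, nconst c -> psub a (repl v0 c) = a.

Lemma indep_var v0 v : v != v0 -> indep v0 (pvar R v).
Proof. by move=> /negPf vv0 c c0; rewrite psub_repl_var // vv0. Qed.

Variable F : fps 'I_2 R.
Hypothesis HF : is_fgl F.

(* The substitution [v0 := v0 +_F a] is invertible and turns [v0 := a] into   *)
(* [v0 := 0].                                                                 *)
Lemma repl_factor v0 a f : nconst a -> indep v0 a -> psub f (repl v0 a) = 0 ->
  exists g, f = fadd F (pvar R v0) (fopp F a) * g.
Proof.
move=> a0 ia f0.
have x0 : nconst (pvar R v0 : fps V R) by exact: nconst_var.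
have o0 := nconst_opp HF a0.
have p0 := nconst_fgl HF x0 a0; have q0 := nconst_fgl HF x0 o0.
have zE : psub (psub f (repl v0 (fadd F (pvar R v0) a))) (repl v0 0) = 0.
  rewrite psub_comp; [|exact: admissible_repl|exact: admissible_repl].
  rewrite -[RHS]f0; apply: eq_psub => v; rewrite !replE; case: (v =P v0) => [_|/eqP vv0].
    rewrite fgl_psub //; last exact: admissible_repl.
    by rewrite psub_repl_var // eqxx ia // fgl_add0r.
  by rewrite psub_repl_var // (negPf vv0).
have [g gE] := repl0_factor zE.
exists (psub g (repl v0 (fadd F (pvar R v0) (fopp F a)))).
rewrite -{1}[f]psub_id.
rewrite (_ : psub f (pvar R) = psub (psub f (repl v0 (fadd F (pvar R v0) a)))
     (repl v0 (fadd F (pvar R v0) (fopp F a)))).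
  rewrite gE psub_mul; last exact: admissible_repl.
  by rewrite psub_repl_var // eqxx.
rewrite psub_comp; [|exact: admissible_repl|exact: admissible_repl].
apply: eq_psub => v; rewrite replE; case: (v =P v0) => [->|/eqP vv0].
  rewrite fgl_psub //; last exact: admissible_repl.
  by rewrite psub_repl_var // eqxx ia // fgl_addNK.
by rewrite psub_repl_var // (negPf vv0).
Qed.

Lemma fopp_diff (a b : fps V R) : nconst a -> nconst b ->
  fopp F (fadd F a (fopp F b)) = fadd F b (fopp F a).
Proof.
move=> a0 b0.
have oa := nconst_opp HF a0; have ob := nconst_opp HF b0.
have d0 := nconst_fgl HF a0 ob; have e0 := nconst_fgl HF b0 oa.
have E : fadd F (fadd F a (fopp F b)) (fadd F b (fopp F a)) = 0.
  by rewrite (fgl_addA HF) // (fgl_addNK HF) // (fgl_addN HF).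
rewrite -[RHS](fgl_add0r HF) // -(fgl_addNr HF d0) -(fgl_addA HF) //.
  by rewrite E fgl_addr0 //; exact: nconst_opp.
exact: nconst_opp.
Qed.

End Replace.

Section InitFgl.
Variables (V : choiceType) (R : comNzRingType) (F : fps 'I_2 R).
Hypothesis HF : is_fgl F.
Variable w : V -> nat.
Implicit Types a b : fps V R.

Lemma init_fadd a b c p : nconst a -> nconst b ->
  init w a c p -> vge w (wt w p).+1 b -> init w (fadd F a b) c p.
Proof.
move=> a0 b0 ai bv; rewrite (fgl_addE HF) //.
apply: init_eqD; first exact: init_eqD.
by apply: vgeMl; exact: vgeMr.
Qed.

Lemma init_faddr a b c p : nconst a -> nconst b ->
  init w b c p -> vge w (wt w p).+1 a -> init w (fadd F a b) c p.
Proof. by move=> a0 b0 bi av; rewrite (fgl_addC HF) //; exact: init_fadd. Qed.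

Lemma init_fopp a c p : nconst a -> (0 < wt w p)%N ->
  init w a c p -> init w (fopp F a) (- c) p.
Proof.
move=> a0 wp ai; have [J ->] := fgl_oppE HF a0.
apply: init_eqD; first exact: initN.
apply: vgeMl; apply: (@vgeW _ _ _ (2 * wt w p)%N); first by lia.
by apply: vgeX; exact: init_vge ai.
Qed.

Lemma init_double a c p : nconst a -> (0 < wt w p)%N ->
  init w a c p -> init w (fadd F a a) (c *+ 2) p.
Proof.
move=> a0 wp ai; rewrite (fgl_addE HF) //.
apply: init_eqD.
  by rewrite -mulr2n; exact: initMn.
apply: vgeMl; apply: (@vgeW _ _ _ (wt w p + wt w p)%N); first by lia.
by apply: vgeM; exact: init_vge ai.
Qed.

Lemma init_reg1 a p : init w a 1 p -> reg a.
Proof. by apply: init_regular => z; rewrite mul1r. Qed.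

Lemma init_regN1 a p : init w a (- 1) p -> reg a.
Proof. by apply: init_regular => z /eqP; rewrite mulN1r oppr_eq0 => /eqP. Qed.

End InitFgl.

(** * Hall-Littlewood sums *)

Notation xv L i := (pvar L (inl i : xb _)).
Notation bv L n j := (pvar L (inr j : xb n)).

Section XMap.
Variable L : comNzRingType.

Definition xmap m n (g : 'I_m -> fps (xb n) L) (v : xb m) : fps (xb n) L :=
  match v with inl i => g i | inr j => bv L n j end.

Lemma xsubstE m n (f : fps (xb m) L) (g : 'I_m -> fps (xb n) L) :
  xsubst f g = psub f (xmap g).
Proof. by rewrite /xsubst psubE /bvar pvarE. Qed.

Lemma admissible_xmap m n (g : 'I_m -> fps (xb n) L) :
  (forall i, nconst (g i)) -> admissible (xmap g).
Proof.
move=> g0; split=> [[i|j]|k] /=; [exact: g0|exact: nconst_var|].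
apply: (@sub_finite_set _ _ ([set v : xb m | exists i, v = inl i] `|`
   [set v : xb m | exists2 j, (inr j : xb n) \in k & v = inr j])).
  move=> [i|j] /=; first by move=> _; left; exists i.
  move=> nz; right; exists j => //.
  have := indic_neq0 (R := L) (b := (k == [mset (inr j : xb n)]%mset)).
  by rewrite -pvar_coef => /(_ nz) /eqP ->; exact: mset11.
rewrite finite_setU; split.
  rewrite (_ : [set _ | _] = (fun i : 'I_m => inl i : xb m) @` setT).
    by apply: finite_image; exact: finite_finset.
  by apply/seteqP; split=> v /= [i]; [exists i|move=> _ <-; exists i].
apply: (@sub_finite_set _ _ ((fun v : xb n => match v with inl _ => inr 0%N | inr j => inr j end : xb m) @`
  [set` enum_mset k])).
  by move=> v [j jk ->] /=; exists (inr j).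
by apply: finite_image; exact: finite_seq.
Qed.

Lemma xmap_comp m n p (f : fps (xb m) L) (g : 'I_m -> fps (xb n) L)
    (h : 'I_n -> fps (xb p) L) :
  (forall i, nconst (g i)) -> (forall i, nconst (h i)) ->
  psub (psub f (xmap g)) (xmap h) = psub f (xmap (fun i => psub (g i) (xmap h))).
Proof.
move=> g0 h0; rewrite psub_comp; [|exact: admissible_xmap|exact: admissible_xmap].
apply: eq_psub => -[i|j] //=.
by rewrite psub_var //; exact: admissible_xmap.
Qed.

Lemma eq_xmap m n (g h : 'I_m -> fps (xb n) L) (f : fps (xb m) L) :
  g =1 h -> psub f (xmap g) = psub f (xmap h).
Proof. by move=> gh; apply: eq_psub => -[i|j] //=. Qed.

Lemma xmap_id n (f : fps (xb n) L) : psub f (xmap (fun i => xv L i)) = f.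
Proof. by rewrite -[RHS]psub_id; apply: eq_psub => -[i|j]. Qed.

Lemma xmap_repl n (i0 : 'I_n) a (f : fps (xb n) L) :
  psub f (xmap (fun i => if i == i0 then a else xv L i)) = psub f (repl (inl i0) a).
Proof. by apply: eq_psub => -[i|j]; rewrite /repl. Qed.

Lemma xmap_xv m n (g : 'I_m -> fps (xb n) L) i : (forall i, nconst (g i)) ->
  psub (xv L i) (xmap g) = g i.
Proof. by move=> g0; rewrite psub_var //; exact: admissible_xmap. Qed.

Lemma xmap_bv m n (g : 'I_m -> fps (xb n) L) j : (forall i, nconst (g i)) ->
  psub (bv L m j) (xmap g) = bv L n j.
Proof. by move=> g0; rewrite psub_var //; exact: admissible_xmap. Qed.

(* Weights making [x_0 < x_1 < ... < x_(n-1)] < every [b_j].                  *)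
Definition om n (B : nat) (v : xb n) : nat :=
  match v with inl i => B + i | inr _ => B + n end.

End XMap.

(* [W h = \sum_i N_i E_i] with [W = D_i E_i] says that [c h] is the sum of    *)
(* the fractions [N_i / D_i].                                                 *)
Lemma sum_fractionsE (A : comNzRingType) (I : finType) (c : nat) (N D E : I -> A)
    (W h : A) :
  reg W -> (forall a : A, a *+ c = 0 -> a = 0) -> (forall i, D i * E i = W) ->
  h * W *+ c = \sum_i N i * E i -> sum_fractions c N D = h.
Proof.
move=> rW rc DE hW.
have rD i : reg (D i) by apply: (@reg_factor _ _ (E i)); rewrite DE.
have rP : reg (\prod_i D i) by apply: reg_prod.
have ok : h * (c%:R * \prod_i D i) = \sum_i N i * \prod_(j | j != i) D j.
  apply: (regI rW); rewrite mulr_sumr.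
  have -> : \sum_i W * (N i * \prod_(j | j != i) D j) =
            \prod_i D i * (\sum_i N i * E i).
    rewrite mulr_sumr; apply: eq_bigr => i _.
    by rewrite -(DE i) [in RHS](bigD1 i) //=; ring.
  by rewrite -hW -mulr_natl; ring.
have uniq h' : h' * (c%:R * \prod_i D i) = \sum_i N i * \prod_(j | j != i) D j ->
    h' = h.
  rewrite -ok => /eqP; rewrite -subr_eq0 -mulrBl mulrCA => /eqP; rewrite mulr_natl.
  move=> /rc; rewrite mulrC => /rP /eqP; rewrite subr_eq0 => /eqP //.
apply: uniq; exact: (@xgetPex _ 0 [set h : A | h * (c%:R * \prod_i D i) =
   \sum_i N i * \prod_(j | j != i) D j] (ex_intro _ h ok)).
Qed.

(** * Divisibility of symmetric series by the common denominator *)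

Section HallLittlewood.
Variables (L : comNzRingType) (F : fps 'I_2 L).
Hypothesis HF : is_fgl F.
Hypothesis Ltf : forall (z : L) n, (0 < n)%N -> z *+ n = 0 -> z = 0.

Lemma fps_tf (V : choiceType) (f : fps V L) n : (0 < n)%N -> f *+ n = 0 -> f = 0.
Proof.
move=> n0 fn; apply/fpsP => m; apply: (Ltf n0).
by rewrite -fcoefMn fn.
Qed.

Section Factors.
Variable n : nat.
Implicit Types i j : 'I_n.

Definition fac_v i j := fadd F (xv L i) (xv L j).
Definition fac_u i j := fadd F (xv L i) (fopp F (xv L j)).

Lemma nconst_u i j : nconst (fac_u i j).
Proof. by apply: nconst_fgl => //; exact: nconst_opp. Qed.

Lemma init_xv B i : init (om B) (xv L i) 1 [mset (inl i : xb n)]%mset.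
Proof. exact: init_var. Qed.

Lemma wt_xv B i : wt (om B) [mset (inl i : xb n)]%mset = (B + i)%N.
Proof. by rewrite wt1. Qed.

Lemma vge_xv B i : vge (@om n B) (B + i)%N (xv L i).
Proof. exact: (@vge_var _ L (@om n B) (inl i)). Qed.

Lemma init_v B i j : i != j -> init (om B) (fac_v i j) 1
  [mset (inl (if (i < j)%N then i else j) : xb n)]%mset.
Proof.
move=> ij; rewrite /fac_v; case: ltnP => [ij'|ji].
  apply: init_fadd => //; first exact: init_xv.
  by rewrite wt_xv; apply: vgeW (@vge_xv B j); rewrite ltn_add2l.
have {}ji : (j < i)%N by rewrite ltn_neqAle ji andbT eq_sym.
apply: init_faddr => //; first exact: init_xv.
by rewrite wt_xv; apply: vgeW (@vge_xv B i); rewrite ltn_add2l.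
Qed.

Lemma init_u B i j : (0 < B)%N -> i != j -> init (om B) (fac_u i j)
  (if (i < j)%N then 1 else - 1)
  [mset (inl (if (i < j)%N then i else j) : xb n)]%mset.
Proof.
move=> B0 ij; rewrite /fac_u.
have o0 : nconst (fopp F (xv L j)) by exact: nconst_opp.
have oi k : init (om B) (fopp F (xv L k)) (- 1) [mset (inl k : xb n)]%mset.
  by apply: init_fopp => //; [rewrite wt_xv; lia|exact: init_xv].
case: ltnP => [ij'|ji].
  apply: init_fadd => //; first exact: init_xv.
  by rewrite wt_xv; apply: vgeW (init_vge (oi j)); rewrite wt_xv ltn_add2l.
have {}ji : (j < i)%N by rewrite ltn_neqAle ji andbT eq_sym.
apply: init_faddr => //.
by rewrite wt_xv; apply: vgeW (@vge_xv B i); rewrite ltn_add2l.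
Qed.

Lemma reg_u i j : i != j -> reg (fac_u i j).
Proof.
move=> ij; have := init_u (isT : (0 < 1)%N) ij.
by case: ifP => _; [exact: init_reg1|exact: init_regN1].
Qed.

(** The cofactor is -1 plus a series without constant term, hence a unit: the two orders of a pair
    give associated factors. *)
Lemma u_sym i j : i != j -> exists J, fac_u j i = fac_u i j * (- 1 + fac_u i j * J).
Proof.
move=> ij; have [J JE] := fgl_oppE HF (nconst_u i j).
exists J; rewrite -[LHS](_ : fopp F (fac_u i j) = _); last exact: fopp_diff.
by rewrite JE; ring.
Qed.

Definition xmerge i j : 'I_n -> fps (xb n) L :=
  fun k => if k == i then xv L j else xv L k.

Lemma nconst_merge i j k : nconst (xmerge i j k).
Proof. by rewrite /xmerge; case: ifP. Qed.

Lemma merge_factor i j f : i != j -> psub f (xmap (xmerge i j)) = 0 ->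
  exists g, f = fac_u i j * g.
Proof.
move=> ij; rewrite xmap_repl => f0; apply: (repl_factor HF _ _ f0) => //.
by apply: indep_var; apply: contra_neq ij => -[].
Qed.

(** Each pair occurs in both orders, so W is symmetric and is a multiple of the denominator of every
    summand. *)
Definition fac_W := \prod_(p : ('I_n * 'I_n)%type | p.1 != p.2) fac_u p.1 p.2.

Lemma reg_W : reg fac_W.
Proof. by apply: reg_prod => p; exact: reg_u. Qed.

End Factors.

Lemma psub_fac_v m n (g : 'I_m -> fps (xb n) L) i j : (forall i, nconst (g i)) ->
  psub (fac_v i j) (xmap g) = fadd F (g i) (g j).
Proof.
by move=> g0; rewrite fgl_psub ?xmap_xv //; exact: admissible_xmap.
Qed.

Lemma psub_fac_u m n (g : 'I_m -> fps (xb n) L) i j : (forall i, nconst (g i)) ->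
  psub (fac_u i j) (xmap g) = fadd F (g i) (fopp F (g j)).
Proof.
move=> g0; have ag := admissible_xmap g0.
by rewrite fgl_psub ?opp_psub ?xmap_xv //; exact: nconst_opp.
Qed.

Section DividedSum.
Variable n : nat.
Implicit Types (f g S : fps (xb n) L) (i j k l : 'I_n).

Lemma psub_merge_u i j : psub (fac_u i j) (xmap (xmerge i j)) = 0.
Proof.
rewrite psub_fac_u; last exact: nconst_merge.
by rewrite /xmerge eqxx; case: eqP => _; rewrite (fgl_addN HF).
Qed.

Lemma merge_u_reg i j k l : (k < l)%N -> (i < j)%N -> (i, j) != (k, l) ->
  reg (psub (fac_u i j) (xmap (xmerge k l))) /\
  reg (psub (fac_u j i) (xmap (xmerge k l))).
Proof.
move=> kl ij ne; rewrite !psub_fac_u; try exact: nconst_merge.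
pose ph (m : 'I_n) := if m == k then l else m.
have E m : xmerge k l m = xv L (ph m) by rewrite /xmerge /ph; case: ifP.
have phij : ph i != ph j.
  rewrite /ph; case: (i =P k) => [ik|ik]; case: (j =P k) => [jk|jk].
  - by move: ij; rewrite ik jk ltnn.
  - by apply: contra_neq ne => lj; rewrite ik -lj.
  - by apply/eqP => il; move: ij; rewrite il jk ltnNge ltnW.
  - by apply/eqP => e; move: ij; rewrite e ltnn.
by rewrite !E; split; apply: reg_u => //; rewrite eq_sym.
Qed.

(** Vanishing on x_i = x_j gives a first factor u. By symmetry the quotient restricted to x_i = x_j
    equals its own negative, so it vanishes there as well, 2 being regular, and gives a second
    factor. *)
Lemma symmetric_divisible S i j : i != j ->
  psub S (xmap (fun k => xv L (tperm i j k))) = S ->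
  psub S (xmap (xmerge i j)) = 0 ->
  exists G, S = fac_u i j * (fac_u j i * G).
Proof.
move=> ij Ssym S0; have ru := reg_u ij.
have n0 (w : 'S_n) k : nconst (xv L (w k) : fps (xb n) L) by [].
have tau0 k : nconst (xv L (tperm i j k) : fps (xb n) L) by [].
have am := admissible_xmap (nconst_merge i j).
have [G1 G1E] := merge_factor ij S0.
have [J JE] := u_sym ij.
have E : G1 = (- 1 + fac_u i j * J) * psub G1 (xmap (fun k => xv L (tperm i j k))).
  apply: (regI ru); rewrite -G1E -{1}Ssym G1E psub_mul; last exact: admissible_xmap.
  by rewrite psub_fac_u // tpermL tpermR -/(fac_u j i) JE; ring.
have M1 : psub G1 (xmap (xmerge i j)) = - psub G1 (xmap (xmerge i j)).
  rewrite {1}E psub_mul // psubD // psubN // psub1 // psub_mul // psub_merge_u.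
  rewrite mul0r addr0 mulN1r xmap_comp //; last exact: nconst_merge.
  congr (- _); apply: eq_xmap => k.
  rewrite xmap_xv; last exact: nconst_merge.
  rewrite /xmerge; case: tpermP => [->|->|/eqP/negPf ki /eqP/negPf kj].
  - by rewrite eqxx; case: ifP.
  - by rewrite eqxx; case: ifP => // /eqP ->.
  - by [].
have G1M : psub G1 (xmap (xmerge i j)) = 0.
  by apply: (@fps_tf _ _ 2) => //; rewrite mulr2n {1}M1 addNr.
have [G2 G2E] := merge_factor ij G1M.
have ji : j != i by rewrite eq_sym.
have [J' JE'] := u_sym ji.
by exists ((- 1 + fac_u j i * J') * G2); rewrite G1E G2E {2}JE'; ring.
Qed.

(** The product Q already split off stays regular on x_k = x_l, because only the pairs (k, l) and
    (l, k) give a factor vanishing there. So the factors of a new pair must divide the quotient. *)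
Lemma divisible_pairs S (s : seq ('I_n * 'I_n)) : uniq s ->
  (forall p, p \in s -> (p.1 < p.2)%N) ->
  (forall i j, (i < j)%N -> exists G, S = fac_u i j * (fac_u j i * G)) ->
  exists G, S = (\prod_(p <- s) (fac_u p.1 p.2 * fac_u p.2 p.1)) * G.
Proof.
move=> us ps HS; elim: s us ps => [|[k l] s IH] /=.
  by exists S; rewrite big_nil mul1r.
move=> /andP[kls us] ps; have [p pin|G GE] := IH us.
  by apply: ps; rewrite inE pin orbT.
have kl : (k < l)%N by apply: (ps (k, l)); rewrite mem_head.
have knl : k != l by apply/eqP => e; move: kl; rewrite e ltnn.
have lnk : l != k by rewrite eq_sym.
set Q := \prod_(p <- s) _ in GE.
have aM := admissible_xmap (nconst_merge k l).
have rQ : reg (psub Q (xmap (xmerge k l))).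
  rewrite psub_prod // big_seq; apply: reg_prod => -[i j] pin /=.
  have ij : (i < j)%N by apply: (ps (i, j)); rewrite inE pin orbT.
  rewrite psub_mul //; have [] := merge_u_reg kl ij.
    by apply: contraNneq kls => <-.
  exact: regM.
have [S' SE] := HS k l kl.
have kill f g : Q * f = fac_u k l * g -> exists g', f = fac_u k l * g'.
  move=> e; apply: merge_factor => //; apply: rQ.
  by rewrite -psub_mul // e psub_mul // psub_merge_u mul0r.
have [G' G'E] := kill _ _ (etrans (esym GE) SE).
have {}SE : Q * G' = fac_u l k * S'.
  by apply: (regI (reg_u knl)); rewrite mulrCA -G'E -GE -SE.
have [J JE] := u_sym knl; have [J' JE'] := u_sym lnk.
have [|G'' G''E] := kill G' ((- 1 + fac_u k l * J) * S').
  by rewrite SE JE; ring.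
exists ((- 1 + fac_u l k * J') * G'').
by rewrite big_cons /= GE -/Q G'E G''E {2}JE'; ring.
Qed.

Lemma symmetric_divisible_W S :
  (forall w : 'S_n, psub S (xmap (fun k => xv L (w k))) = S) ->
  (forall i j, i != j -> psub S (xmap (xmerge i j)) = 0) ->
  exists G, S = G * fac_W n.
Proof.
move=> Ssym S0.
have [||i j ij|G GE] := @divisible_pairs S
    (filter (fun p : ('I_n * 'I_n)%type => (p.1 < p.2)%N) (enum {: ('I_n * 'I_n)%type})).
- by rewrite filter_uniq // enum_uniq.
- by move=> p; rewrite mem_filter => /andP[].
- have ij' : i != j by apply/eqP => e; move: ij; rewrite e ltnn.
  exact: (symmetric_divisible ij' (Ssym (tperm i j)) (S0 i j ij')).
exists G; rewrite GE mulrC; congr (_ * _); rewrite big_filter big_enum_cond /=.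
rewrite big_split /= /fac_W [RHS](bigID (fun p : ('I_n * 'I_n)%type => (p.1 < p.2)%N)) /=.
congr (_ * _).
  by apply: eq_bigl => p; rewrite andb_idl // => lt; apply: contraTneq lt => ->; rewrite ltnn.
rewrite (reindex_inj (h := fun p : ('I_n * 'I_n)%type => (p.2, p.1))) /=; last first.
  by move=> [a b] [c d] [-> ->].
by apply: eq_bigl => p; rewrite -leqNgt ltn_neqAle (inj_eq val_inj) eq_sym.
Qed.

End DividedSum.
End HallLittlewood.

(** * The sum over injections *)

Section HallLittlewoodSum.
Local Close Scope classical_set_scope.
Variables (L : comNzRingType) (F : fps 'I_2 L).
Hypothesis HF : is_fgl F.
Hypothesis Ltf : forall (z : L) n, (0 < n)%N -> z *+ n = 0 -> z = 0.

Variable pow : forall n, fps (xb n) L -> nat -> fps (xb n) L.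
Hypothesis pow_psub : forall m n (g : 'I_m -> fps (xb n) L) t k,
  (forall i, nconst (g i)) -> nconst t ->
  psub (pow t k) (xmap g) = pow (psub t (xmap g)) k.

Variable lam : seq nat.
Let r := size lam.

Section Terms.
Variable n : nat.
Implicit Types (I : {ffun 'I_r -> 'I_n}) (i j : 'I_n).

Definition fac b i j := if b then fac_v F i j else fac_u F i j.

(* [i] is the value of [I] at some [k], and [j] is not among the values at    *)
(* indices up to [k]: the pair contributes to the denominator of the term.    *)
Definition leadpair I i j :=
  [exists k : 'I_r, (I k == i) && [forall l : 'I_r, (l <= k)%N ==> (I l != j)]].

(** For I injective, W times the summand of any permutation extending I: at the leading pairs the
    factor x_i +_F \bar x_j of W cancels against the denominator, leaving the numerator x_i +_F
    x_j. *)
Definition term I : fps (xb n) L :=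
  (\prod_(k < r) pow (xv L (I k)) (nth 0%N lam k)) *
  \prod_(p : ('I_n * 'I_n)%type | p.1 != p.2) fac (leadpair I p.1 p.2) p.1 p.2.

Definition hl_sum : fps (xb n) L := \sum_(I : {ffun 'I_r -> 'I_n} | injectiveb I) term I.

Lemma leadpair_anti I i j : leadpair I i j -> ~~ leadpair I j i.
Proof.
move=> /existsP[k /andP[/eqP ki /forallP Hk]].
apply/negP => /existsP[l /andP[/eqP lj /forallP Hl]].
have [kl|lk] := leqP k l.
  by have := Hl k; rewrite kl ki eqxx.
by have := Hk l; rewrite ltnW // lj eqxx.
Qed.

(** The first index at which I takes one of the values i and j decides which of the two orders is
    leading. *)
Lemma leadpair_total I i j : i != j -> (exists k, I k = i) \/ (exists k, I k = j) ->
  leadpair I i j || leadpair I j i.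
Proof.
move=> ij H; have [k [kij kmin]] : exists k : 'I_r, (I k = i \/ I k = j) /\
    forall l : 'I_r, (l < k)%N -> I l != i /\ I l != j.
  have [k0 Hk0] : exists k : 'I_r, (I k == i) || (I k == j).
    by case: H => -[k <-]; exists k; rewrite eqxx ?orbT.
  case: (@arg_minnP _ k0 (fun k => (I k == i) || (I k == j)) val Hk0) => k Hk kmin.
  exists k; split; first by case/orP: Hk => /eqP; [left|right].
  move=> l lk; apply/andP; rewrite -negb_or; apply/negP => /kmin.
  by rewrite leqNgt lk.
have base (a b : 'I_n) : a != b -> I k = a -> (forall l : 'I_r, (l < k)%N -> I l != b) -> leadpair I a b.
  move=> ab ka Hb; apply/existsP; exists k; rewrite ka eqxx /=.
  apply/forallP => l; apply/implyP; rewrite leq_eqVlt => /orP[/eqP lk|]; last exact: Hb.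
  by rewrite (val_inj lk : l = k) ka.
case: kij => ka; apply/orP; [left|right]; apply: base => //.
- by move=> l /kmin[].
- by rewrite eq_sym.
- by move=> l /kmin[].
Qed.

Lemma psub_fac m (g : 'I_n -> fps (xb m) L) b i j : (forall i, nconst (g i)) ->
  psub (fac b i j) (xmap g) =
  fadd F (g i) (if b then g j else fopp F (g j)).
Proof. by move=> g0; rewrite /fac; case: b; rewrite ?psub_fac_v ?psub_fac_u. Qed.

Lemma psub_term m (g : 'I_n -> fps (xb m) L) I : (forall i, nconst (g i)) ->
  psub (term I) (xmap g) =
  (\prod_(k < r) pow (g (I k)) (nth 0%N lam k)) *
  \prod_(p : ('I_n * 'I_n)%type | p.1 != p.2)
     fadd F (g p.1) (if leadpair I p.1 p.2 then g p.2 else fopp F (g p.2)).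
Proof.
move=> g0; have ag := admissible_xmap g0.
rewrite psub_mul // !psub_prod //; congr (_ * _).
  by apply: eq_bigr => k _; rewrite pow_psub ?xmap_xv.
by apply: eq_bigr => p _; rewrite psub_fac.
Qed.

Lemma term_perm (w : 'S_n) I :
  psub (term I) (xmap (fun i => xv L (w i))) = term [ffun k => w (I k)].
Proof.
rewrite psub_term //; congr (_ * _).
  by apply: eq_bigr => k _; rewrite ffunE.
rewrite [RHS](reindex_inj (h := fun p : ('I_n * 'I_n)%type => (w p.1, w p.2))) /=; last first.
  by move=> [a b] [c d] [/perm_inj -> /perm_inj ->].
apply: eq_big => [p|p _]; first by rewrite (inj_eq perm_inj).
have -> : leadpair [ffun k => w (I k)] (w p.1) (w p.2) = leadpair I p.1 p.2.
  apply: eq_existsb => k; rewrite ffunE (inj_eq perm_inj); congr (_ && _).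
  by apply: eq_forallb => l; rewrite ffunE (inj_eq perm_inj).
by rewrite /fac; case: ifP.
Qed.

Lemma hl_sum_perm (w : 'S_n) : psub hl_sum (xmap (fun i => xv L (w i))) = hl_sum.
Proof.
rewrite /hl_sum psub_sum; last exact: admissible_xmap.
pose h I : {ffun 'I_r -> 'I_n} := [ffun k => w (I k)].
have h_inj : injective h.
  move=> I J /ffunP IJ; apply/ffunP => k; have := IJ k.
  by rewrite !ffunE => /perm_inj.
rewrite [RHS](reindex_inj h_inj) /=; apply: eq_big => [I|I _]; last exact: term_perm.
apply/injectiveP/injectiveP => H k l; first by rewrite !ffunE => /perm_inj /H.
by move=> kl; apply: H; rewrite !ffunE kl.
Qed.

(** At least one of (i, j) and (j, i) is not leading, and it contributes a factor that vanishes on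
    x_i = x_j. *)
Lemma term_merge I i j : i != j -> psub (term I) (xmap (xmerge L i j)) = 0.
Proof.
move=> ij; rewrite psub_term; last exact: nconst_merge.
suff [p [p12 pd pij]] : exists p : ('I_n * 'I_n)%type,
    [/\ p.1 != p.2, leadpair I p.1 p.2 = false & p = (i, j) \/ p = (j, i)].
  rewrite (bigD1 p) //= pd.
  have -> : xmerge L i j p.1 = xmerge L i j p.2.
    by case: pij => -> /=; rewrite /xmerge eqxx; case: eqP => // ->.
  by rewrite (fgl_addN HF) ?mul0r ?mulr0 //; exact: nconst_merge.
have [dij|dij] := boolP (leadpair I i j).
  exists (j, i); split; [by rewrite eq_sym|exact/negbTE/leadpair_anti|by right].
by exists (i, j); split; [|exact/negbTE|left].
Qed.

Lemma hl_exists : exists h, h * fac_W F n = hl_sum.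
Proof.
have [h E] : exists h, hl_sum = h * fac_W F n; last by exists h.
apply: (symmetric_divisible_W HF Ltf); first exact: hl_sum_perm.
move=> i j ij; rewrite /hl_sum psub_sum; last by apply: admissible_xmap; exact: nconst_merge.
by rewrite big1 // => I _; exact: term_merge.
Qed.

End Terms.

Lemma card_perm_fiber n (I : {ffun 'I_r -> 'I_n}) (rn : (r <= n)%N) (w0 : 'S_n) :
  (forall k, w0 (widen_ord rn k) = I k) ->
  #|[set w : 'S_n | [forall k, w (widen_ord rn k) == I k]]| = (n - r)`!.
Proof.
move=> Hw0; pose A := [set i : 'I_n | (r <= i)%N].
have cA : #|A| = (n - r)%N.
  have -> : A = ~: [set widen_ord rn k | k : 'I_r].
    apply/setP => i; rewrite !inE; apply/idP/negP => [ri /imsetP[k _ ik]|H].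
      by move: ri; rewrite ik /= leqNgt ltn_ord.
    rewrite leqNgt; apply/negP => ir; apply: H; apply/imsetP.
    by exists (Ordinal ir) => //; exact: val_inj.
  rewrite cardsCs finset.setCK card_imset ?card_ord //.
  by move=> k l /(congr1 val) /= kl; exact: val_inj.
rewrite -cA -card_perm -[RHS](card_imset _ (mulIg w0)).
apply: eq_card => w; rewrite inE; apply/forallP/imsetP => [Hw|[u uA ->] k].
  exists (w * w0^-1)%g; last by rewrite mulgKV.
  rewrite unfold_in; apply/fintype.subsetP => i; rewrite !inE; apply: contraR; rewrite -ltnNge => ir.
  have -> : i = widen_ord rn (Ordinal ir) by exact: val_inj.
  by rewrite permM (eqP (Hw _)) -Hw0 permK.
rewrite permM (out_perm uA) ?Hw0 // inE /= -ltnNge; exact: ltn_ord.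
Qed.

Lemma sum_perm_restrict n (rn : (r <= n)%N) (A : nmodType)
    (f : {ffun 'I_r -> 'I_n} -> A) :
  \sum_(w : 'S_n) f [ffun k => w (widen_ord rn k)] =
  (\sum_(I : {ffun 'I_r -> 'I_n} | injectiveb I) f I) *+ (n - r)`!.
Proof.
pose res (w : 'S_n) : {ffun 'I_r -> 'I_n} := [ffun k => w (widen_ord rn k)].
have res_inj w : injectiveb (res w).
  apply/injectiveP => k l; rewrite !ffunE => /perm_inj /(congr1 val) /= kl.
  exact: val_inj.
have fib (I : {ffun 'I_r -> 'I_n}) : I \in codom res -> #|[set w | res w == I]| = (n - r)`!.
  move=> /codomP[w0 Iw0]; rewrite -(@card_perm_fiber n I rn w0).
    apply: eq_card => w; rewrite !inE; apply/eqP/forallP => [<- k|H]; first by rewrite ffunE.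
    by apply/ffunP => k; rewrite ffunE (eqP (H k)).
  by move=> k; rewrite Iw0 ffunE.
(* That every injection extends to a permutation follows by counting: the n! permutations fall into
   fibers of size (n - r)!, so there are as many restrictions as injections. *)
have im (I : {ffun 'I_r -> 'I_n}) : injectiveb I = (I \in codom res).
  have sub : [set I : {ffun 'I_r -> 'I_n} | I \in codom res] \subset [set I : {ffun 'I_r -> 'I_n} | injectiveb I].
    by apply/fintype.subsetP => J; rewrite !inE => /codomP[w ->]; exact: res_inj.
  suff /eqP E : [set I : {ffun 'I_r -> 'I_n} | I \in codom res] == [set I : {ffun 'I_r -> 'I_n} | injectiveb I].
    by have := congr1 (fun X : {set _} => I \in X) E; rewrite !inE => ->.
  rewrite eqEcard sub /=.
  have -> : #|[set I : {ffun 'I_r -> 'I_n} | injectiveb I]| = (n ^_ r)%N.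
    by have := card_inj_ffuns ('I_r) ('I_n); rewrite !card_ord cardsE.
  have fn0 := fact_gt0 (n - r); rewrite -(leq_pmul2r fn0) ffact_fact //.
  rewrite -card_Sn -sum1_card.
  rewrite (partition_big res (fun I => I \in codom res)) /=; last first.
    by move=> w _; exact: codom_f.
  rewrite -sum_nat_const [X in (_ <= X)%N](eq_bigl (fun I => I \in codom res)); last first.
    by move=> J; rewrite inE.
  apply: leq_sum => J /fib <-; rewrite -sum1_card; apply/eq_leq/eq_bigl => w.
  by rewrite !inE.
rewrite (partition_big res (fun I => injectiveb I)) /=; last by move=> w _; exact: res_inj.
rewrite -sumrMnl; apply: eq_bigr => I; rewrite im => /fib <-.
rewrite -sumr_const; apply: eq_big => [w|w /eqP <- //]; by rewrite inE.
Qed.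

End HallLittlewoodSum.

(** * The functions as quotients, and their specializations *)

Section HallLittlewoodFunction.
Variables (L : comNzRingType) (F : fps 'I_2 L).
Hypothesis HF : is_fgl F.
Hypothesis Ltf : forall (z : L) n, (0 < n)%N -> z *+ n = 0 -> z = 0.

Variable pow : forall n, fps (xb n) L -> nat -> fps (xb n) L.
Hypothesis pow_psub : forall m n (g : 'I_m -> fps (xb n) L) t k,
  (forall i, nconst (g i)) -> nconst t ->
  psub (pow t k) (xmap g) = pow (psub t (xmap g)) k.

Variable lam : seq nat.
Let r := size lam.

Lemma leadpair_widen n (rn : (r <= n)%N) (w : 'S_n) (i j : 'I_n) : i != j ->
  leadpair (lam := lam) [ffun k => w (widen_ord rn k)] (w i) (w j) = (i < r)%N && (i < j)%N.
Proof.
move=> ij; apply/existsP/andP => [[k /andP[]]|[ir ij']].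
  rewrite ffunE (inj_eq perm_inj) => /eqP <- /forallP H; split; first exact: (ltn_ord k).
  rewrite ltnNge; apply/negP => jk.
  have jr : (j < r)%N by apply: leq_ltn_trans jk (ltn_ord k).
  have := H (Ordinal jr); rewrite jk ffunE (inj_eq perm_inj) /=.
  by rewrite (_ : widen_ord rn _ = j) ?eqxx //; exact: val_inj.
exists (Ordinal ir); rewrite ffunE (inj_eq perm_inj).
rewrite (_ : widen_ord rn _ = i) ?eqxx /=; last exact: val_inj.
apply/forallP => l; apply/implyP => li; rewrite ffunE (inj_eq perm_inj).
apply/eqP => lj; move: ij'; rewrite -lj /= ltnNge; case/negP.
exact: li.
Qed.

Lemma prod_leadpair n (rn : (r <= n)%N) (w : 'S_n) (A : comNzRingType)
    (f : 'I_n -> 'I_n -> A) :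
  \prod_(i < n | (i < r)%N) \prod_(j < n | (i < j)%N) f (w i) (w j) =
  \prod_(p : ('I_n * 'I_n)%type | (p.1 != p.2) &&
     leadpair (lam := lam) [ffun k => w (widen_ord rn k)] p.1 p.2) f p.1 p.2.
Proof.
rewrite pair_big_dep /=.
rewrite [RHS](reindex_inj (h := fun p : ('I_n * 'I_n)%type => (w p.1, w p.2))) /=; last first.
  by move=> [a b] [c d] [/perm_inj -> /perm_inj ->].
apply: eq_bigl => -[i j] /=; rewrite (inj_eq perm_inj).
have [->|ij] := eqVneq i j; first by rewrite ltnn andbF.
by rewrite leadpair_widen.
Qed.

Lemma prod_widen n (rn : (r <= n)%N) (A : comNzRingType) (f : 'I_n -> nat -> A) :
  \prod_(i < n | (i < r)%N) f i i = \prod_(k < r) f (widen_ord rn k) k.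
Proof. by rewrite (big_ord_narrow rn). Qed.

(** This replaces the choice hidden in [sum_fractions] by an equation in the ring, which determines
    the function because W is regular. For n < r both sides are 0, since there are no injections. *)
Lemma hl_funP n : hl_fun F (@pow n) lam * fac_W F n = hl_sum F pow lam n.
Proof.
have [h hW] := hl_exists HF Ltf pow_psub lam n.
have [rn|nr] := leqP r n; last first.
  rewrite /hl_fun -/r leqNgt nr mul0r /hl_sum big_pred0 // => I.
  apply/negP => /injectiveP /leq_card; rewrite !card_ord.
  by rewrite leqNgt nr.
suff -> : hl_fun F (@pow n) lam = h by [].
rewrite /hl_fun -/r rn.
have x0 (w : 'S_n) i : nconst (xv L (w i) : fps (xb n) L) by [].
pose J (w : 'S_n) : {ffun 'I_r -> 'I_n} := [ffun k => w (widen_ord rn k)].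
pose E (w : 'S_n) := \prod_(p : ('I_n * 'I_n)%type | (p.1 != p.2) &&
   ~~ leadpair (lam := lam) (J w) p.1 p.2) fac_u F p.1 p.2.
apply: (@sum_fractionsE _ _ _ _ _ E (fac_W F n)).
- exact: reg_W.
- by move=> a; apply: fps_tf => //; exact: fact_gt0.
- move=> w; rewrite /xperm xsubstE /xvar pvarE faddE foppE.
  have aw := admissible_xmap (x0 w).
  rewrite psub_prod //.
  under eq_bigr => i _.
    rewrite psub_prod //; under eq_bigr => j _.
      rewrite -/(fac_u F i j) psub_fac_u // -/(fac_u F (w i) (w j)); over.
    over.
  rewrite /= (prod_leadpair rn w (@fac_u _ F n)) /fac_W [RHS](bigID (fun p => leadpair (lam := lam) (J w) p.1 p.2)) //.
rewrite hW /hl_sum -(sum_perm_restrict rn); apply: eq_bigr => w _.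
rewrite /xperm xsubstE /xvar pvarE faddE.
have aw := admissible_xmap (x0 w).
rewrite psub_mul // !psub_prod // /term -mulrA; congr (_ * _).
  under eq_bigr => i _ do rewrite pow_psub // xmap_xv //.
  rewrite (prod_widen rn (fun i k => pow (xv L (w i)) (nth 0%N lam k))).
  by apply: eq_bigr => k _; rewrite ffunE.
under eq_bigr => i _.
  rewrite psub_prod //; under eq_bigr => j _.
    rewrite -/(fac_v F i j) psub_fac_v // -/(fac_v F (w i) (w j)); over.
  over.
rewrite /= (prod_leadpair rn w (@fac_v _ F n)) [LHS](bigID (fun p => leadpair (lam := lam) (J w) p.1 p.2)) /=.
by congr (_ * _); apply: eq_bigr => p /andP[_ pd]; rewrite /fac ?pd ?(negPf pd).
Qed.

Lemma hl_fun_unique n h : h * fac_W F n = hl_sum F pow lam n -> hl_fun F (@pow n) lam = h.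
Proof.
move=> hW; apply: (regI (reg_W (n := n) HF)).
by rewrite mulrC hl_funP -hW mulrC.
Qed.

Lemma hl_fun_perm n (w : 'S_n) :
  psub (hl_fun F (@pow n) lam) (xmap (fun i => xv L (w i))) = hl_fun F (@pow n) lam.
Proof.
apply/esym/hl_fun_unique.
have x0 i : nconst (xv L (w i) : fps (xb n) L) by [].
have aw := admissible_xmap x0.
rewrite -(@hl_sum_perm L F HF pow pow_psub lam n w) -hl_funP psub_mul //; congr (_ * _).
rewrite /fac_W psub_prod //.
rewrite (reindex_inj (h := fun p : ('I_n * 'I_n)%type => (w p.1, w p.2))) /=; last first.
  by move=> [a b] [c d] [/perm_inj -> /perm_inj ->].
apply: eq_big => [p|p _]; first by rewrite (inj_eq perm_inj).
by rewrite psub_fac_u.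
Qed.

Section Specialize.
Variables (m n : nat) (ph : 'I_m -> 'I_n).
Hypothesis ph_inj : injective ph.

Let out (p : ('I_n * 'I_n)%type) := ~~ ((p.1 \in codom ph) && (p.2 \in codom ph)).

Definition ph_ffun (I : {ffun 'I_r -> 'I_m}) : {ffun 'I_r -> 'I_n} := [ffun k => ph (I k)].

Lemma prod_pairs (A : comNzRingType) (f : 'I_n -> 'I_n -> A) :
  \prod_(p : ('I_n * 'I_n)%type | p.1 != p.2) f p.1 p.2 =
  (\prod_(q : ('I_m * 'I_m)%type | q.1 != q.2) f (ph q.1) (ph q.2)) *
  \prod_(p : ('I_n * 'I_n)%type | (p.1 != p.2) && out p) f p.1 p.2.
Proof.
rewrite (bigID (fun p => ~~ out p)) /=; congr (_ * _); last first.
  by apply: eq_bigl => p; rewrite negbK.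
pose h (q : ('I_m * 'I_m)%type) := (ph q.1, ph q.2).
have h_inj : injective h by move=> [a b] [c d] [/ph_inj -> /ph_inj ->].
pose A0 := [set q : ('I_m * 'I_m)%type | q.1 != q.2]%SET.
transitivity (\prod_(p in imset h (mem A0)) f p.1 p.2).
  apply: eq_bigl => -[a b]; rewrite /out negbK /=.
  apply/andP/imsetP => [[ab /andP[/codomP[a' aE] /codomP[b' bE]]]|[[c d]]].
    exists (a', b'); last by rewrite /h /= aE bE.
    by rewrite inE /= -(inj_eq ph_inj) -aE -bE.
  rewrite inE /= => cd [-> ->]; rewrite (inj_eq ph_inj) cd; split=> //.
  by rewrite !codom_f.
rewrite big_imset /=; last by move=> p q _ _; exact: h_inj.
by apply: eq_bigl => q; rewrite inE.
Qed.

Lemma leadpair_ph I i j : leadpair (ph_ffun I) (ph i) (ph j) = leadpair (lam := lam) I i j.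
Proof.
apply: eq_existsb => k; rewrite ffunE (inj_eq ph_inj); congr (_ && _).
by apply: eq_forallb => l; rewrite ffunE (inj_eq ph_inj).
Qed.

Lemma sum_ph_ffun (A : nmodType) (f : {ffun 'I_r -> 'I_n} -> A) :
  \sum_(I : {ffun 'I_r -> 'I_n} | injectiveb I && [forall k, I k \in codom ph]) f I =
  \sum_(I : {ffun 'I_r -> 'I_m} | injectiveb I) f (ph_ffun I).
Proof.
have h_inj : injective ph_ffun.
  move=> I I' /ffunP E; apply/ffunP => k; have := E k.
  by rewrite !ffunE => /ph_inj.
pose A0 := [set I : {ffun 'I_r -> 'I_m} | injectiveb I]%SET.
transitivity (\sum_(I in imset ph_ffun (mem A0)) f I).
  apply: eq_bigl => I; apply/andP/imsetP => [[/injectiveP II /forallP H]|[I' I'A ->]].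
    pose I' : {ffun 'I_r -> 'I_m} := [ffun k => iinv (H k)].
    have I'E : I = ph_ffun I' by apply/ffunP => k; rewrite !ffunE f_iinv.
    exists I' => //; rewrite inE; apply/injectiveP => k l kl; apply: II.
    by rewrite I'E [LHS]ffunE [RHS]ffunE kl.
  move: I'A; rewrite inE => /injectiveP II'; split; last first.
    by apply/forallP => k; rewrite ffunE codom_f.
  by apply/injectiveP => k l; rewrite !ffunE => /ph_inj /II'.
rewrite big_imset /=; last by move=> I I' _ _; exact: h_inj.
by apply: eq_bigl => I; rewrite inE.
Qed.

Variable g : 'I_n -> fps (xb n) L.
Hypothesis g0 : forall i, nconst (g i).
Hypothesis g_ph : forall j, g (ph j) = xv L (ph j).

Let C := \prod_(p : ('I_n * 'I_n)%type | (p.1 != p.2) && out p)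
           fadd F (g p.1) (fopp F (g p.2)).

Hypothesis C_reg : reg C.
Hypothesis C_term : forall I : {ffun 'I_r -> 'I_m},
  \prod_(p : ('I_n * 'I_n)%type | (p.1 != p.2) && out p)
     fadd F (g p.1) (if leadpair (ph_ffun I) p.1 p.2 then g p.2 else fopp F (g p.2)) = C.
Hypothesis kill : forall I : {ffun 'I_r -> 'I_n}, injective I ->
  (exists k, I k \notin codom ph) -> psub (term F pow I) (xmap g) = 0.

(** The terms of injections leaving the image of [ph] vanish by [kill]. Every other term becomes the
    corresponding term in m variables times C, and W becomes W in m variables times the same C. Both
    factors are regular and cancel. *)
Lemma hl_fun_specialize :
  psub (hl_fun F (@pow n) lam) (xmap g) =
  psub (hl_fun F (@pow m) lam) (xmap (fun j => xv L (ph j))).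
Proof.
have ph0 j : nconst (xv L (ph j) : fps (xb n) L) by [].
have aph := admissible_xmap ph0; have ag := admissible_xmap g0.
set Wp := psub (fac_W F m) (xmap (fun j => xv L (ph j))).
have WpE : Wp = \prod_(q : ('I_m * 'I_m)%type | q.1 != q.2) fac_u F (ph q.1) (ph q.2).
  by rewrite /Wp psub_prod //; apply: eq_bigr => q _; rewrite psub_fac_u.
have rWp : reg Wp.
  by rewrite WpE; apply: reg_prod => q q12; apply: (reg_u HF); rewrite (inj_eq ph_inj).
have Wg : psub (fac_W F n) (xmap g) = Wp * C.
  rewrite psub_prod //.
  under eq_bigr => p _ do rewrite psub_fac_u //.
  rewrite (prod_pairs (fun a b => fadd F (g a) (fopp F (g b)))) WpE; congr (_ * _).
  by apply: eq_bigr => q _; rewrite !g_ph.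
have termE I : psub (term F pow (ph_ffun I)) (xmap g) =
    psub (term F pow I) (xmap (fun j => xv L (ph j))) * C.
  rewrite !(psub_term HF pow_psub) // (prod_pairs (fun a b => fadd F (g a)
    (if leadpair (ph_ffun I) a b then g b else fopp F (g b)))) C_term mulrA.
  congr (_ * _ * _); first by apply: eq_bigr => k _; rewrite ffunE g_ph.
  by apply: eq_bigr => q _; rewrite leadpair_ph !g_ph.
have sumE : psub (hl_sum F pow lam n) (xmap g) =
    psub (hl_sum F pow lam m) (xmap (fun j => xv L (ph j))) * C.
  rewrite !psub_sum // mulr_suml (bigID (fun I : {ffun 'I_r -> 'I_n} => [forall k, I k \in codom ph])) /=.
  rewrite [X in _ + X]big1 ?addr0; last first.
    move=> I /andP[/injectiveP II]; rewrite negb_forall => /existsP[k kI].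
    by apply: kill => //; exists k.
  by rewrite sum_ph_ffun; apply: eq_bigr => I _; exact: termE.
apply: (regI (regM C_reg rWp)).
rewrite -[C * Wp]mulrC -Wg mulrC -psub_mul // hl_funP sumE -hl_funP psub_mul //.
by rewrite -/Wp Wg; ring.
Qed.

End Specialize.

End HallLittlewoodFunction.

(** * Specializations *)

Section Specializations.
Variables (L : comNzRingType) (F : fps 'I_2 L).
Hypothesis HF : is_fgl F.
Hypothesis Ltf : forall (z : L) n, (0 < n)%N -> z *+ n = 0 -> z = 0.

Lemma init_regMn2 (V : choiceType) w (a : fps V L) c p :
  c = 2%:R \/ c = - 2%:R -> init w a c p -> reg a.
Proof.
move=> c2; apply: init_regular => z; case: c2 => ->; rewrite ?mulNr mulr_natl.
  exact: Ltf.
by move=> /eqP; rewrite oppr_eq0 => /eqP; exact: Ltf.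
Qed.

Section Minus.
Variable n : nat.
Implicit Types (i j a b : 'I_n).

Let x0 i : nconst (xv L i : fps (xb n) L). Proof. by []. Qed.
Let o0 i : nconst (fopp F (xv L i : fps (xb n) L)). Proof. exact: nconst_opp. Qed.

Let wpos (i : 'I_n) : (0 < wt (@om n 1) [mset (inl i : xb n)]%mset)%N.
Proof. by rewrite wt1. Qed.

Lemma init_fopp_xv i : init (@om n 1) (fopp F (xv L i)) (- 1) [mset (inl i : xb n)]%mset.
Proof. by apply: init_fopp => //; exact: init_xv. Qed.

Lemma reg_xv i : reg (xv L i : fps (xb n) L).
Proof. exact: init_reg1 (@init_xv L n 1 i). Qed.

Lemma reg_fopp i : reg (fopp F (xv L i : fps (xb n) L)).
Proof. exact: init_regN1 (init_fopp_xv i). Qed.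

Lemma reg_double i : reg (fadd F (xv L i) (xv L i) : fps (xb n) L).
Proof.
apply: (@init_regMn2 _ (@om n 1) _ (1 *+ 2) [mset (inl i : xb n)]%mset); first by left.
by apply: init_double => //; exact: init_xv.
Qed.

Lemma reg_double_opp i : reg (fadd F (fopp F (xv L i)) (fopp F (xv L i)) : fps (xb n) L).
Proof.
apply: (@init_regMn2 _ (@om n 1) _ (- 1 *+ 2) [mset (inl i : xb n)]%mset).
  by right; rewrite mulNrn.
by apply: init_double => //; exact: init_fopp_xv.
Qed.

Lemma reg_v i j : i != j -> reg (fac_v F i j).
Proof. by move=> ij; exact: init_reg1 (@init_v L F HF n 1 i j ij). Qed.

Lemma reg_opp_opp i j : i != j -> reg (fadd F (fopp F (xv L i)) (fopp F (xv L j)) : fps (xb n) L).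
Proof.
wlog ij : i j / (i < j)%N => [H|_].
  have [ij|ji|/val_inj ->] := ltngtP i j; [exact: H| |by rewrite eqxx].
  by move=> ne; rewrite fgl_addC //; apply: H => //; rewrite eq_sym.
apply: (@init_regN1 _ _ (@om n 1) _ [mset (inl i : xb n)]%mset).
apply: init_fadd => //; first exact: init_fopp_xv.
by apply: vgeW (init_vge (init_fopp_xv j)); rewrite !wt1 ltn_add2l.
Qed.

Definition minus_at a b : 'I_n -> fps (xb n) L :=
  fun i => if i == b then fopp F (xv L a) else xv L i.
Definition zero_at a : 'I_n -> fps (xb n) L :=
  fun i => if i == a then 0 else xv L i.

Lemma nconst_minus a b i : nconst (minus_at a b i).
Proof. by rewrite /minus_at; case: ifP. Qed.

Lemma nconst_zero a i : nconst (zero_at a i).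
Proof. by rewrite /zero_at; case: ifP. Qed.
End Minus.

Section WithPow.
Variable pow : forall n, fps (xb n) L -> nat -> fps (xb n) L.
Hypothesis pow_psub : forall m n (g : 'I_m -> fps (xb n) L) t k,
  (forall i, nconst (g i)) -> nconst t ->
  psub (pow t k) (xmap g) = pow (psub t (xmap g)) k.
Variable lam : seq nat.
Let r := size lam.

Lemma leadpair_out m n (ph : 'I_m -> 'I_n) (I : {ffun 'I_r -> 'I_m}) i j :
  j \notin codom ph -> leadpair (lam := lam) (ph_ffun (lam := lam) ph I) i j = [exists k, ph (I k) == i].
Proof.
move=> jph; apply: eq_existsb => k; rewrite ffunE.
rewrite [X in _ && X](_ : _ = true) ?andbT //.
apply/forallP => l; apply/implyP => _; rewrite ffunE.
by apply: contraNneq jph => <-; exact: codom_f.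
Qed.

Lemma leadpair_codom m n (ph : 'I_m -> 'I_n) (I : {ffun 'I_r -> 'I_m}) i j :
  leadpair (lam := lam) (ph_ffun (lam := lam) ph I) i j -> i \in codom ph.
Proof. by move=> /existsP[k /andP[/eqP <- _]]; rewrite ffunE codom_f. Qed.

Section MinusAt.
Variables (m n : nat) (ph : 'I_m -> 'I_n) (a b : 'I_n).
Hypotheses (ph_inj : injective ph) (ab : a != b).
Hypotheses (aph : a \notin codom ph) (bph : b \notin codom ph).
Hypothesis cover : forall i, [|| i \in codom ph, i == a | i == b].

(** If I reaches a or b, one of (a, b) and (b, a) is leading and contributes x_a +_F \bar x_a = 0.
    Otherwise, making the pairs (i, a) and (i, b) leading only exchanges the two factors x_i +_F x_a
    and x_i +_F \bar x_a. *)
Lemma hl_fun_minus :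
  psub (hl_fun F (@pow n) lam) (xmap (minus_at a b)) =
  psub (hl_fun F (@pow m) lam) (xmap (fun j => xv L (ph j))).
Proof.
have x0 (i : 'I_n) : nconst (xv L i : fps (xb n) L) by [].
have o0 i : nconst (fopp F (xv L i : fps (xb n) L)) by exact: nconst_opp.
have ga : minus_at a b a = xv L a by rewrite /minus_at (negPf ab).
have gb : minus_at a b b = fopp F (xv L a) by rewrite /minus_at eqxx.
have gph j : minus_at a b (ph j) = xv L (ph j).
  rewrite /minus_at; case: eqP => // phb.
  by move: bph; rewrite -phb codom_f.
apply: (hl_fun_specialize HF Ltf pow_psub ph_inj) => //; first exact: nconst_minus.
- apply: reg_prod => -[i j] /andP[/= ij _]; rewrite /minus_at.
  case: (i =P b) => [ib|/eqP ib]; case: (j =P b) => [jb|/eqP jb].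
  + by move: ij; rewrite ib jb eqxx.
  + have [->|aj] := eqVneq a j; first exact: reg_double_opp.
    exact: reg_opp_opp.
  (* The pair (a, b) yields x_a +_F x_a, regular because L has no 2-torsion. *)
  + rewrite fgl_oppK //; have [->|ia] := eqVneq i a; first exact: reg_double.
    exact: (reg_v ia).
  + exact: (reg_u HF ij).
- move=> I; pose inc (p : ('I_n * 'I_n)%type) := p.1 \in codom ph.
  have split2 (f : 'I_n -> 'I_n -> fps (xb n) L) :
    \prod_(p : ('I_n * 'I_n)%type | (p.1 != p.2) && ~~ (inc p && (p.2 \in codom ph))) f p.1 p.2 =
    (\prod_(i | i \in codom ph) (f i a * f i b)) *
    \prod_(p : ('I_n * 'I_n)%type | (p.1 != p.2) && ~~ (inc p && (p.2 \in codom ph)) && ~~ inc p) f p.1 p.2.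
    rewrite (bigID inc) /=; congr (_ * _).
    transitivity (\prod_(i | i \in codom ph) \prod_(j | j \notin codom ph) f i j).
      rewrite pair_big_dep /=; apply: eq_bigl => -[i j] /=; rewrite /inc /=.
      have [iph|iph] := boolP (i \in codom ph); rewrite ?andbF ?andbT //=.
      have [jph|jph] := boolP (j \in codom ph); rewrite ?andbF ?andbT //=.
      by apply: contraNneq jph => <-.
    apply: eq_bigr => i _; rewrite (bigD1 a) //= (bigD1 b) /=; last by rewrite bph eq_sym.
    rewrite big1 ?mulr1 // => j /andP[/andP[jph ja] jb].
    by have := cover j; rewrite (negPf jph) (negPf ja) (negPf jb).
  rewrite (split2 (fun i j => fadd F (minus_at a b i)
     (if leadpair (ph_ffun ph I) i j then minus_at a b j else fopp F (minus_at a b j)))).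
  rewrite (split2 (fun i j => fadd F (minus_at a b i) (fopp F (minus_at a b j)))).
  congr (_ * _).
    apply: eq_bigr => i iph; rewrite !leadpair_out // ga gb fgl_oppK //.
    by case: ifP => // _; rewrite mulrC.
  apply: eq_bigr => p /andP[_ pinc]; case: ifP => // /leadpair_codom.
  by rewrite -/(inc p) (negPf pinc).
- move=> I II [k kph].
  have H : leadpair I a b || leadpair I b a.
    apply: leadpair_total => //; have := cover (I k); rewrite (negPf kph) /=.
    by case/orP => /eqP <-; [left|right]; exists k.
  rewrite (psub_term HF pow_psub); last exact: nconst_minus.
  case/orP: H => H; [rewrite (bigD1 (a, b)) //=|rewrite (bigD1 (b, a)) //=; last by rewrite eq_sym].
    by rewrite H ga gb (fgl_addN HF) // mul0r mulr0.
  by rewrite H ga gb (fgl_addNr HF) // mul0r mulr0.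
Qed.

End MinusAt.

Section ZeroAt.
Variables (m n : nat) (ph : 'I_m -> 'I_n) (a : 'I_n).
Hypotheses (ph_inj : injective ph) (aph : a \notin codom ph).
Hypothesis cover : forall i, (i \in codom ph) || (i == a).
Hypothesis pow0 : forall k, (0 < k)%N -> pow (0 : fps (xb n) L) k = 0.
Hypothesis lam0 : 0%N \notin lam.

Let zph j : zero_at a (ph j) = xv L (ph j).
Proof.
rewrite /zero_at; case: eqP => // pha.
by move: aph; rewrite -pha codom_f.
Qed.

(** Injections reaching a are killed by the power of x_a, which vanishes at 0 by [pow0]. For the
    others, leading or not makes no difference at a, since the formal inverse of 0 is 0. *)
Lemma hl_fun_zero :
  psub (hl_fun F (@pow n) lam) (xmap (zero_at a)) =
  psub (hl_fun F (@pow m) lam) (xmap (fun j => xv L (ph j))).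
Proof.
have x0 (i : 'I_n) : nconst (xv L i : fps (xb n) L) by [].
have o0 i : nconst (fopp F (xv L i : fps (xb n) L)) by exact: nconst_opp.
apply: (hl_fun_specialize HF Ltf pow_psub ph_inj) => //; first exact: nconst_zero.
- apply: reg_prod => -[i j] /andP[/= ij _]; rewrite /zero_at.
  case: (i =P a) => [ia|/eqP ia]; case: (j =P a) => [ja|/eqP ja].
  + by move: ij; rewrite ia ja eqxx.
  + by rewrite fgl_add0r //; exact: reg_fopp.
  + by rewrite (fgl_opp0 HF) fgl_addr0 //; exact: reg_xv.
  + exact: (reg_u HF ij).
- move=> I; apply: eq_bigr => -[i j] /= /andP[_ out]; case: ifP => // /leadpair_codom iph.
  have := cover j; rewrite iph /= in out; rewrite (negPf out) /= => ja.
  by rewrite /zero_at ja (fgl_opp0 HF).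
- move=> I II [k kph]; rewrite (psub_term HF pow_psub); last exact: nconst_zero.
  have := cover (I k); rewrite (negPf kph) /= => ka.
  rewrite (bigD1 k) //= {1}/zero_at ka pow0 ?mul0r //.
  by rewrite lt0n; apply: contraNneq lam0 => <-; apply: mem_nth.
Qed.

Hypothesis pow_double : forall (t : fps (xb n) L) k, (0 < k)%N ->
  exists s, pow t k = fadd F t t * s.

Let d := fadd F (xv L a) (xv L a) : fps (xb n) L.
Let dvd (f : fps (xb n) L) := exists g, f = d * g.

Let dvdD f g : dvd f -> dvd g -> dvd (f + g).
Proof. by move=> [f' ->] [g' ->]; exists (f' + g'); rewrite mulrDr. Qed.

Let dvdM f g : dvd f -> dvd (f * g).
Proof. by move=> [f' ->]; exists (f' * g); rewrite mulrA. Qed.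

Let dvd_sum (I : Type) (s : seq I) (P : pred I) (E : I -> fps (xb n) L) :
  (forall i, P i -> dvd (E i)) -> dvd (\sum_(i <- s | P i) E i).
Proof.
move=> H; elim/big_ind: _ => [|f g|i Pi]; [|exact: dvdD|exact: H].
by exists 0; rewrite mulr0.
Qed.

Let dvd_prodB (I : Type) (s : seq I) (P : pred I) (f g : I -> fps (xb n) L) :
  (forall i, P i -> dvd (f i - g i)) ->
  dvd (\prod_(i <- s | P i) f i - \prod_(i <- s | P i) g i).
Proof.
move=> H; apply: (big_rec2 (fun x y => dvd (x - y))) => [|i y z Pi yz].
  by exists 0; rewrite subrr mulr0.
rewrite (_ : _ - _ = (f i - g i) * y + (y - z) * g i); last by ring.
by apply: dvdD; apply: dvdM => //; exact: H.
Qed.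

(** In independent variables, F(X, Z) - F(X, Y) vanishes for Z = Y, so it is divisible by Z +_F \bar
    Y. Substituting Y := \bar y and Z := y gives the claim. *)
Lemma fadd_opp_diff (V : choiceType) (x y : fps V L) : nconst x -> nconst y ->
  exists g, fadd F x y - fadd F x (fopp F y) = fadd F y y * g.
Proof.
move=> x0 y0; have o0 := nconst_opp HF y0.
pose X := pvar L (inord 0 : 'I_3); pose Y := pvar L (inord 1 : 'I_3).
pose Z := pvar L (inord 2 : 'I_3).
have ne (i j : nat) : (i < 3)%N -> (j < 3)%N -> i != j -> (inord i != inord j :> 'I_3).
  by move=> i3 j3 ij; rewrite -val_eqE /= !inordK.
have [|||g gE] := @repl_factor _ L F HF (inord 2 : 'I_3) Y (fadd F X Z - fadd F X Y).
- exact: nconst_var.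
- by apply: indep_var; exact: ne.
- have aY : admissible (repl (inord 2 : 'I_3) Y) by apply: admissible_repl; exact: nconst_var.
  rewrite psubB // !fgl_psub //; try exact: nconst_var.
  rewrite !psub_repl_var; try exact: nconst_var.
  rewrite eqxx !(negPf (ne _ _ _ _ _)) //; exact: subrr.
pose s (i : 'I_3) := if i == 0%N :> nat then x else if i == 1%N :> nat then fopp F y else y.
have as_ : admissible s.
  by apply: admissible_fin => i; rewrite /s; do 2![case: ifP => // _].
exists (psub g s); have := congr1 (fun f => psub f s) gE.
rewrite psubB // psub_mul // !fgl_psub ?opp_psub //; try exact: nconst_var; last first.
  by apply: nconst_opp => //; exact: nconst_var.
by rewrite !psub_var // /s !inordK //= fgl_oppK.
Qed.

(** The divisor x_a +_F x_a stays regular on x_k = x_l, so the factor of the pair (k, l) can be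
    cancelled. *)
Lemma dvd_reg_u k l f : k != l -> dvd (fac_u F k l * f) -> dvd f.
Proof.
move=> kl [g gE]; have x0 (i : 'I_n) : nconst (xv L i : fps (xb n) L) by [].
have am := admissible_xmap (@nconst_merge L n k l).
have [|g' g'E] := merge_factor HF kl (_ : psub g (xmap (xmerge L k l)) = 0).
  apply: (_ : reg (psub d (xmap (xmerge L k l)))).
    rewrite fgl_psub // !xmap_xv; try exact: nconst_merge.
    by rewrite /xmerge; case: ifP => _; exact: reg_double.
  by rewrite -psub_mul // -gE psub_mul // (psub_merge_u HF) mul0r.
exists g'; apply: (regI (reg_u HF kl)); rewrite gE g'E; ring.
Qed.

(** It is enough to treat W times the difference, by [dvd_reg_u]. Terms reaching a contain x_a +_F
    x_a through [pow_double]; the others differ from their counterparts only by exchanging x_i +_F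
    x_a and x_i +_F \bar x_a, where [fadd_opp_diff] applies. *)
Lemma hl_fun_zero_dvd :
  dvd (hl_fun F (@pow n) lam - psub (hl_fun F (@pow n) lam) (xmap (zero_at a))).
Proof.
have x0 (i : 'I_n) : nconst (xv L i : fps (xb n) L) by [].
have o0 i : nconst (fopp F (xv L i : fps (xb n) L)) by exact: nconst_opp.
have ph0 j : nconst (xv L (ph j) : fps (xb n) L) by [].
have aph' := admissible_xmap ph0.
set h := hl_fun _ _ _; set h0 := psub h _.
suff H : dvd (fac_W F n * (h - h0)).
  move: H; rewrite /fac_W; elim/big_rec: _ (h - h0) => [f|p y p12 IH f]; first by rewrite mul1r.
  by rewrite -mulrA => /(dvd_reg_u p12); exact: IH.
pose out (p : ('I_n * 'I_n)%type) := ~~ ((p.1 \in codom ph) && (p.2 \in codom ph)).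
pose C := \prod_(p : ('I_n * 'I_n)%type | (p.1 != p.2) && out p) fac_u F p.1 p.2.
have WE : fac_W F n = psub (fac_W F m) (xmap (fun j => xv L (ph j))) * C.
  rewrite [LHS](prod_pairs ph_inj (@fac_u _ F n)); congr (_ * _).
  rewrite psub_prod //; apply: eq_bigr => q _; rewrite psub_fac_u //.
have termE (I : {ffun 'I_r -> 'I_m}) : dvd (term F pow (ph_ffun ph I) -
    psub (term F pow I) (xmap (fun j => xv L (ph j))) * C).
  rewrite (psub_term HF pow_psub) // /term (prod_pairs ph_inj
    (fun i j => fac F (leadpair (ph_ffun ph I) i j) i j)).
  set A := \prod_(k < _) _; set A' := \prod_(k < _) _.
  have -> : A' = A by apply: eq_bigr => k _; rewrite ffunE.
  set B := \prod_(q | _) _; set B' := \prod_(q | _) fadd _ _ _.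
  have -> : B' = B.
    apply: eq_bigr => q _; rewrite /fac leadpair_ph //.
    by case: ifP.
  rewrite mulrA -mulrBr mulrC; apply: dvdM.
  apply: dvd_prodB => -[i j] /andP[/= ij outp]; rewrite /fac; case: ifP => [|_]; last first.
    by exists 0; rewrite subrr mulr0.
  move=> /leadpair_codom iph; move: outp; rewrite /out /= iph /= => jph.
  have := cover j; rewrite (negPf jph) /= => /eqP ->.
  exact: fadd_opp_diff.
have -> : fac_W F n * (h - h0) =
    (\sum_(I : {ffun 'I_r -> 'I_n} | injectiveb I && ~~ [forall k, I k \in codom ph]) term F pow I) +
    \sum_(I : {ffun 'I_r -> 'I_m} | injectiveb I)
       (term F pow (ph_ffun ph I) - psub (term F pow I) (xmap (fun j => xv L (ph j))) * C).
  rewrite mulrBr mulrC (hl_funP HF Ltf pow_psub) /hl_sum.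
  rewrite (bigID (fun I : {ffun 'I_r -> 'I_n} => [forall k, I k \in codom ph])) /= sumrB addrA.
  congr (_ - _).
    rewrite addrC; congr (_ + _); exact: sum_ph_ffun.
  rewrite /h0 hl_fun_zero WE mulrAC -psub_mul // mulrC [_ * hl_fun _ _ _]mulrC.
  by rewrite (hl_funP HF Ltf pow_psub) psub_sum // mulr_sumr; apply: eq_bigr => I _; rewrite mulrC.
apply: dvdD; last by apply: dvd_sum => I _; exact: termE.
apply: dvd_sum => I /andP[_]; rewrite negb_forall => /existsP[k kph].
have := cover (I k); rewrite (negPf kph) /= => /eqP ka.
rewrite /term (bigD1 k) //= ka -mulrA; apply: dvdM.
have [|s ->] := pow_double (xv L a) (_ : 0 < nth 0%N lam k)%N; last by exists s.
by rewrite lt0n; apply: contraNneq lam0 => <-; apply: mem_nth.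
Qed.

End ZeroAt.
End WithPow.
End Specializations.

(** * Coefficients in the parameters *)

Section BCoefficients.
Variable L : comNzRingType.

Lemma fpsX1 (V : choiceType) v : fpsX L [mset v]%mset = pvar L (v : V).
Proof. exact: mset_eval1. Qed.

Section Monomials.
Variable n : nat.
Implicit Types (p : {mset 'I_n}%mset) (m : {mset nat}%mset).

Definition mxb p m : {mset (xb n)}%mset :=
  seq_mset (map inl (p : seq 'I_n) ++ map inr (m : seq nat)).

Lemma mxb_inl p m i : mxb p m (inl i) = p i.
Proof.
rewrite mset_seqE count_cat !count_map -(count_mem_mset i p) [X in (_ + X)%N](_ : _ = 0%N).
  by rewrite addn0; apply: eq_count => j /=; apply/eqP/eqP => [[]|->].
by rewrite -(count_pred0 m); apply: eq_count => j.
Qed.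

Lemma mxb_inr p m j : mxb p m (inr j) = m j.
Proof.
rewrite mset_seqE count_cat !count_map -(count_mem_mset j m) [X in (X + _)%N](_ : _ = 0%N).
  by rewrite add0n; apply: eq_count => i /=; apply/eqP/eqP => [[]|->].
by rewrite -(count_pred0 p); apply: eq_count => i.
Qed.

Lemma mxbP (K : {mset (xb n)}%mset) p m :
  (forall i, K (inl i) = p i) -> (forall j, K (inr j) = m j) -> K = mxb p m.
Proof.
by move=> Hp Hm; apply/msetP => -[i|j]; rewrite ?mxb_inl ?mxb_inr.
Qed.

Lemma mxbD p p' m m' : mxb (p `+` p')%mset (m `+` m')%mset = (mxb p m `+` mxb p' m')%mset.
Proof.
apply/esym/mxbP => i; rewrite !msetE2 ?mxb_inl ?mxb_inr //.
Qed.

Lemma mxb0 : mxb mset0 mset0 = mset0.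
Proof. by apply/esym/mxbP => i; rewrite !mset0E. Qed.

Lemma mxb_x i k : mxb (msetn k i) mset0 = msetn k (inl i : xb n).
Proof.
by apply/esym/mxbP => j; rewrite ?mset0E !msetnE.
Qed.

Lemma mxb_b j m : mxb mset0 (j +` m)%mset = ((inr j : xb n) +` mxb mset0 m)%mset.
Proof.
by apply/esym/mxbP => i; rewrite !msetE2 ?mxb_inl ?mxb_inr ?mset0E !msetnE.
Qed.

Lemma mxb_surj K : exists p m, K = mxb p m.
Proof.
elim/mset_ind: K => [|v K [p [m ->]]]; first by exists mset0, mset0; rewrite mxb0.
case: v => [i|j].
  exists (i +` p)%mset, m; rewrite -{2}[m]mset0D mxbD mxb_x //.
exists p, (j +` m)%mset; rewrite -{2}[p]mset0D mxbD; congr (_ `+` _)%mset.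
by apply: mxbP => i; rewrite ?mset0E !msetnE.
Qed.

Lemma mxb_inj p m p' m' : mxb p m = mxb p' m' -> p = p' /\ m = m'.
Proof.
move=> E; split; apply/msetP => i; first by rewrite -(mxb_inl p m) E mxb_inl.
by rewrite -(mxb_inr p m) E mxb_inr.
Qed.

Lemma mxb_bsub p m m' : (mxb mset0 m' `<=` mxb p m)%mset = (m' `<=` m)%mset.
Proof.
apply/msubsetP/msubsetP => H i; first by have := H (inr i); rewrite !mxb_inr.
by case: i => [i|j]; rewrite ?mxb_inl ?mxb_inr ?mset0E.
Qed.

Lemma wt_mxb B p m : wt (@om n B) (mxb p m) =
  (B * deg p + wt (@nat_of_ord n) p + (B + n) * deg m)%N.
Proof.
elim/mset_ind: p => [|i p IH].
  rewrite deg0 muln0 wt0 !add0n; elim/mset_ind: m => [|j m IH].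
    by rewrite mxb0 wt0 deg0 muln0.
  rewrite -{1}[mset0]mset0D mxbD wtD IH degD degn.
  rewrite (_ : mxb mset0 [mset j]%mset = [mset (inr j : xb n)]%mset).
    by rewrite wt1 /= mulnDr muln1.
  by apply/esym/mxbP => i; rewrite ?mset0E !msetnE.
rewrite -{1}[m]mset0D mxbD wtD IH mxb_x wt1 degD degn wtD wt1 /=; ring.
Qed.

End Monomials.

Lemma bcoefE n (f : fps (xb n) L) m p : bcoef f m p = f (mxb p m).
Proof. by []. Qed.

Definition xlift n (g : fps 'I_n L) : fps (xb n) L := psub g (fun i => xv L i).

Lemma admissible_xv n : admissible (fun i : 'I_n => xv L i : fps (xb n) L).
Proof. by apply: admissible_fin. Qed.

Lemma mset_eval_xv n (p : {mset 'I_n}%mset) :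
  mset_eval (fun i => xv L i : fps (xb n) L) p = fpsX L (mxb p mset0).
Proof.
elim/mset_ind: p => [|i p IH]; first by rewrite mset_eval0 mxb0 /fpsX mset_eval0.
rewrite mset_evalD mset_eval1 IH -{2}[mset0]mset0D mxbD fpsXD mxb_x.
by rewrite fpsX1.
Qed.

Lemma coef_xlift n (g : fps 'I_n L) p m :
  xlift g (mxb p m) = if m == mset0 then g p else 0.
Proof.
have E k : fpsX L (mxb k mset0) (mxb p m) = ((p == k) && (m == mset0))%:R.
  rewrite coef_X; congr (_%:R); congr nat_of_bool.
  by apply/eqP/andP => [/mxb_inj[-> ->] //|[/eqP -> /eqP ->]].
rewrite psub_coef (@fsbig_setT_seq _ _ [:: p]) //.
  by rewrite big_seq1 mset_eval_xv E eqxx /=; case: (m == mset0); rewrite ?mulr1 ?mulr0.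
by move=> k; rewrite inE mset_eval_xv E eq_sym => /negPf ->; rewrite mulr0.
Qed.

Lemma coef_xlift_bX n (h : fps 'I_n L) p m m' :
  (fpsX L (mxb mset0 m') * xlift h) (mxb p m) = if m' == m then h p else 0.
Proof.
rewrite coef_XM mxb_bsub; case: ifP => [/msub_add[l ->]|H].
  rewrite -{1}[p]mset0D mxbD msetB_add coef_xlift; case: (l =P mset0) => [->|l0].
    by rewrite msetD0 eqxx.
  by case: eqP => // e; case: l0; rewrite -[l](msetB_add m') -e msetBxx.
by case: eqP H => // ->; rewrite msubset_refl.
Qed.

(** A substitution involving only the x_i acts on each coefficient of a monomial in b separately. *)
Lemma bcoef_xmap m n (f : fps (xb m) L) (g : 'I_m -> fps 'I_n L) j :
  (forall i, nconst (g i)) ->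
  bcoef (psub f (xmap (fun i => xlift (g i)))) j = psub (bcoef f j) g.
Proof.
move=> g0; apply/fpsP => p; rewrite bcoefE.
have ag : admissible g by exact: admissible_fin.
have ev k j' : mset_eval (xmap (fun i => xlift (g i))) (mxb k j') =
    fpsX L (mxb mset0 j') * xlift (mset_eval g k).
  elim/mset_ind: k => [|i k IH].
    elim/mset_ind: j' => [|l j' IH].
      by rewrite !(mxb0, mset_eval0) /fpsX mset_eval0 mul1r /xlift psub1 //; exact: admissible_xv.
    by rewrite !mxb_b mset_evalD mset_eval1 IH fpsXD fpsX1 /= mulrA.
  rewrite -{1}[j']mset0D mxbD mset_evalD IH mxb_x mset_eval1 /= mulrCA; congr (_ * _).
  by rewrite mset_evalD mset_eval1 /xlift psub_mul //; exact: admissible_xv.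
have [M HM] := admissible_bound p ag.
rewrite (coef_psub _ HM) ?msubset_refl // psub_coef.
rewrite (@fsbig_setT_seq _ _ [seq mxb k j | k <- msubs M]) /=.
- rewrite big_map; apply: eq_bigr => k _.
  by rewrite ev coef_xlift_bX eqxx.
- by rewrite map_inj_uniq ?msubs_uniq // => k k' /mxb_inj[].
move=> K; have [k [j' ->]] := mxb_surj K; rewrite ev coef_xlift_bX => H.
case: eqP H => [->|_ _]; last by rewrite mulr0.
move=> /negP H; have [->|nz] := eqVneq (mset_eval g k p) 0; first by rewrite mulr0.
case: H; apply: map_f; rewrite mem_msubs; exact: (HM k p (msubset_refl _) nz).
Qed.

Lemma bcoef_xlift_mul n (g : fps 'I_n L) f m : bcoef (xlift g * f) m = g * bcoef f m.
Proof.
apply/fpsP => p; rewrite bcoefE !fcoefM.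
pose h k := (mxb k mset0 : {mset (xb n)}%mset).
transitivity (\sum_(K <- [seq h k | k <- msubs p]) xlift g K * f (mxb p m `\` K)%mset).
  apply: eq_big_support; first exact: msubs_uniq.
    by rewrite map_inj_uniq ?msubs_uniq // => k k' /mxb_inj[].
  move=> K; have [k [j ->]] := mxb_surj K; rewrite coef_xlift.
  case: (j =P mset0) => [->|_]; last by rewrite mul0r eqxx.
  move=> _; rewrite (mem_map (f := h)); last by move=> a b /mxb_inj[].
  rewrite !mem_msubs; apply/msubsetP/msubsetP => H i.
    by have := H (inl i); rewrite !mxb_inl.
  by case: i => [i|j']; rewrite ?mxb_inl ?mxb_inr ?mset0E.
rewrite big_map big_seq [RHS]big_seq; apply: eq_bigr => k; rewrite mem_msubs => /msub_add[l ->].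
by rewrite coef_xlift eqxx -{1}[m]mset0D mxbD !msetB_add bcoefE.
Qed.

Lemma coef_bscalar n (c : fps nat L) (p : {mset 'I_n}%mset) m :
  bscalar n c (mxb p m) = if p == mset0 then c m else 0.
Proof.
have ev k : mset_eval (bvar L n) k = fpsX L (mxb mset0 k).
  rewrite /bvar pvarE; elim/mset_ind: k => [|l k IH].
    by rewrite mset_eval0 mxb0 /fpsX mset_eval0.
  by rewrite mset_evalD mset_eval1 IH mxb_b fpsXD fpsX1.
have E k : fpsX L (mxb mset0 k) (mxb p m) = ((p == mset0) && (m == k))%:R.
  rewrite coef_X; congr (_%:R); congr nat_of_bool.
  by apply/eqP/andP => [/mxb_inj[-> ->] //|[/eqP -> /eqP ->]].
rewrite /bscalar psubE psub_coef (@fsbig_setT_seq _ _ [:: m]) //.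
  by rewrite big_seq1 ev E eqxx andbT; case: (p == mset0); rewrite ?mulr1 ?mulr0.
by move=> k; rewrite inE ev E eq_sym => /negPf ->; rewrite andbF mulr0.
Qed.

Lemma bcoef_bscalar n (c : fps nat L) (f : fps (xb n) L) m p :
  bcoef (bscalar n c * f) m p = \sum_(k <- msubs m) c k * bcoef f (m `\` k)%mset p.
Proof.
rewrite bcoefE fcoefM; pose h k := (mxb mset0 k : {mset (xb n)}%mset).
transitivity (\sum_(K <- [seq h k | k <- msubs m]) bscalar n c K * f (mxb p m `\` K)%mset).
  apply: eq_big_support; first exact: msubs_uniq.
    by rewrite map_inj_uniq ?msubs_uniq // => k k' /mxb_inj[].
  move=> K; have [k [j ->]] := mxb_surj K; rewrite coef_bscalar.
  case: (k =P mset0) => [->|_]; last by rewrite mul0r eqxx.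
  move=> _; rewrite (mem_map (f := h)); last by move=> a b /mxb_inj[].
  by rewrite !mem_msubs mxb_bsub.
rewrite big_map big_seq [RHS]big_seq; apply: eq_bigr => k; rewrite mem_msubs => /msub_add[l ->].
by rewrite coef_bscalar eqxx -{1}[p]mset0D mxbD !msetB_add bcoefE.
Qed.

End BCoefficients.

(** * Membership of P and Q in the inverse limits *)

Section Membership.
Variables (L : comNzRingType) (F : fps 'I_2 L).
Hypothesis HF : is_fgl F.
Hypothesis Ltf : forall (z : L) n, (0 < n)%N -> z *+ n = 0 -> z = 0.

Lemma bpowE n (t : fps (xb n) L) k : bpow F t k = \prod_(i < k) fadd F t (bv L n (nat_of_ord i)).
Proof. by apply: eq_bigr => i _; rewrite faddE /bvar pvarE. Qed.

Lemma bpow_psub m n (g : 'I_m -> fps (xb n) L) t k :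
  (forall i, nconst (g i)) -> nconst t ->
  psub (bpow F t k) (xmap g) = bpow F (psub t (xmap g)) k.
Proof.
move=> g0 t0; have ag := admissible_xmap g0.
rewrite !bpowE psub_prod //; apply: eq_bigr => i _.
by rewrite fgl_psub // xmap_bv.
Qed.

Lemma bpow2S n (t : fps (xb n) L) k : bpow2 F t k.+1 = fadd F t t * bpow F t k.
Proof. by rewrite /bpow2 faddE. Qed.

Lemma bpow2_psub m n (g : 'I_m -> fps (xb n) L) t k :
  (forall i, nconst (g i)) -> nconst t ->
  psub (bpow2 F t k) (xmap g) = bpow2 F (psub t (xmap g)) k.
Proof.
move=> g0 t0; have ag := admissible_xmap g0.
case: k => [|k]; first exact: psub1.
by rewrite !bpow2S psub_mul // bpow_psub // fgl_psub.
Qed.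

Lemma bpow2_zero n k : (0 < k)%N -> bpow2 F (0 : fps (xb n) L) k = 0.
Proof. by case: k => // k _; rewrite bpow2S fgl_add0r ?mul0r. Qed.

Lemma bpow2_double n (t : fps (xb n) L) k : (0 < k)%N ->
  exists s, bpow2 F t k = fadd F t t * s.
Proof. by case: k => // k _; exists (bpow F t k); exact: bpow2S. Qed.

Lemma admissible_pvar n m (g : 'I_n -> 'I_m) : admissible (fun i => pvar L (g i)).
Proof. by apply: admissible_fin. Qed.

Definition zero2 n (i0 i1 i : 'I_n) : fps 'I_n L :=
  if (i == i0) || (i == i1) then 0 else pvar L i.
Definition minus2 n (i0 i1 i : 'I_n) : fps 'I_n L :=
  if i == i1 then fopp F (pvar L i0) else pvar L i.

Lemma nconst_zero2 n (i0 i1 i : 'I_n) : nconst (zero2 i0 i1 i).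
Proof. by rewrite /zero2; case: ifP. Qed.

Lemma nconst_minus2 n (i0 i1 i : 'I_n) : nconst (minus2 i0 i1 i).
Proof. by rewrite /minus2; case: ifP => // _; exact: nconst_opp. Qed.

Lemma supersymmetricE n (f : fps 'I_n L) : supersymmetric F f <->
  (forall w : 'S_n, psub f (fun i => pvar L (w i)) = f) /\
  (forall i0 i1 : 'I_n, i0 = 0%N :> nat -> i1 = 1%N :> nat ->
     psub f (minus2 i0 i1) = psub f (zero2 i0 i1)).
Proof. by rewrite /supersymmetric psubE foppE pvarE. Qed.

Lemma Gamma_plusE n (f : fps 'I_n L) : Gamma_plus F f <->
  supersymmetric F f /\
  (forall i0 : 'I_n, i0 = 0%N :> nat -> exists g : fps 'I_n L,
     f - psub f (repl i0 0) = fadd F (pvar L i0) (pvar L i0) * g).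
Proof. by rewrite /Gamma_plus /= psubE faddE pvarE. Qed.

Lemma xlift_pvar n i : xlift (pvar L i) = xv L i :> fps (xb n) L.
Proof. by rewrite /xlift psub_var //; exact: admissible_xv. Qed.

Lemma xlift0 n : xlift (0 : fps 'I_n L) = 0.
Proof. by rewrite /xlift psub0 //; exact: admissible_xv. Qed.

Lemma xlift_fopp n (a : fps 'I_n L) : nconst a -> xlift (fopp F a) = fopp F (xlift a).
Proof. by move=> a0; rewrite /xlift opp_psub //; exact: admissible_xv. Qed.

Lemma xlift_fadd n (a b : fps 'I_n L) : nconst a -> nconst b ->
  xlift (fadd F a b) = fadd F (xlift a) (xlift b).
Proof. by move=> a0 b0; rewrite /xlift fgl_psub //; exact: admissible_xv. Qed.

Lemma over_b_Gamma n (h : fps (xb n) L) :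
  (forall w : 'S_n, psub h (xmap (fun i => xv L (w i))) = h) ->
  (forall i0 i1 : 'I_n, i0 = 0%N :> nat -> i1 = 1%N :> nat ->
     psub h (xmap (minus_at F i0 i1)) =
     psub h (xmap (fun i => if (i == i0) || (i == i1) then 0 else xv L i))) ->
  over_b (Gamma F) h.
Proof.
move=> sh zh m; apply/supersymmetricE; split=> [w|i0 i1 i00 i11].
  rewrite -bcoef_xmap //; congr bcoef; rewrite -[RHS](sh w).
  by apply: eq_xmap => i; exact: xlift_pvar.
rewrite -!bcoef_xmap; try exact: nconst_zero2; try exact: nconst_minus2.
congr bcoef; rewrite (eq_xmap (h := minus_at F i0 i1)) ?zh //.
  by apply: eq_xmap => i; rewrite /zero2; case: ifP => _; rewrite ?xlift0 ?xlift_pvar.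
by move=> i; rewrite /minus2 /minus_at; case: ifP => _; rewrite ?xlift_fopp ?xlift_pvar.
Qed.

Lemma lift2_range n (a : 'I_n.+2) (b : 'I_n.+1) (ph := fun j : 'I_n => lift a (lift b j)) :
  [/\ injective ph, a != lift a b, a \notin codom ph, lift a b \notin codom ph &
      forall i, [|| i \in codom ph, i == a | i == lift a b]].
Proof.
split; first by move=> i j /lift_inj /lift_inj.
- exact: neq_lift.
- by apply/codomP => -[j]; apply/eqP; exact: neq_lift.
- by apply/codomP => -[j] /lift_inj; apply/eqP; exact: neq_lift.
move=> i; case: (unliftP a i) => [i' ->|->]; last by rewrite eqxx orbT.
case: (unliftP b i') => [j ->|->]; last by rewrite eqxx !orbT.
by rewrite (_ : lift a (lift b j) = ph j) // codom_f.
Qed.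

Lemma lift1_range n (a : 'I_n.+1) :
  [/\ injective (lift a), a \notin codom (lift a) &
      forall i, (i \in codom (lift a)) || (i == a)].
Proof.
split; first exact: lift_inj.
  by apply/codomP => -[j]; apply/eqP; exact: neq_lift.
move=> i; case: (unliftP a i) => [j ->|->]; last by rewrite eqxx orbT.
by rewrite codom_f.
Qed.

Definition last0map n (i : 'I_n.+1) : fps (xb n) L :=
  if unlift ord_max i is Some j then xv L j else 0.

Lemma nconst_last0map n i : nconst (@last0map n i).
Proof. by rewrite /last0map; case: unlift. Qed.

Lemma xlast0E n (f : fps (xb n.+1) L) : xlast0 f = psub f (xmap (@last0map n)).
Proof. by rewrite /xlast0 xsubstE /xvar /last0map pvarE. Qed.

Section HlFun.
Variable pow : forall n, fps (xb n) L -> nat -> fps (xb n) L.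
Hypothesis pow_psub : forall m n (g : 'I_m -> fps (xb n) L) t k,
  (forall i, nconst (g i)) -> nconst t ->
  psub (pow t k) (xmap g) = pow (psub t (xmap g)) k.
Variable lam : seq nat.

Lemma hl_fun_Gamma n : over_b (Gamma F) (hl_fun F (@pow n) lam).
Proof.
apply: over_b_Gamma => [w|i0 i1]; first exact: (hl_fun_perm HF Ltf pow_psub).
case: n i0 i1 => [[]//|[|n]] i0 i1 i00 i11; first by have := ltn_ord i1; rewrite i11.
have E1 : i1 = lift i0 ord0 by apply: val_inj; rewrite /= i00 i11.
have [phi ne aph bph cov] := lift2_range i0 ord0; rewrite -E1 in ne bph cov.
have H := hl_fun_minus HF Ltf pow_psub lam phi ne aph bph cov.
have z0 := @nconst_zero L n.+2 i0; have m0 := @nconst_minus L F HF n.+2 i0 i1.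
(* After the substitution x_1 := \bar x_0 the series no longer involves x_0, so setting x_0 := 0
   changes nothing and produces the value at (0, 0). *)
have K : psub (psub (hl_fun F (@pow n.+2) lam) (xmap (minus_at F i0 i1))) (xmap (zero_at L i0)) =
   psub (hl_fun F (@pow n.+2) lam) (xmap (minus_at F i0 i1)).
  rewrite H xmap_comp //; apply: eq_xmap => j; rewrite xmap_xv // /zero_at.
  by rewrite eq_sym (negPf (neq_lift _ _)).
rewrite -K xmap_comp //; apply: eq_xmap => i; rewrite /minus_at.
case: (i =P i1) => [->|_].
  by rewrite orbT opp_psub //; [rewrite xmap_xv // /zero_at eqxx (fgl_opp0 HF)|exact: admissible_xmap].
by rewrite orbF xmap_xv.
Qed.

(** Two zeros are the case t = 0 of the pair (t, \bar t), so this holds for P too, whose powers do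
    not vanish at 0. *)
Lemma hl_fun_xlast00 n :
  xlast0 (xlast0 (hl_fun F (@pow n.+2) lam)) = hl_fun F (@pow n) lam.
Proof.
have [phi ne aph bph cov] := lift2_range (@ord_max n.+1) (@ord_max n).
have H := hl_fun_minus HF Ltf pow_psub lam phi ne aph bph cov.
have l0 m := @nconst_last0map m; have m0 := @nconst_minus L F HF n.+2 ord_max (lift ord_max ord_max).
have c0 i : nconst (psub (last0map i) (xmap (@last0map n)) : fps (xb n) L).
  by apply: nconst_psub => //; exact: admissible_xmap.
have E := congr1 (fun f => psub f (xmap (fun i => psub (last0map i) (xmap (@last0map n))))) H.
rewrite !xlast0E xmap_comp //; rewrite !xmap_comp // in E.
have la k : last0map (ord_max : 'I_k.+1) = 0 by rewrite /last0map unlift_none.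
have lb : psub (last0map (lift ord_max ord_max)) (xmap (@last0map n)) = 0.
  by rewrite {1}/last0map liftK xmap_xv // la.
transitivity (psub (hl_fun F (@pow n.+2) lam) (xmap (fun i =>
   psub (minus_at F ord_max (lift ord_max ord_max) i)
     (xmap (fun i => psub (last0map i) (xmap (@last0map n))))))).
  apply: eq_xmap => i; rewrite /minus_at; case: eqP => [->|_]; last by rewrite xmap_xv.
  rewrite opp_psub //; last exact: admissible_xmap.
  by rewrite xmap_xv // la lb psub0 ?(fgl_opp0 HF) //; exact: admissible_xmap.
rewrite E -[RHS]xmap_id; apply: eq_xmap => j; rewrite xmap_xv //.
by rewrite {1}/last0map liftK xmap_xv // /last0map liftK.
Qed.

Hypothesis pow0 : forall n k, (0 < k)%N -> pow (0 : fps (xb n) L) k = 0.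
Hypothesis lam0 : 0%N \notin lam.

Lemma hl_fun_xlast0 n : xlast0 (hl_fun F (@pow n.+1) lam) = hl_fun F (@pow n) lam.
Proof.
have [phi aph cov] := lift1_range (@ord_max n).
have H := hl_fun_zero HF Ltf pow_psub phi aph cov (@pow0 n.+1) lam0.
have l0 := @nconst_last0map n; have z0 := @nconst_zero L n.+1 ord_max.
have := congr1 (fun f => psub f (xmap (@last0map n))) H; rewrite !xmap_comp // xlast0E => E.
transitivity (psub (hl_fun F (@pow n.+1) lam) (xmap (fun i =>
   psub (zero_at L ord_max i) (xmap (@last0map n))))).
  apply: eq_xmap => i; rewrite /zero_at; case: eqP => [->|_]; last by rewrite xmap_xv.
  by rewrite /last0map unlift_none psub0 //; exact: admissible_xmap.
rewrite E -[RHS]xmap_id; apply: eq_xmap => j; rewrite xmap_xv //.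
by rewrite /last0map liftK.
Qed.

Hypothesis pow_double : forall n (t : fps (xb n) L) k, (0 < k)%N ->
  exists s, pow t k = fadd F t t * s.

Lemma hl_fun_Gamma_plus n : over_b (Gamma_plus F) (hl_fun F (@pow n) lam).
Proof.
move=> m; apply/Gamma_plusE; split; first exact: hl_fun_Gamma.
case: n => [[]//|n] i0 _.
have [phi aph cov] := lift1_range i0.
have [g gE] := hl_fun_zero_dvd HF Ltf pow_psub phi aph cov (@pow0 n.+1) lam0 (@pow_double n.+1).
exists (bcoef g m); rewrite -bcoef_xlift_mul xlift_fadd // xlift_pvar -gE.
rewrite -bcoef_xmap; last by move=> i; rewrite /repl; case: ifP.
apply/fpsP => p; rewrite fcoefB !bcoefE fcoefB; congr (_ - (_ : fps _ _) _).
by apply: eq_xmap => i; rewrite /repl /zero_at; case: ifP => _; rewrite ?xlift0 ?xlift_pvar.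
Qed.

End HlFun.

Definition last0 n (f : fps 'I_n.+1 L) : fps 'I_n L :=
  psub f (fun i => if unlift ord_max i is Some j then pvar L j else 0).

Lemma admissible_last0 n :
  admissible (fun i : 'I_n.+1 => if unlift ord_max i is Some j then pvar L j else 0).
Proof. by apply: admissible_fin => i; case: unlift. Qed.

Lemma bcoef_xlast0 n (h : fps (xb n.+1) L) m : bcoef (xlast0 h) m = last0 (bcoef h m).
Proof.
rewrite /last0 -bcoef_xmap; last by move=> i; case: unlift.
rewrite xlast0E; congr bcoef; apply: eq_xmap => i; rewrite /last0map.
by case: unlift => [j|]; rewrite ?xlift0 ?xlift_pvar.
Qed.

Lemma Gamma_last0 n (f : fps 'I_n.+1 L) : Gamma F f -> Gamma F (last0 f).
Proof.
move=> /supersymmetricE[sf zf]; have al := @admissible_last0 n.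
have lv i : psub (pvar L (lift ord_max i)) (fun i : 'I_n.+1 => if unlift ord_max i is Some j then pvar L j else 0) = pvar L i.
  by rewrite psub_var // liftK.
apply/supersymmetricE; split=> [w|i0 i1 i00 i11].
  rewrite -{2}(sf (lift_perm ord_max ord_max w)) /last0 !psub_comp //; try exact: admissible_pvar.
  apply: eq_psub => i; case: (unliftP ord_max i) => [j ->|->].
    by rewrite psub_var ?lift_perm_lift ?lv //; exact: admissible_pvar.
  rewrite psub0; last exact: admissible_pvar.
  by rewrite psub_var // lift_perm_id unlift_none.
have am : admissible (minus2 i0 i1) by apply: admissible_fin; exact: nconst_minus2.
have az : admissible (zero2 i0 i1) by apply: admissible_fin; exact: nconst_zero2.
set j0 := lift ord_max i0; set j1 := lift ord_max i1.
have am' : admissible (minus2 j0 j1) by apply: admissible_fin; exact: nconst_minus2.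
have az' : admissible (zero2 j0 j1) by apply: admissible_fin; exact: nconst_zero2.
have /(congr1 (@last0 n)) := zf j0 j1 (etrans (lift_max _) i00) (etrans (lift_max _) i11).
rewrite /last0 !psub_comp // => E.
transitivity (psub f (fun v : 'I_n.+1 => psub (minus2 j0 j1 v)
  (fun i : 'I_n.+1 => if unlift ord_max i is Some j then pvar L j else 0))).
  apply: eq_psub => i; case: (unliftP ord_max i) => [j ->|->].
    rewrite psub_var // /minus2 (inj_eq lift_inj); case: ifP => _; rewrite ?lv //.
    by rewrite opp_psub ?lv.
  by rewrite psub0 // /minus2 (negPf (neq_lift _ _)) psub_var // unlift_none.
rewrite E; apply: eq_psub => i; case: (unliftP ord_max i) => [j ->|->].
  by rewrite psub_var // /zero2 !(inj_eq lift_inj); case: ifP => _; rewrite ?psub0 ?lv //.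
by rewrite psub0 // /zero2 !(negPf (neq_lift _ _)) psub_var // unlift_none.
Qed.

(** The transition to an odd n holds by definition; the transition to an even n sets two variables
    of P to 0. *)
Lemma PLplus_mem lam : projlim (over_b (Gamma F)) (PLplus F lam).
Proof.
have HP n : over_b (Gamma F) (PL F lam n) by exact: hl_fun_Gamma bpow_psub _ _.
move=> n; split; rewrite /PLplus /=.
  by case: ifP => _ // m; rewrite bcoef_xlast0; apply: Gamma_last0; exact: HP.
case: (odd n) => //=; exact: (hl_fun_xlast00 bpow_psub).
Qed.

Lemma strictpartP (lam : strictpart) : sorted gtn (val lam) /\ 0%N \notin val lam.
Proof. by have /andP[] := valP lam. Qed.

Lemma QL_mem lam : projlim (over_b (Gamma_plus F)) (QL F lam).
Proof.
move=> n; split.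
  exact: (hl_fun_Gamma_plus bpow2_psub bpow2_zero (proj2 (strictpartP lam)) bpow2_double).
exact: (hl_fun_xlast0 bpow2_psub bpow2_zero (proj2 (strictpartP lam))).
Qed.

End Membership.

(** * Initial monomials *)

Section Rearrangement.
Import Order.TTheory Num.Theory.

(** Summation by parts: each nonnegative partial sum A_c is weighted by a drop of s, which is at
    least 1. *)
Lemma abel_lower_bound (s a : nat -> int) (A : nat -> int) r :
  (forall c, A c = \sum_(k < c) a k) ->
  (forall k, (k < r)%N -> s k.+1 + 1 <= s k) -> (forall c, (c <= r)%N -> 0 <= A c) ->
  \sum_(c < r.+1) A c + s r * A r.+1 <= \sum_(k < r.+1) s k * a k.
Proof.
move=> AE; have AS c : A c.+1 = A c + a c by rewrite !AE big_ord_recr.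
have A0 : A 0%N = 0 by rewrite AE big_ord0.
elim: r => [|r IH] sd A_ge0; first by rewrite !big_ord_recr !big_ord0 /= AS A0; lia.
have {}IH : \sum_(c < r.+1) A c + s r * A r.+1 <= \sum_(k < r.+1) s k * a k.
  by apply: IH => [k kr|c cr]; [apply: sd; lia|apply: A_ge0; lia].
rewrite big_ord_recr [X in _ <= X]big_ord_recr /= (AS r.+1).
have := sd r (ltnSn r); have := A_ge0 r.+1 (leqnn _).
move: IH; set X := \sum_(c < _) _; set Y := \sum_(k < _) _.
by move: (s r) (s r.+1) (A r.+1) (a r.+1) => sr sr1 Ar ar; nia.
Qed.

Lemma sum_uniq_ge (t : seq nat) : uniq t -> (\sum_(k < size t) k <= \sum_(x <- t) x)%N.
Proof.
move=> ut; rewrite -(perm_big _ (permEl (perm_sort leq t))) /= -(size_sort leq t).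
have : sorted ltn (sort leq t).
  by rewrite ltn_sorted_uniq_leq sort_uniq ut sort_sorted //; exact: leq_total.
move: (sort leq t) => {ut}u us; rewrite [X in (_ <= X)%N](big_nth 0%N) big_mkord.
apply: leq_sum => -[i /= iu] _; elim: i iu => // i IH iu.
apply: leq_ltn_trans (IH (ltnW iu)) _.
by move/(sortedP 0%N): us; apply.
Qed.

(** Take a_k = f(k) - k. The partial sums are nonnegative because c distinct naturals add up to at
    least 0 + ... + (c - 1). With s strictly decreasing and positive, Abel summation then forces all
    of them to vanish. *)
Lemma strict_rearrangement (s : seq nat) (f : nat -> nat) :
  sorted gtn s -> 0%N \notin s -> {in gtn (size s) &, injective f} ->
  (\sum_(k < size s) nth 0 s k * f k <= \sum_(k < size s) nth 0 s k * k)%N ->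
  forall k, (k < size s)%N -> f k = k.
Proof.
move=> ss s0 fi; case: (posnP (size s)) => [->|]; first by [].
case sE : (size s) => [//|r] _ H.
pose a k : int := (f k)%:Z - k%:Z; pose A c := \sum_(k < c) a k.
have split_sum (u v w : nat -> int) c : (forall k, w k = u k - v k) ->
    \sum_(k < c) w k = \sum_(k < c) u k - \sum_(k < c) v k.
  by move=> E; rewrite -sumrB; apply: eq_bigr => k _; rewrite E.
have Age c : (c <= r.+1)%N -> 0 <= A c.
  move=> cr; rewrite /A (split_sum (fun k => (f k)%:Z) (fun k => k%:Z)) //.
  have ut : uniq [seq f k | k <- iota 0 c].
    rewrite map_inj_in_uniq ?iota_uniq // => x y; rewrite !mem_iota !add0n => xc yc.
    apply: fi; rewrite inE /= sE; [have := xc|have := yc]; lia.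
  have := sum_uniq_ge ut; rewrite size_map size_iota big_map (_ : iota 0 c = index_iota 0 c) ?big_mkord; last by rewrite /index_iota subn0.
  by rewrite -!(big_morph Posz PoszD (erefl 0%:Z)) subr_ge0 lez_nat.
have nth_pos k : (k <= r)%N -> (0 < nth 0%N s k)%N.
  move=> kr; rewrite lt0n; apply: contraNneq s0 => <-; apply: mem_nth.
  by rewrite sE.
have sum0 : \sum_(k < r.+1) (nth 0%N s k)%:Z * a k <= 0.
  rewrite (split_sum (fun k => (nth 0%N s k * f k)%:Z) (fun k => (nth 0%N s k * k)%:Z)
    (fun k => (nth 0%N s k)%:Z * a k)); last first.
    by move=> k; rewrite /a mulrBr !PoszM.
  by rewrite -!(big_morph Posz PoszD (erefl 0%:Z)) subr_le0 lez_nat.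
have main : \sum_(c < r.+1) A c + (nth 0%N s r)%:Z * A r.+1 <= \sum_(k < r.+1) (nth 0%N s k)%:Z * a k.
  apply: (abel_lower_bound (s := fun k => (nth 0%N s k)%:Z)) => // [k kr|c cr]; last exact: Age (leqW cr).
  have /(sortedP 0%N)/(_ k) := ss; rewrite sE ltnS kr => /(_ isT) /=; lia.
have sumA : \sum_(c < r.+1) A c = 0 /\ A r.+1 = 0.
  have S0 : 0 <= \sum_(c < r.+1) A c.
    by apply: sumr_ge0 => c _; apply: Age; exact: ltnW.
  have Ar := Age r.+1 (leqnn _); have := nth_pos r (leqnn r).
  move: main sum0; set X := \sum_(c < _) _ in S0 *; set Y := \sum_(k < _) _.
  by move: (nth 0%N s r) Ar; set Z := A r.+1 => z; nia.
have A0 c : (c <= r.+1)%N -> A c = 0.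
  rewrite leq_eqVlt => /orP[/eqP -> //|cr]; first by case: sumA.
  case: sumA => SA _; have /psumr_eq0P Hp : forall i : 'I_r.+1, xpredT i -> 0 <= A i.
    by move=> i _; apply: Age; exact: ltnW.
  exact: (Hp SA (Ordinal cr) isT).
move=> k kr; have : A k.+1 = A k + a k by rewrite /A big_ord_recr.
rewrite !A0 //; last exact: ltnW.
rewrite /a; lia.
Qed.
End Rearrangement.

Section BigMset.
Variables (V : choiceType) (I : Type) (r : seq I) (P : pred I) (E : I -> {mset V}%mset).

Lemma big_msetE v : (\big[@msetD V/mset0]_(i <- r | P i) E i)%mset v = (\sum_(i <- r | P i) E i v)%N.
Proof. by elim/big_rec2: _ => [|i x y _ <-]; rewrite ?mset0E ?msetE2. Qed.

Lemma wt_big w : wt w (\big[@msetD V/mset0]_(i <- r | P i) E i)%mset = (\sum_(i <- r | P i) wt w (E i))%N.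
Proof. by elim/big_rec2: _ => [|i x y _ <-]; rewrite ?wt0 ?wtD. Qed.
End BigMset.

Definition mset_of n (m : 'I_n -> nat) : {mset 'I_n}%mset :=
  (\big[@msetD _/mset0]_(i < n) msetn (m i) i)%mset.

Lemma mset_ofE n (m : 'I_n -> nat) i : mset_of m i = m i.
Proof.
rewrite big_msetE (bigD1 i) //= msetnxx big1 ?addn0 // => j /negPf ji.
by rewrite msetnE eq_sym ji.
Qed.

Lemma wt_ord n w (p : {mset 'I_n}%mset) : wt w p = (\sum_(i < n) p i * w i)%N.
Proof.
rewrite (_ : p = mset_of p); last by apply/msetP => i; rewrite mset_ofE.
rewrite wt_big; apply: eq_bigr => i _; by rewrite wtn mset_ofE.
Qed.

Definition xmon n (mu : seq nat) : {mset 'I_n}%mset := mset_of (fun i => nth 0%N mu i).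

Lemma xmonE n mu (i : 'I_n) : xmon n mu i = nth 0%N mu i.
Proof. exact: mset_ofE. Qed.

Lemma wt_xmon n w mu : (size mu <= n)%N ->
  wt (fun i : 'I_n => w (nat_of_ord i)) (xmon n mu) = (\sum_(k < size mu) nth 0%N mu k * w k)%N.
Proof.
move=> sn; rewrite wt_ord (big_ord_widen n (fun k => nth 0%N mu k * w k)%N sn).
rewrite [RHS]big_mkcond; apply: eq_bigr => i _; rewrite xmonE.
by case: ltnP => // /(nth_default 0%N) ->.
Qed.

Lemma deg_xmon n mu : (size mu <= n)%N -> deg (xmon n mu) = sumn mu.
Proof.
move=> sn; rewrite degE (wt_xmon (fun=> 1%N)) // sumnE (big_nth 0%N) big_mkord.
by apply: eq_bigr => k _; rewrite muln1.
Qed.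

Definition wsum (mu : seq nat) : nat := \sum_(k < size mu) nth 0%N mu k * k.

Section InitHl.
Variables (L : comNzRingType) (F : fps 'I_2 L).
Hypothesis HF : is_fgl F.
Hypothesis Ltf : forall (z : L) n, (0 < n)%N -> z *+ n = 0 -> z = 0.
Variable pow : forall n, fps (xb n) L -> nat -> fps (xb n) L.
Hypothesis pow_psub : forall m n (g : 'I_m -> fps (xb n) L) t k,
  (forall i, nconst (g i)) -> nconst t ->
  psub (pow t k) (xmap g) = pow (psub t (xmap g)) k.
Variable cpow : nat -> L.
Hypothesis pow_init : forall n (i : 'I_n) k B, (0 < B)%N ->
  init (om B) (pow (xv L i) k) (cpow k) (msetn k (inl i : xb n)).
Variable lam : seq nat.
Hypotheses (slam : sorted gtn lam) (lam0 : 0%N \notin lam).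
Let r := size lam.

(** All terms share the initial monomial N of W. The rest of the term of I has weight B |lam| plus
    the sum of the lam_k I(k), which [strict_rearrangement] makes minimal only at the inclusion I0.
    Dividing by the initial term of W, whose coefficient is regular, gives the result. *)
Lemma hl_fun_init n B : (r <= n)%N -> (0 < B)%N ->
  init (om B) (hl_fun F (@pow n) lam) (\prod_(k < r) cpow (nth 0%N lam k))
    (mxb (xmon n lam) mset0).
Proof.
move=> rn B0.
pose c := \prod_(p : ('I_n * 'I_n)%type | p.1 != p.2) (if (p.1 < p.2)%N then 1 else - 1 : L).
pose N := (\big[@msetD _/mset0]_(p : ('I_n * 'I_n)%type | p.1 != p.2)
   [mset (inl (if (p.1 < p.2)%N then p.1 else p.2) : xb n)])%mset.
pose PI (I : {ffun 'I_r -> 'I_n}) :=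
  (\big[@msetD _/mset0]_(k < r) msetn (nth 0%N lam k) (inl (I k) : xb n))%mset.
pose I0 : {ffun 'I_r -> 'I_n} := [ffun k => widen_ord rn k].
have rc z : c * z = 0 -> z = 0.
  rewrite /c; elim/big_rec: _ z => [|p y _ IH] z; first by rewrite mul1r.
  rewrite -mulrA; case: ifP => _; first by rewrite mul1r; exact: IH.
  by move=> /eqP; rewrite mulN1r oppr_eq0 => /eqP; exact: IH.
have iW : init (om B) (fac_W F n) c N.
  by apply: init_prod => -[i j] /= ij; exact: init_u.
have iT I : exists c', init (om B) (term F pow I) c' (PI I `+` N)%mset.
  exists (\prod_(k < r) cpow (nth 0%N lam k) *
    \prod_(p : ('I_n * 'I_n)%type | p.1 != p.2) (if leadpair I p.1 p.2 || (p.1 < p.2)%N then 1 else - 1)).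
  apply: initM; [by apply: init_prod => k _; exact: pow_init|apply: init_prod => -[i j] /= ij].
  rewrite /fac; case: (leadpair I i j) => /=; [exact: init_v|exact: init_u].
have iT0 : init (om B) (term F pow I0) (c * \prod_(k < r) cpow (nth 0%N lam k)) (PI I0 `+` N)%mset.
  rewrite mulrC; apply: initM; [by apply: init_prod => k _; exact: pow_init|apply: init_prod => -[i j] /= ij].
  (* A leading pair of the inclusion has i < j, so replacing \bar x_j by x_j leaves the initial term
     x_i unchanged. *)
  rewrite /fac; case: ifP => [lij|_]; last exact: init_u.
  have := @leadpair_widen lam n rn (1%g : 'S_n) i j ij; rewrite !perm1.
  rewrite (_ : [ffun k => _] = I0); last by apply/ffunP => k; rewrite !ffunE perm1.
  by rewrite lij => /esym/andP[_ ij']; have := @init_v L F HF n B i j ij; rewrite ij'.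
have wPI I : wt (om B) (PI I) = (B * sumn lam + \sum_(k < r) nth 0%N lam k * I k)%N.
  rewrite wt_big sumnE (big_nth 0%N) big_mkord big_distrr -big_split /=.
  by apply: eq_bigr => k _; rewrite wtn /=; ring.
have I0E : PI I0 = mxb (xmon n lam) mset0.
  apply: mxbP => [i|j]; rewrite big_msetE.
    rewrite xmonE; have [ir|ri] := ltnP i r.
      rewrite (bigD1 (Ordinal ir)) //= big1 ?addn0 => [|k /negPf ki]; rewrite ffunE msetnE.
        by rewrite (_ : widen_ord _ _ = i) ?eqxx //; exact: val_inj.
      rewrite ifN //; apply: contraFN ki => /eqP[ik].
      by apply/eqP/val_inj; rewrite /= ik.
    rewrite nth_default // big1 // => k _; rewrite ffunE msetnE ifN //.
    by apply/eqP => -[ik]; move: ri; rewrite ik /= leqNgt ltn_ord.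
  by rewrite mset0E big1 // => k _; rewrite msetnE.
have big (I : {ffun 'I_r -> 'I_n}) : injectiveb I -> I != I0 -> (wt (om B) (PI I0) < wt (om B) (PI I))%N.
  move=> /injectiveP II ne; rewrite ltnNge; apply/negP; rewrite !wPI leq_add2l => H.
  move/eqP: ne; apply; apply/ffunP => k; rewrite ffunE; apply: val_inj => /=.
  pose f (x : nat) : nat := if insub x is Some y then I (y : 'I_r) else 0%N.
  have fE (l : 'I_r) : f l = I l by rewrite /f valK.
  have := @strict_rearrangement lam f slam lam0 _ _ k (ltn_ord k); rewrite fE; apply.
    move=> x y; rewrite !inE => xr yr.
    by rewrite -[x]/(val (Ordinal xr)) -[y]/(val (Ordinal yr)) !fE => /val_inj/II ->.
  move: H; rewrite -/r; congr (_ <= _)%N; apply: eq_bigr => l _; rewrite ?fE // ffunE //.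
apply: (init_div rc iW); rewrite mulrC (hl_funP HF Ltf pow_psub) /hl_sum [(N `+` _)%mset]msetDC -I0E.
rewrite (bigD1 I0) /=; last by apply/injectiveP => i j; rewrite !ffunE => -[/val_inj].
apply: init_eqD => //; apply: vge_sum => I /andP[II ne].
have [c' /init_vge] := iT I; apply: vgeW; rewrite !wtD.
by have := big I II ne; lia.
Qed.

End InitHl.

Section Rename.
Variables (V W : choiceType) (s : W -> V).
Hypothesis s_inj : injective s.
Implicit Types p q : {mset W}%mset.

Definition mmap p : {mset V}%mset := seq_mset (map s (p : seq W)).

Lemma mmapE p v : mmap p (s v) = p v.
Proof.
rewrite mset_seqE count_map -(count_mem_mset v p); apply: eq_count => u /=.
exact: inj_eq.
Qed.

Lemma mmap_out p v : (forall u, v != s u) -> mmap p v = 0%N.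
Proof.
move=> vs; rewrite mset_seqE count_map -(count_pred0 p); apply: eq_count => u /=.
by rewrite eq_sym; apply/negbTE.
Qed.

Lemma mmap_codom (K : {mset V}%mset) p : (forall u, K (s u) = p u) ->
  (forall v, (forall u, v != s u) -> K v = 0%N) -> K = mmap p.
Proof.
move=> Ks K0; apply/msetP => v; case: (pselect (exists u, v = s u)) => [[u ->]|nv].
  by rewrite mmapE.
have vs u : v != s u by apply/eqP => vu; apply: nv; exists u.
by rewrite K0 // mmap_out.
Qed.

Lemma mmap0 : mmap mset0 = mset0.
Proof. by apply/esym/mmap_codom => u; rewrite ?mset0E. Qed.

Lemma mmap_cons u p : mmap (u +` p)%mset = (s u +` mmap p)%mset.
Proof.
apply/esym/mmap_codom => v; rewrite !msetE2 ?mmapE ?msetnE ?(inj_eq s_inj) //.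
by move=> vs; rewrite mmap_out // (negPf (vs u)).
Qed.

Lemma wt_mmap w p : wt w (mmap p) = wt (fun u => w (s u)) p.
Proof.
elim/mset_ind: p => [|u p IH]; first by rewrite mmap0 !wt0.
by rewrite mmap_cons !wtD IH !wt1.
Qed.

Lemma deg_mmap p : deg (mmap p) = deg p.
Proof. by rewrite !degE wt_mmap. Qed.

Variables (R : comNzRingType) (g : V -> fps W R).
Hypothesis gs : forall u, g (s u) = pvar R u.
Hypothesis g0 : forall v, (forall u, v != s u) -> g v = 0.

Lemma coef_rename f p : psub f g p = f (mmap p).
Proof.
have ev q : mset_eval g (mmap q) = fpsX R q.
  elim/mset_ind: q => [|u q IH]; first by rewrite mmap0 /fpsX !mset_eval0.
  by rewrite mmap_cons mset_evalD mset_eval1 gs IH fpsXD fpsX1.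
have ev0 K : (exists q, K = mmap q) \/ mset_eval g K = 0.
  elim/mset_ind: K => [|v K [[q ->]|K0]]; first by left; exists mset0; rewrite mmap0.
    case: (pselect (exists u, v = s u)) => [[u ->]|nv].
      by left; exists (u +` q)%mset; rewrite mmap_cons.
    right; rewrite mset_evalD mset_eval1 g0 ?mul0r // => u.
    by apply/eqP => vu; apply: nv; exists u.
  by right; rewrite mset_evalD K0 mulr0.
rewrite psub_coef (@fsbig_setT_seq _ _ [:: mmap p]) //.
  by rewrite big_seq1 ev coef_X eqxx mulr1.
move=> K; rewrite inE => Kp; case: (ev0 K) => [[q Kq]|->]; last by rewrite fcoef0 mulr0.
rewrite Kq ev coef_X; case: eqP => [pq|_]; last by rewrite mulr0.
by move: Kp; rewrite Kq pq eqxx.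
Qed.
End Rename.

Section Leading.
Variables (L : comNzRingType).

Lemma coef_last0 n (f : fps 'I_n.+1 L) p : last0 f p = f (mmap (lift ord_max) p).
Proof.
rewrite /last0; apply: (coef_rename (@lift_inj _ ord_max)) => u; first by rewrite liftK.
by case: (unliftP ord_max u) => [j -> /(_ j)|-> _ //]; rewrite eqxx.
Qed.

Lemma mmap_xmon n mu : (size mu <= n)%N -> mmap (lift ord_max) (xmon n mu) = xmon n.+1 mu.
Proof.
move=> sn; apply/esym/mmap_codom => [|u|v vs]; first exact: lift_inj.
  by rewrite !xmonE lift_max.
case: (unliftP ord_max v) vs => [j -> /(_ j)|-> _]; first by rewrite eqxx.
by rewrite xmonE nth_default.
Qed.

Lemma xmon_mmap n mu (p : {mset 'I_n}%mset) :
  mmap (lift ord_max) p = xmon n.+1 mu -> p = xmon n mu.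
Proof.
move=> E; apply/msetP => i; rewrite xmonE -lift_max -xmonE -E mmapE //.
exact: lift_inj.
Qed.

(** A form of the initial term free of B: order at least |lam| in x and b together, and x^lam is the
    only pure x-monomial of degree |lam| with index weight at most [wsum lam]. It passes to fewer
    variables, where x^lam may no longer exist. *)
Definition leading n (h : fps (xb n) L) (lam : seq nat) (w : L) : Prop :=
  [/\ (size lam <= n)%N -> bcoef h mset0 (xmon n lam) = w,
      forall m p, bcoef h m p != 0 -> (sumn lam <= deg p + deg m)%N &
      forall p, bcoef h mset0 p != 0 -> deg p = sumn lam ->
        p = xmon n lam \/ (wsum lam < wt (@nat_of_ord n) p)%N].

Lemma leading_init n (h : fps (xb n) L) lam w : (size lam <= n)%N ->
  (forall B, (0 < B)%N -> init (om B) h w (mxb (xmon n lam) mset0)) -> leading h lam w.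
Proof.
move=> sn H; have wlam : wt (@nat_of_ord n) (xmon n lam) = wsum lam := wt_xmon id sn.
split=> [_|m p|p nz dp].
- by have [] := H 1%N isT.
- move=> nz; rewrite leqNgt; apply: contraNN nz => lt.
  (* For B this large one unit of total degree outweighs the index part of the weight of x^p b^m. *)
  set B := (wt (@nat_of_ord n) p + n * deg m).+1; apply/eqP.
  apply: (init_vge (H B isT)); rewrite !wt_mxb deg0 deg_xmon // muln0 addn0 wlam.
  have := leq_mul (leqnn B) lt; rewrite mulnS mulnDr mulnDl {1}/B.
  by move: (B * _)%N (B * _)%N (B * _)%N => x y z; lia.
- have [_ /(_ (mxb p mset0))] := H 1%N isT; rewrite !wt_mxb deg0 deg_xmon // dp wlam => H0.
  have [le|lt] := leqP (wt (@nat_of_ord n) p) (wsum lam); last by right.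
  left; apply/eqP; apply: contraNT nz => ne; apply/eqP/H0; first by rewrite leq_add2r leq_add2l.
  by apply: contraNneq ne => /mxb_inj[->].
Qed.

Lemma leading0 n lam w : (n < size lam)%N -> leading (0 : fps (xb n) L) lam w.
Proof. by move=> ns; split=> [|m p|p]; rewrite ?eqxx // leqNgt ns. Qed.

Lemma leading_xlast0 n (h : fps (xb n.+1) L) lam w :
  leading h lam w -> leading (xlast0 h) lam w.
Proof.
have wl p : wt (@nat_of_ord n.+1) (mmap (lift ord_max) p) = wt (@nat_of_ord n) p.
  rewrite wt_mmap; last exact: lift_inj.
  by congr wt; apply/funext => i; exact: lift_max.
have dl p : deg (mmap (lift (@ord_max n)) p) = deg p by apply: deg_mmap; exact: lift_inj.
move=> [H1 H2 H3]; split=> [sn|m p|p]; rewrite bcoef_xlast0 coef_last0.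
- by rewrite mmap_xmon // H1 // ltnW.
- by move=> /H2; rewrite dl.
- by move=> nz dp; case: (H3 _ nz); rewrite ?dl ?wl //; [move/xmon_mmap; left|right].
Qed.

Variable F : fps 'I_2 L.
Hypothesis HF : is_fgl F.
Hypothesis Ltf : forall (z : L) n, (0 < n)%N -> z *+ n = 0 -> z = 0.

Lemma bpow_init n (i : 'I_n) k B : (0 < B)%N ->
  init (om B) (bpow F (xv L i) k) 1 (msetn k (inl i : xb n)).
Proof.
move=> B0; rewrite bpowE.
have : init (om B) (\prod_(j < k) fadd F (xv L i) (bv L n (nat_of_ord j))) (\prod_(j < k) 1)
    (\big[@msetD _/mset0]_(j < k) [mset (inl i : xb n)])%mset.
  apply: init_prod => j _; apply: init_fadd => //; first exact: init_xv.
  rewrite wt_xv; apply: vgeW (@vge_var _ L (@om n B) (inr (nat_of_ord j))).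
  by rewrite /= ltn_add2l.
have E : (\big[@msetD _/mset0]_(j < k) [mset (inl i : xb n)])%mset = msetn k (inl i : xb n).
  apply/msetP => v; rewrite big_msetE sum_nat_const card_ord !msetnE.
  by case: ifP => _; rewrite ?muln1 ?muln0.
by rewrite E big1_eq.
Qed.

Definition cpow2 (k : nat) : L := if k is 0 then 1 else 1 *+ 2.

Lemma bpow2_init n (i : 'I_n) k B : (0 < B)%N ->
  init (om B) (bpow2 F (xv L i) k) (cpow2 k) (msetn k (inl i : xb n)).
Proof.
move=> B0; case: k => [|k].
  rewrite (_ : msetn 0 _ = mset0); first exact: init1.
  by apply/msetP => v; rewrite msetnE mset0E if_same.
rewrite bpow2S (_ : msetn k.+1 _ = ((inl i : xb n) +` msetn k (inl i : xb n))%mset); last first.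
  by apply/msetP => v; rewrite !msetE2 !msetnE; case: ifP.
rewrite -[cpow2 _]mulr1; apply: initM; last exact: bpow_init.
apply: init_double => //; last exact: init_xv.
by rewrite wt_xv; lia.
Qed.

Lemma hl_fun_leading (pow : forall n, fps (xb n) L -> nat -> fps (xb n) L) (cpow : nat -> L)
    (lam : strictpart) n :
  (forall m n (g : 'I_m -> fps (xb n) L) t k, (forall i, nconst (g i)) -> nconst t ->
     psub (pow m t k) (xmap g) = pow n (psub t (xmap g)) k) ->
  (forall n (i : 'I_n) k B, (0 < B)%N ->
     init (om B) (pow n (xv L i) k) (cpow k) (msetn k (inl i : xb n))) ->
  leading (hl_fun F (@pow n) (val lam)) (val lam)
    (\prod_(k < size (val lam)) cpow (nth 0%N (val lam) k)).
Proof.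
move=> pow_psub pow_init; have [slam lam0] := strictpartP lam.
have [sn|ns] := leqP (size (val lam)) n.
  by apply: leading_init => // B B0; exact: hl_fun_init.
rewrite /hl_fun leqNgt ns; exact: leading0.
Qed.

Lemma PLplus_leading lam n : leading (PLplus F lam n) (val lam) 1.
Proof.
have H m : leading (PL F lam m) (val lam) 1.
  have := @hl_fun_leading (@bpow L F) (fun=> 1) lam m (@bpow_psub L F) bpow_init.
  by rewrite big1.
by rewrite /PLplus; case: ifP => _ //; exact: leading_xlast0.
Qed.

Lemma QL_leading lam n : leading (QL F lam n) (val lam) ((1 *+ 2) ^+ size (val lam)).
Proof.
have := @hl_fun_leading (@bpow2 L F) cpow2 lam n (@bpow2_psub L F) bpow2_init.
rewrite (eq_bigr (fun=> 1 *+ 2)) ?prodr_const ?card_ord // => k _.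
have [_ lam0] := strictpartP lam; rewrite /cpow2.
by case E : (nth _ _ _) => //; move: lam0; rewrite -E mem_nth.
Qed.

End Leading.

(** * Coefficients at strict monomials *)

Section StrictSort.

Lemma nth_filter_pos (s : seq nat) i : sorted geq s ->
  nth 0%N (filter (fun x => 0 < x)%N s) i = nth 0%N s i.
Proof.
elim: s i => // -[|x] s IH i /= ss.
  have s0 : all (fun y => y == 0%N) s.
    by apply: sub_all (order_path_min (rev_trans leq_trans) ss) => y /=; rewrite leqn0.
  rewrite (_ : filter _ s = [::]); last first.
    by apply/eqP; rewrite -[_ == _]negbK -has_filter -all_predC; apply: sub_all s0 => y /=; rewrite lt0n negbK.
  rewrite nth_nil; case: i => //= i; have [is_|si] := ltnP i (size s); last by rewrite nth_default.
  by apply/esym/eqP; exact: (all_nthP 0%N s0).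
by case: i => //= i; apply: IH; exact: path_sorted ss.
Qed.

Lemma strict_monomial n (p : {mset 'I_n}%mset) :
  (forall i j, i != j -> (0 < p i)%N -> p i != p j) ->
  exists (w : 'S_n) (mu : strictpart),
    [/\ (size (val mu) <= n)%N, sumn (val mu) = deg p & mmap w p = xmon n (val mu)].
Proof.
move=> pd; pose t1 := [tuple p i | i < n]; pose t2 := [tuple of sort geq t1].
have pt : perm_eq t1 t2 by rewrite perm_sym perm_sort.
have [w wE] := tuple_permP pt.
have t1E : t1 = [seq p i | i <- enum 'I_n] :> seq nat by rewrite /=; congr map; rewrite enumT; exact: erefl.
have geq_total : total geq by move=> x y; exact: leq_total.
have geq_trans : transitive geq by exact: (rev_trans leq_trans).
have st2 : sorted geq t2 by apply: sort_sorted => x y; exact: leq_total.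
pose mu := filter (fun x => 0 < x)%N t2.
have umu : uniq mu.
  rewrite /mu (filter_sort geq_total geq_trans).
  rewrite sort_uniq t1E filter_map map_inj_in_uniq ?filter_uniq -?enumT ?enum_uniq //.
  move=> i j; rewrite !mem_filter /= => /andP[pi _] _ pij.
  by apply/eqP; apply: contraTT isT => ij; have := pd _ _ ij pi; rewrite pij eqxx.
have smu : strictpart_pred mu.
  rewrite /strictpart_pred gtn_sorted_uniq_geq umu sorted_filter //=.
  by rewrite mem_filter.
exists w; exists (exist _ mu smu); split=> /=.
- by rewrite size_filter -[X in (_ <= X)%N](size_tuple t2) count_size.
- transitivity (sumn t2).
    rewrite /mu !sumnE big_filter big_mkcond /=; apply: eq_bigr => x _.
    by case: posnP.
  rewrite !sumnE -(perm_big _ pt) t1E degE wt_ord big_map big_enum /=.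
  by apply: eq_bigr => i _; rewrite muln1.
apply/esym/mmap_codom => [|i|v /(_ (w^-1 v)%g)]; [exact: perm_inj| |by rewrite permKV eqxx].
rewrite xmonE nth_filter_pos // -tnth_nth.
have e : t1 = [tuple tnth t2 (w i) | i < n] by exact: val_inj.
by have := congr1 (fun t : n.-tuple nat => tnth t i) e; rewrite !tnth_mktuple => ->.
Qed.
End StrictSort.

Section GammaVanishing.
Variables (L : comNzRingType) (F : fps 'I_2 L).
Hypothesis HF : is_fgl F.

Lemma Gamma_coef_perm n (f : fps 'I_n L) (w : 'S_n) p : Gamma F f -> f (mmap w p) = f p.
Proof.
move=> /supersymmetricE[sf _]; rewrite -{2}(sf (w^-1)%g); apply/esym/coef_rename => [|u|v].
- exact: perm_inj.
- by rewrite permK.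
- by move=> /(_ (w^-1 v)%g); rewrite permKV eqxx.
Qed.

(** Modulo higher degree \bar x_(i0) is - x_(i0), so the exponents of i0 and i1 add up at i0, with a
    sign. *)
Lemma init_minus2 n (i0 i1 : 'I_n) (K : {mset 'I_n}%mset) : i0 != i1 ->
  exists c Q, [/\ init (fun=> 1%N) (mset_eval (minus2 F i0 i1) K) c Q, c = 1 \/ c = - 1,
    deg Q = deg K, Q i0 = (K i0 + K i1)%N /\ Q i1 = 0%N &
    forall i, i != i0 -> i != i1 -> Q i = K i].
Proof.
move=> i01; have i10 : i1 != i0 by rewrite eq_sym.
elim/mset_ind: K => [|v K [c [Q [iQ c1 dQ [Q0 Q1] QK]]]].
  exists 1, mset0; rewrite mset_eval0; split; rewrite ?mset0E //; [exact: init1|by left].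
exists ((if v == i1 then - 1 else 1) * c), ((if v == i1 then i0 else v) +` Q)%mset.
have i0w : (0 < wt (fun=> 1%N) [mset i0]%mset)%N by rewrite wt1.
rewrite mset_evalD mset_eval1; split.
- apply: initM => //; rewrite /minus2; case: ifP => _; last exact: init_var.
  by apply: init_fopp => //; exact: init_var.
- by case: ifP => _; case: c1 => ->; rewrite ?mul1r ?mulrNN ?mul1r; [right|left|left|right]; rewrite ?mulr1 ?mulrNN ?mulr1.
- by rewrite !degD dQ !degn.
- rewrite !msetE2 !msetnE Q0 Q1; case: (eqVneq v i1) => [->|vi1].
    by rewrite ?eqxx ?(negPf i01) ?(negPf i10) ?eqxx; split; lia.
  by case: (i1 =P v) => [e|_]; [rewrite e eqxx in vi1|rewrite add0n addnA].
- move=> i ni0 ni1; rewrite !msetE2 !msetnE QK //.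
  by case: (eqVneq v i1) => [->|//]; rewrite (negPf ni0) (negPf ni1).
Qed.

Lemma coef_zero2 n (f : fps 'I_n L) (i0 i1 : 'I_n) (P : {mset 'I_n}%mset) :
  i0 \in P -> psub f (zero2 L i0 i1) P = 0.
Proof.
move=> i0P; have ev (K : {mset 'I_n}%mset) : mset_eval (zero2 L i0 i1) K = 0 \/
    mset_eval (zero2 L i0 i1) K = fpsX L K /\ i0 \notin K.
  elim/mset_ind: K => [|v K IH]; first by right; rewrite in_mset0 mset_eval0 /fpsX mset_eval0.
  rewrite mset_evalD mset_eval1 {1 3}/zero2; case: ifP => [_|/norP[vi0 _]]; first by left; rewrite mul0r.
  case: IH => [->|[-> i0K]]; [by left; rewrite mulr0|right; rewrite fpsXD fpsX1; split=> //].
  by rewrite in_msetD in_mset1 negb_or i0K andbT eq_sym.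
rewrite psub_coef (@fsbig_setT_seq _ _ [::]) ?big_nil // => K _.
have [->|[-> i0K]] := ev K; first by rewrite fcoef0 mulr0.
by rewrite coef_X; case: eqP i0K => [<-|_ _]; rewrite ?i0P ?mulr0.
Qed.

Definition sq n (p : {mset 'I_n}%mset) : nat := \sum_(i < n) p i * p i.

Lemma sq_le n (p : {mset 'I_n}%mset) : (sq p <= deg p * deg p)%N.
Proof.
rewrite {2}degE wt_ord big_distrr /=; apply: leq_sum => i _.
by rewrite muln1 leq_mul // mset_le_deg.
Qed.

Lemma sq_perm n (w : 'S_n) (p : {mset 'I_n}%mset) : sq (mmap w p) = sq p.
Proof.
rewrite /sq (reindex_inj (@perm_inj _ w)); apply: eq_bigr => i _.
by rewrite mmapE //; exact: perm_inj.
Qed.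

(* The coefficient of [t^(2k)] in [f(t, t-bar, ...)] vanishes; modulo higher  *)
(* degree it is an alternating sum of the coefficients of [x_0^a x_1^b] with  *)
(* [a + b = 2k], of which the one with [a = b = k] minimizes [a^2 + b^2].     *)
Lemma Gamma_equal_exponents n (f : fps 'I_n L) (q : {mset 'I_n}%mset) (i0 i1 : 'I_n) :
  Gamma F f -> i0 = 0%N :> nat -> i1 = 1%N :> nat -> q i0 = q i1 -> (0 < q i0)%N ->
  vge (fun=> 1%N) (deg q) f ->
  (forall K, deg K = deg q -> (sq q < sq K)%N -> f K = 0) -> f q = 0.
Proof.
move=> /supersymmetricE[_ zf] i00 i11 qq q0 fq fK.
have i01 : i0 != i1 by rewrite -val_eqE /= i00 i11.
have [c [P [iP c1 dP [P0 P1] PK]]] := init_minus2 q i01.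
have i0P : i0 \in P by rewrite -mset_neq0 -lt0n P0; lia.
have := congr1 (fun h : fps 'I_n L => h P) (zf _ _ i00 i11); rewrite coef_zero2 //.
rewrite psub_coef (@fsbig_setT_seq _ _ [:: q]) // => [|K].
  rewrite big_seq1 (proj1 iP); case: c1 => ->; rewrite ?mulr1 // mulrN mulr1 => /eqP.
  by rewrite oppr_eq0 => /eqP.
rewrite inE => Kq; have [c' [Q [iQ _ dQ [Q0 Q1] QK]]] := init_minus2 K i01.
have [dK|dK] := ltnP (deg K) (deg q); first by rewrite fq ?mul0r // -degE.
have [lt|{}dK'] := ltnP (deg q) (deg K).
  by rewrite (init_vge iQ) ?mulr0 // -!degE dQ dP.
have {dK dK'}dK : deg K = deg q by apply/eqP; rewrite eqn_leq dK dK'.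
have [PQ|PQ] := eqVneq P Q; last by rewrite (proj2 iQ) ?mulr0 // -!degE dP dQ dK.
rewrite fK ?mul0r // /sq !(bigD1 i0 (P := xpredT)) //= !(bigD1 i1 (P := fun i => i != i0)) ?[i1 == _]eq_sym //=.
have KE i : i != i0 -> i != i1 -> K i = q i by move=> ? ?; rewrite -QK // -PK // PQ.
have -> : (\sum_(i | (i != i0) && (i != i1)) K i * K i = \sum_(i | (i != i0) && (i != i1)) q i * q i)%N.
  by apply: eq_bigr => i /andP[? ?]; rewrite KE.
rewrite !addnA ltn_add2r.
have : (K i0 + K i1 = q i0 + q i1)%N by rewrite -Q0 -P0 PQ.
have : K i0 <> q i0.
  move=> K0; move/eqP: Kq; apply; apply/msetP => i.
  have [->//|ni0] := eqVneq i i0; have [->|ni1] := eqVneq i i1; last exact: KE.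
  by apply: (@addnI (q i0)); rewrite -{1}K0 -Q0 -P0 PQ.
by rewrite -qq; move: (K i0) (K i1) (q i0) => a b k; nia.
Qed.

(** In degree d, up to a permutation of the variables, a monomial is either x^mu with mu strict, or
    has equal positive exponents at the first two variables; the latter case is
    [Gamma_equal_exponents]. *)
Lemma Gamma_vanish n (f : fps 'I_n L) d : Gamma F f ->
  (forall mu : strictpart, (size (val mu) <= n)%N -> (sumn (val mu) < d)%N ->
     f (xmon n (val mu)) = 0) ->
  vge (fun=> 1%N) d f.
Proof.
move=> Gf fs; elim: d fs => // d IH fs.
have {}IH : vge (fun=> 1%N) d f.
  by apply: IH => mu sn dn; apply: fs => //; exact: ltnW.
move=> p; rewrite -degE ltnS leq_eqVlt => /orP[/eqP dp|lt]; last by apply: IH; rewrite -degE.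
(* Descending induction on the sum of squares of the exponents, which is at most d^2. *)
have [N] := ubnP (d * d - sq p)%N; elim: N p dp => // N IHN p dp; rewrite ltnS => pN.
case: (pselect (exists i j, [/\ i != j, (0 < p i)%N & p i = p j])) => [[i [j [ij pi pij]]]|np].
  have n2 : (1 < n)%N.
    by case: n i j ij {f Gf fs IH IHN p dp pN pi pij} => [[]//|[|n]] // i j; rewrite !ord1.
  pose i0 := Ordinal (ltnW n2); pose i1 := Ordinal n2.
  pose w := (tperm i i0 * tperm (tperm i i0 j) i1)%g.
  have i01 : i0 != i1 by [].
  have wi : w i = i0.
    rewrite permM tpermL tpermD //.
    by rewrite -[X in _ != X](tpermL i i0) (inj_eq perm_inj) eq_sym.
  have wj : w j = i1 by rewrite permM tpermL.
  have qw l : mmap w p (w l) = p l by rewrite mmapE //; exact: perm_inj.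
  have dw K : deg (mmap w K) = deg K by apply: deg_mmap; exact: perm_inj.
  rewrite -(Gamma_coef_perm w p Gf); apply: (@Gamma_equal_exponents _ _ _ i0 i1) => //.
  - by rewrite -wi -wj !qw.
  - by rewrite -wi qw.
  - by rewrite dw dp.
  move=> K; rewrite dw sq_perm dp => dK pK; apply: IHN => //.
  apply: leq_trans pN; have := sq_le K; rewrite dK; lia.
have [|w [mu [sn dmu E]]] := @strict_monomial n p.
  by move=> i j ij pi; apply/eqP => pij; apply: np; exists i, j.
by rewrite -(Gamma_coef_perm w p Gf) E fs // dmu dp.
Qed.

End GammaVanishing.

(** * Divisibility by the series x +_F x and by powers of 2 *)

Section Doubling.
Variables (L : comNzRingType) (F : fps 'I_2 L).
Hypothesis HF : is_fgl F.
Hypothesis Ltf : forall (z : L) n, (0 < n)%N -> z *+ n = 0 -> z = 0.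
Hypothesis a11_regular : forall z y : L,
  F (ord0 +` [mset ord_max])%mset * z = y *+ 2 -> exists x, z = x *+ 2.

Section Divisibility.
Variable V : choiceType.
Implicit Types (f g h k : fps V L) (u v : V).

Definition dbl v : fps V L := fadd F (pvar L v) (pvar L v).

Lemma dblE v : exists J : fps V L, dbl v = pvar L v *+ 2 + pvar L v * pvar L v * J /\
  J mset0 = F (ord0 +` [mset ord_max])%mset.
Proof.
exists (fgl_rest F (pvar L v) (pvar L v)); split; first by rewrite mulr2n [LHS](fgl_addE HF).
by apply: fgl_rest_coef0.
Qed.

Lemma init_dbl v : init (fun=> 1%N) (dbl v) (1 *+ 2) [mset v]%mset.
Proof. by apply: init_double; rewrite ?wt1 //; exact: init_var. Qed.

Lemma reg2 (z : L) : (1 *+ 2) * z = 0 -> z = 0.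
Proof. by rewrite mulr_natl; exact: Ltf. Qed.

Lemma reg_dbl v : reg (dbl v).
Proof. exact: init_regular reg2 (init_dbl v). Qed.

Lemma reg_pvar v : reg (pvar L v).
Proof. exact: init_reg1 (init_var L (fun=> 1%N) v). Qed.

(** That is, 2 is regular modulo x +_F x. Write x +_F x = 2 x + x^2 J with J(0) = a_(1,1). Then x^2
    J g is divisible by 2, and since a_(1,1) is regular modulo 2, so is g; the factor 2 cancels. *)
Lemma dbl_dvd_double v f g : f *+ 2 = dbl v * g -> exists h, f = dbl v * h.
Proof.
move=> fg; have [J [JE J0]] := dblE v.
have iJ : init (fun=> 1%N) J (J mset0) mset0.
  by split=> // m; rewrite wt0 leqn0 -degE deg_eq0 => ->.
have iX := initM (initM (init_var L (fun=> 1%N) v) (init_var L (fun=> 1%N) v)) iJ.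
rewrite mul1r mul1r J0 in iX.
have ev m : exists x, g m = x *+ 2.
  pose K z := exists x : L, z = x *+ 2.
  apply: (@mul_init_ideal _ _ (fun=> 1%N) _ g _ _ (deg m).+1 K _ _ _ _ iX).
  - by exists 0; rewrite mul0rn.
  - by move=> a b [x ->] [y ->]; exists (x - y); rewrite mulrnBl.
  - by move=> a b [x ->]; exists (a * x); rewrite mulrnAr.
  - by move=> z [y zy]; exact: a11_regular zy.
  - move=> m' _; exists ((f - pvar L v * g) m'); rewrite -fcoefMn; congr (_ m').
    by rewrite mulrnBl fg JE mulrDl mulrnAl addrAC subrr add0r.
  - by rewrite -degE.
have [g' gE] := boolp.choice ev.
exists (Fps g'); apply/eqP; rewrite -subr_eq0; apply/eqP/(fps_tf Ltf (isT : (0 < 2)%N)).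
rewrite mulrnBl fg -mulrnAr (_ : Fps g' *+ 2 = g) ?subrr //.
by apply/fpsP => m; rewrite fcoefMn gE.
Qed.

(** Principal ideals with a regular initial coefficient are closed: approximate quotients are
    congruent to each other, hence converge. *)
Lemma dvd_limit w f g c p : (forall z, c * z = 0 -> z = 0) -> init w f c p ->
  (forall d, exists k, vge w d (g - f * k)) -> exists k, g = f * k.
Proof.
move=> rc fi /boolp.choice[K KE].
have cons d e : (d <= e)%N -> vge w d (K (e + wt w p)%N - K (d + wt w p)%N).
  move=> de; apply: (mul_init_vge rc fi).
  rewrite (_ : f * _ = (g - f * K (d + wt w p)%N) - (g - f * K (e + wt w p)%N)); last by ring.
  by apply: vgeB => //; apply: vgeW (KE _); rewrite leq_add2r.
pose k := Fps (fun m => K ((wt w m).+1 + wt w p)%N m).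
exists k; apply/eqP; rewrite -subr_eq0; apply/eqP/(@vge_eq0 _ _ w) => d.
rewrite (_ : g - f * k = (g - f * K (d + wt w p)%N) + f * (K (d + wt w p)%N - k)); last by ring.
apply: vgeD; first by apply: vgeW (KE _); exact: leq_addr.
apply: vgeMr => m md; rewrite fcoefB; exact: (cons _ _ md m (ltnSn _)).
Qed.

Lemma dbl_repl0 u v : psub (dbl v) (repl u 0) = if u == v then 0 else dbl v.
Proof.
have a0 : admissible (repl u (0 : fps V L)) by exact: admissible_repl.
rewrite /dbl fgl_psub // psub_repl_var // eq_sym; case: eqP => // _.
exact: fgl_add0r.
Qed.

Lemma dbl_dvd_mul_pvar u v g k : u != v ->
  pvar L u * g = dbl v * k -> exists h, g = dbl v * h.
Proof.
move=> uv E; have a0 : admissible (repl u (0 : fps V L)) by exact: admissible_repl.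
have [|k' k'E] := @repl0_factor _ _ u k.
  apply: (reg_dbl (v := v)); have := congr1 (fun h => psub h (repl u 0)) E.
  by rewrite !psub_mul // dbl_repl0 (negPf uv) psub_repl_var // eqxx mul0r => <-.
exists k'; apply: (regI (reg_pvar (v := u))).
by rewrite E k'E; ring.
Qed.

(** Write the double of u as u T with T = 2 + u J, and call it d_v for v. If d_v divides T h,
    setting u = 0 shows that it divides 2 h(0), hence h(0); so h is a multiple of d_v plus u h' with
    T h' again divisible. Iterating, g is a multiple of d_v modulo every power of u, and [dvd_limit]
    concludes. *)
Lemma dbl_coprime u v g k : u != v -> dbl u * g = dbl v * k -> exists h, g = dbl v * h.
Proof.
move=> uv E; have a0 : admissible (repl u (0 : fps V L)) by exact: admissible_repl.
have [J [JE _]] := dblE u; pose T := 1 *+ 2 + pvar L u * J.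
have TE : dbl u = pvar L u * T by rewrite JE /T; ring.
have TgE : exists k', T * g = dbl v * k'.
  by apply: (dbl_dvd_mul_pvar uv (k := k)); rewrite mulrA -TE.
have step h : (exists k', T * h = dbl v * k') ->
    exists k' h', h = dbl v * k' + pvar L u * h' /\ exists k'', T * h' = dbl v * k''.
  move=> [k' hE]; set e := fun f => psub f (repl u 0).
  have [h0 h0E] : exists h0, e h = dbl v * h0.
    apply: (@dbl_dvd_double v _ (e k')); have := congr1 e hE.
    rewrite /e !psub_mul // dbl_repl0 (negPf uv) /T psubD // psubMn // psub1 // psub_mul //.
    by rewrite psub_repl_var // eqxx mul0r addr0 mulr_natl.
  have [|h' h'E] := @repl0_factor _ _ u (h - e h).
    by apply/fpsP => m; rewrite coef_repl0 fcoef0; case: ifP => // um; rewrite fcoefB /e coef_repl0 um subrr.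
  exists h0, h'; split; first by rewrite -h0E -h'E; ring.
  apply: (dbl_dvd_mul_pvar uv (k := k' - T * h0)).
  by rewrite mulrCA -h'E mulrBr hE h0E; ring.
have iter s : exists k' h', g = dbl v * k' + pvar L u ^+ s * h' /\ exists k'', T * h' = dbl v * k''.
  elim: s => [|s [k1 [h1 [gE /step[k2 [h2 [h1E Th2]]]]]]].
    by exists 0, g; rewrite mulr0 add0r mul1r.
  by exists (k1 + pvar L u ^+ s * k2), h2; split=> //; rewrite gE h1E exprS; ring.
apply: (dvd_limit reg2 (init_dbl v)) => d; have [k' [h' [gE _]]] := iter d.
exists k'; rewrite gE addrC addKr; apply: vgeMl.
by have := @vgeX _ _ (fun=> 1%N) 1 _ d (@vge_var _ L (fun=> 1%N) u); rewrite muln1.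
Qed.

Lemma dbl_dvd_prod (s : seq V) f : uniq s -> (forall v, v \in s -> exists g, f = dbl v * g) ->
  exists g, f = (\prod_(v <- s) dbl v) * g.
Proof.
have cop v (t : seq V) g k : v \notin t -> (\prod_(u <- t) dbl u) * g = dbl v * k ->
    exists h, g = dbl v * h.
  elim: t g k => [|u t IH] g k; first by rewrite big_nil mul1r => _ ->; exists k.
  rewrite inE negb_or big_cons => /andP[vu vt]; rewrite -mulrA => E.
  by have [|h hE] := @dbl_coprime u v _ _ _ E; [rewrite eq_sym|exact: IH hE].
elim: s => [_ _|v s IH /= /andP[vs us] H]; first by exists f; rewrite big_nil mul1r.
have [u us'|g gE] := IH us; first by apply: H; rewrite inE us' orbT.
have [k kE] := H v (mem_head _ _).
have [h hE] := cop v s g k vs (etrans (esym gE) kE).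
by exists h; rewrite big_cons gE hE; ring.
Qed.

(** Keeps the monomials that involve every variable of s. Each step is a difference f - f(v = 0),
    the form in which Gamma_+ gives divisibility. *)
Fixpoint diff0 (s : seq V) f : fps V L :=
  if s is v :: s' then diff0 s' f - psub (diff0 s' f) (repl v 0) else f.

Lemma coef_diff0 s f m : diff0 s f m = if all (mem m) s then f m else 0.
Proof.
elim: s => [//|v s IH].
transitivity ((diff0 s f - psub (diff0 s f) (repl v 0)) m); first by [].
by rewrite fcoefB coef_repl0 IH /=; case: (v \in m) => /=; rewrite ?subr0 ?subrr.
Qed.

Lemma diff0_dvd s f v : v \in s -> (exists g, f - psub f (repl v 0) = dbl v * g) ->
  exists g, diff0 s f = dbl v * g.
Proof.
move=> vs H; have -> : diff0 s f = diff0 s (f - psub f (repl v 0)).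
  apply/fpsP => m; rewrite !coef_diff0; case: allP => // /(_ v vs) vm.
  by rewrite fcoefB coef_repl0 (vm : v \in m) subr0.
case: H => g ->; elim: s {vs f} => [|u s [g' IH]] /=; first by exists g.
rewrite IH psub_mul ?dbl_repl0; last exact: admissible_repl.
case: ifP => _; first by exists g'; rewrite mul0r subr0.
by exists (g' - psub g' (repl u 0)); rewrite mulrBr.
Qed.

Lemma coef_init_mul w f g c p q : init w f c p -> vge w (wt w q) g ->
  (f * g) (p `+` q)%mset = c * g q.
Proof.
move=> [fc f0] gq; pose f' := f - fpsC V c * fpsX L p.
have f'v : vge w (wt w p).+1 f'.
  move=> m; rewrite ltnS fcoefB coef_CM coef_X => mp; have [->|ne] := eqVneq m p.
    by rewrite fc mulr1 subrr.
  by rewrite f0 // mulr0 subrr.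
rewrite (_ : f = fpsC V c * fpsX L p + f'); last by rewrite /f' addrC subrK.
rewrite mulrDl fcoefD -mulrA coef_CM coef_XM_add (vgeM f'v gq) ?addr0 //.
by rewrite wtD addSn.
Qed.

End Divisibility.

(** The part of f involving x_1, ..., x_r is divisible by each x_i +_F x_i, hence by their product,
    whose initial term is 2^r x_1 ... x_r. As f has order |mu|, the coefficient of x^mu is 2^r times
    a coefficient of the quotient. *)
Lemma Gamma_plus_divisible n (f : fps 'I_n L) (mu : strictpart) : Gamma_plus F f ->
  (size (val mu) <= n)%N -> vge (fun=> 1%N) (sumn (val mu)) f ->
  exists z, f (xmon n (val mu)) = (1 *+ 2) ^+ size (val mu) * z.
Proof.
move=> /(Gamma_plusE)[/supersymmetricE[sf _] df] sn fmu; set r := size _ in sn *.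
(* The definition of Gamma_+ speaks of the first variable; a transposition carries it to any x_i. *)
have dfi (i : 'I_n) : exists g : fps 'I_n L, f - psub f (repl i 0) = dbl i * g.
  have n0 : (0 < n)%N by apply: leq_ltn_trans (ltn_ord i).
  pose i0 := Ordinal n0; have [g gE] := df i0 erefl; pose w := tperm i0 i.
  have aw : admissible (fun j => pvar L (w j)) by exact: admissible_pvar.
  have ar (j : 'I_n) : admissible (repl j (0 : fps 'I_n L)) by exact: admissible_repl.
  exists (psub g (fun j => pvar L (w j))).
  have := congr1 (fun h => psub h (fun j => pvar L (w j))) gE.
  rewrite /= psubB // psub_mul // fgl_psub // psub_var // tpermL => <-.
  rewrite sf; congr (_ - _); rewrite -{1}(sf w) !psub_comp //.
  apply: eq_psub => j; rewrite psub_repl_var // /repl -[in LHS](tpermL i0 i) (inj_eq perm_inj).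
  by case: eqP => _; [rewrite psub0|rewrite psub_var].
pose s := [seq widen_ord sn k | k <- enum 'I_r].
have us : uniq s by rewrite map_inj_uniq ?enum_uniq // => k l [] /val_inj.
have [g gE] : exists g, diff0 s f = (\prod_(v <- s) dbl v) * g.
  by apply: dbl_dvd_prod => // v vs; apply: diff0_dvd.
have iP : init (fun=> 1%N) (\prod_(v <- s) @dbl 'I_n v) ((1 *+ 2) ^+ r)
    (\big[@msetD _/mset0]_(v <- s) [mset v])%mset.
  have := init_prod s (P := xpredT) (fun i _ => init_dbl i).
  have -> : \prod_(v <- s) (1 *+ 2 : L) = (1 *+ 2) ^+ r by rewrite big_map big_enum prodr_const card_ord.
  by [].
set p := (\big[@msetD _/mset0]_(v <- s) _)%mset in iP.
have pE (i : 'I_n) : p i = (i < r)%N.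
  rewrite big_msetE big_map big_enum /=; case: ltnP => [ir|ri].
    rewrite (bigD1 (Ordinal ir)) //= (_ : widen_ord _ _ = i) ?msetnxx ?big1 ?addn0 //; last exact: val_inj.
    move=> k ki; rewrite msetnE ifN //; apply: contraNneq ki => ik.
    by apply/eqP/val_inj; rewrite /= ik.
  rewrite big1 // => k _; rewrite msetnE ifN //.
  by apply/eqP => ik; move: ri; rewrite ik /= leqNgt ltn_ord.
have [_ mu0] := strictpartP mu.
have mu_pos i : (i < r)%N -> (0 < nth 0%N (val mu) i)%N.
  by move=> ir; rewrite lt0n; apply: contraNneq mu0 => <-; exact: mem_nth.
have [q qE] : exists q, xmon n (val mu) = (p `+` q)%mset.
  apply: msub_add; apply/msubsetP => i; rewrite pE xmonE.
  by case: ltnP => // /mu_pos.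
have degq : (sumn (val mu) = deg q + deg p)%N by rewrite -(deg_xmon sn) qE degD addnC.
have gq : vge (fun=> 1%N) (wt (fun=> 1%N) q) g.
  have rr (z : L) : (1 *+ 2) ^+ r * z = 0 -> z = 0.
    by elim: {iP sn s us gE p pE mu_pos qE degq} r z => [|r' IH] z; rewrite ?mul1r // exprS -mulrA => h; apply: IH; exact: reg2 h.
  apply: (mul_init_vge rr iP); rewrite -gE -!degE -degq => m md.
  by rewrite coef_diff0; case: ifP => // _; exact: fmu.
exists (g q); rewrite -(coef_init_mul iP gq) -gE -qE coef_diff0 ifT //.
apply/allP => _ /mapP[k _ ->] /=.
by rewrite -mset_neq0 xmonE -lt0n mu_pos //=; exact: ltn_ord.
Qed.

End Doubling.

(** * Formal bases *)

Section Rank.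

Lemma strictpart_enum N : exists s : seq strictpart, uniq s /\
  forall lam : strictpart, (sumn (val lam) <= N)%N -> lam \in s.
Proof.
pose s := [seq filter (fun i => inord i \in A) (rev (iota 0 N.+1)) | A : {set 'I_N.+1}].
exists (undup (pmap insub s)); split=> [|lam lamN]; first exact: undup_uniq.
have [slam lam0] := strictpartP lam.
have leN i : i \in val lam -> (i <= N)%N.
  move=> il; apply: leq_trans lamN; rewrite sumnE (big_rem _ il) /=; exact: leq_addr.
rewrite mem_undup mem_pmap_sub; apply/fintype.imageP; exists [set i : 'I_N.+1 | (i : nat) \in val lam]%SET => //.
apply: (@sorted_eq _ gtn) => //; first exact: (rev_trans ltn_trans).
- by move=> x y /andP[xy yx]; have := ltn_trans xy yx; rewrite ltnn.
- apply: sorted_filter; first exact: (rev_trans ltn_trans).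
  by rewrite rev_sorted iota_ltn_sorted.
apply: uniq_perm.
- apply: (sorted_uniq _ _ slam); [exact: (rev_trans ltn_trans)|exact: ltnn].
- by rewrite filter_uniq // rev_uniq iota_uniq.
move=> i; rewrite mem_filter inE mem_rev mem_iota /= add0n ltnS.
apply/idP/andP => [il|[+ iN]]; last by rewrite inordK.
have iN := leN i il; by split; rewrite ?inordK.
Qed.

(** The list may also contain larger partitions; their terms vanish in the sums below. *)
Definition slist N : seq strictpart := projT1 (cid (strictpart_enum N)).

Lemma slist_uniq N : uniq (slist N).
Proof. by rewrite /slist; case: cid => s []. Qed.

Lemma mem_slist N (lam : strictpart) : (sumn (val lam) <= N)%N -> lam \in slist N.
Proof. by rewrite /slist; case: cid => s [_ H] /=; exact: H. Qed.

Lemma wsum_le (lam : strictpart) : (wsum (val lam) <= sumn (val lam) * sumn (val lam))%N.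
Proof.
have [_ lam0] := strictpartP lam.
have nth_pos k : (k < size (val lam))%N -> (0 < nth 0%N (val lam) k)%N.
  by move=> kl; rewrite lt0n; apply: contraNneq lam0 => <-; exact: mem_nth.
have sl : (size (val lam) <= sumn (val lam))%N.
  rewrite sumnE (big_nth 0%N) big_mkord -{1}[size _]card_ord -sum1_card.
  by apply: leq_sum => k _; exact: nth_pos.
rewrite /wsum {1}sumnE (big_nth 0%N) big_mkord big_distrl /=; apply: leq_sum => k _.
by rewrite leq_mul2l (leq_trans (ltnW (ltn_ord k)) sl) orbT.
Qed.

(* Orders the pairs ([lam], [m]) lexicographically by [|lam| + |m|], [|m|]    *)
(* and [\sum_i i lam_i].                                                      *)
Definition rank (lam : strictpart) (m : {mset nat}%mset) : nat :=
  let N := (sumn (val lam) + deg m)%N in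
  (N.+1 * N.+1 * N.+1 * N.+1 + deg m * (N * N).+1 + wsum (val lam))%N.

(** The jump of the fourth power from (M + 1)^4 to (M + 2)^4 exceeds M (M^2 + 1) + M^2, a bound on
    the other two terms. *)
Lemma rank_lt (lam mu : strictpart) (k m : {mset nat}%mset) :
  (sumn (val lam) + deg k < sumn (val mu) + deg m)%N -> (rank lam k < rank mu m)%N.
Proof.
rewrite /rank; have := wsum_le lam.
move: (sumn (val lam)) (sumn (val mu)) (wsum (val lam)) (wsum (val mu)) (deg k) (deg m) => a b x y c d xa H.
set M := (a + c)%N in H *; set N := (b + d)%N in H *.
have cM : (c <= M)%N by rewrite leq_addl.
have xM : (x <= M * M)%N by apply: leq_trans xa _; apply: leq_mul; rewrite leq_addr.
have h1 : (c * (M * M).+1 <= M * (M * M).+1)%N by rewrite leq_mul2r cM orbT.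
have h2 : (M.+2 * M.+2 * M.+2 * M.+2 <= N.+1 * N.+1 * N.+1 * N.+1)%N.
  by do !apply: leq_mul.
have h3 : (M.+1 * M.+1 * M.+1 * M.+1 + M * (M * M).+1 + M * M < M.+2 * M.+2 * M.+2 * M.+2)%N.
  by clearbody M; nia.
lia.
Qed.

Lemma rank_lt_deg (lam mu : strictpart) (k m : {mset nat}%mset) :
  (sumn (val lam) + deg k)%N = (sumn (val mu) + deg m)%N -> (deg k < deg m)%N ->
  (rank lam k < rank mu m)%N.
Proof.
rewrite /rank => E km; have lamN : (sumn (val lam) <= sumn (val mu) + deg m)%N.
  by rewrite -E leq_addr.
rewrite E -!addnA ltn_add2l; apply: leq_trans (leq_addr _ _).
set N := (_ + deg m)%N in lamN *; have wN : (wsum (val lam) <= N * N)%N.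
  by apply: leq_trans (wsum_le lam) _; apply: leq_mul.
apply: (@leq_trans ((deg k).+1 * (N * N).+1)%N); last by rewrite leq_mul2r km orbT.
by rewrite mulSn; lia.
Qed.

Lemma rank_lt_wsum (lam mu : strictpart) (m : {mset nat}%mset) :
  sumn (val lam) = sumn (val mu) -> (wsum (val lam) < wsum (val mu))%N ->
  (rank lam m < rank mu m)%N.
Proof. by rewrite /rank => -> ?; rewrite ltn_add2l. Qed.

Lemma xmon_inj n (lam mu : strictpart) : (size (val lam) <= n)%N -> (size (val mu) <= n)%N ->
  xmon n (val lam) = xmon n (val mu) -> lam = mu.
Proof.
move=> sl sm E; apply: val_inj.
have nthE k : nth 0%N (val lam) k = nth 0%N (val mu) k.
  have [kn|nk] := ltnP k n; first by rewrite -[k]/(val (Ordinal kn)) -!xmonE E.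
  by rewrite !nth_default // (leq_trans _ nk).
have szP (a b : strictpart) : (forall k, nth 0%N (val a) k = nth 0%N (val b) k) ->
    (size (val a) <= size (val b))%N.
  move=> ab; rewrite leqNgt; apply/negP => lt; have [_ a0] := strictpartP a.
  by move: a0; rewrite -(nth_default 0%N (leqnn (size (val b)))) -ab mem_nth.
by apply: (@eq_from_nth _ 0%N) => [|k _]; [apply/eqP; rewrite eqn_leq !szP|exact: nthE].
Qed.

End Rank.

(** * Triangular families are formal bases *)

Section Basis.
Variables (L : comNzRingType) (F : fps 'I_2 L).
Hypothesis HF : is_fgl F.
Variables (G : forall n, set (fps 'I_n L)) (e : strictpart -> xfamily L) (w : strictpart -> L).
Hypothesis G_Gamma : forall n f, @G n f -> Gamma F f.
Hypothesis G0 : forall n, G (0 : fps 'I_n L).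
Hypothesis G_lin : forall n (a : L) f g, @G n f -> @G n g -> @G n (f + fpsC _ a * g).
Hypothesis G_div : forall n f (mu : strictpart), @G n f -> (size (val mu) <= n)%N ->
  vge (fun=> 1%N) (sumn (val mu)) f -> exists z, f (xmon n (val mu)) = w mu * z.
Hypothesis w_reg : forall mu z, w mu * z = 0 -> z = 0.
Hypothesis e_mem : forall lam, projlim (over_b G) (e lam).
Hypothesis e_lead : forall lam n, leading (e lam n) (val lam) (w lam).

Implicit Types (lam mu nu : strictpart) (m k : {mset nat}%mset) (c : strictpart -> fps nat L).

Definition bterm c n m (p : {mset 'I_n}%mset) lam : L :=
  \sum_(k <- msubs m) c lam k * bcoef (e lam n) (m `\` k)%mset p.

Lemma bterm_eq0 c n m p lam : (deg p + deg m < sumn (val lam))%N -> @bterm c n m p lam = 0.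
Proof.
move=> lt; rewrite /bterm big_seq big1 // => k; rewrite mem_msubs => /msub_add[l mE].
have [->|nz] := eqVneq (bcoef (e lam n) (m `\` k)%mset p) 0; first by rewrite mulr0.
have [_ H _] := e_lead lam n; have := H _ _ nz.
by move: lt; rewrite mE msetB_add degD => lt le; have := leq_trans lt le; rewrite ltn_add2l ltnNge leq_addl.
Qed.

Definition lincomb c n m (p : {mset 'I_n}%mset) : L :=
  \sum_(lam <- slist (deg p + deg m)) bterm c m p lam.

Lemma sum_bterm c n m (p : {mset 'I_n}%mset) N : (deg p + deg m <= N)%N ->
  \sum_(lam <- slist N) bterm c m p lam = lincomb c m p.
Proof.
move=> le; apply: eq_big_support; rewrite ?slist_uniq // => lam nz.
have : (sumn (val lam) <= deg p + deg m)%N.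
  by rewrite leqNgt; apply: contraNN nz => /bterm_eq0 ->.
by move=> H; rewrite !mem_slist // (leq_trans H).
Qed.

Lemma formal_lincombP c f : formal_lincomb e c f <->
  forall n m p, bcoef (f n) m p = @lincomb c n m p.
Proof.
have termE n m p lam : (bscalar n (c lam) * e lam n) (mxb p m) = bterm c m p lam.
  by rewrite -bcoefE bcoef_bscalar.
have sumE n m p : \sum_(lam \in [set: strictpart]) (bscalar n (c lam) * e lam n) (mxb p m) = lincomb c m p.
  rewrite (@fsbig_setT_seq _ _ (slist (deg p + deg m))) ?slist_uniq // => [|lam lamN].
    by apply: eq_bigr => lam _; exact: termE.
  rewrite termE bterm_eq0 // ltnNge; apply: contraNN lamN; exact: mem_slist.
split=> [H n m p|H n K]; first by rewrite bcoefE; have [_ ->] := H n (mxb p m).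
have [p [m ->]] := mxb_surj K; rewrite sumE -H bcoefE; split=> //.
apply: (@sub_finite_set _ _ [set` slist (deg p + deg m)]); last exact: finite_seq.
move=> lam nz; have {}nz : (bscalar n (c lam) * e lam n) (mxb p m) != 0 := nz.
suff : lam \in slist (deg p + deg m) by [].
apply: mem_slist; rewrite leqNgt; apply: contraNN nz => lt.
by rewrite termE bterm_eq0.
Qed.

Lemma formal_lincomb_exists c : exists f, formal_lincomb e c f.
Proof.
exists (fun n => Fps (fun K => \sum_(lam \in [set: strictpart]) (bscalar n (c lam) * e lam n) K)).
move=> n K; split=> //; have [p [m ->]] := mxb_surj K.
apply: (@sub_finite_set _ _ [set` slist (deg p + deg m)]); last exact: finite_seq.
move=> lam nz; have {}nz : (bscalar n (c lam) * e lam n) (mxb p m) != 0 := nz.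
suff : lam \in slist (deg p + deg m) by [].
apply: mem_slist; rewrite leqNgt; apply: contraNN nz => lt.
by rewrite -bcoefE bcoef_bscalar; apply/eqP; exact: (@bterm_eq0 c n m p lam).
Qed.

(** A finite combination, hence an element of G up to which membership can be tested; it agrees with
    the full sum at x^p b^m when deg p + deg m is at most N. *)
Definition truncated c n N m : fps 'I_n L :=
  \sum_(lam <- slist N) \sum_(k <- msubs m) fpsC _ (c lam k) * bcoef (e lam n) (m `\` k)%mset.

Lemma coef_truncated c n N m (p : {mset 'I_n}%mset) : (deg p + deg m <= N)%N ->
  truncated c n N m p = lincomb c m p.
Proof.
move=> le; rewrite -(sum_bterm c le) fcoef_sum; apply: eq_bigr => lam _.
by rewrite fcoef_sum; apply: eq_bigr => k _; rewrite coef_CM.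
Qed.

Lemma G_sub_truncated c n N m f : @G n f -> @G n (f - truncated c n N m).
Proof.
have GD (g h : fps 'I_n L) : G g -> G h -> G (g + h).
  by move=> Gg Gh; rewrite -[h]mul1r -(rmorph1 (@fpsC 'I_n L)); exact: G_lin.
move=> Gf; rewrite -[X in _ - X]mul1r -mulNr -(rmorph1 (@fpsC 'I_n L)) -rmorphN.
apply: G_lin => //; rewrite /truncated; elim/big_ind: _ => [|g h|lam _]; [exact: G0|exact: GD|].
elim/big_ind: _ => [|g h|k _]; [exact: G0|exact: GD|]; rewrite -[_ * _]add0r; apply: G_lin; first exact: G0.
exact: (proj1 (e_mem lam n)).
Qed.

(** The coefficient of x^mu b^m, read in the smallest number of variables in which x^mu exists;
    [scoefE] shows that more variables give the same value. *)
Definition scoef (f : xfamily L) m mu : L := bcoef (f (size (val mu))) m (xmon _ (val mu)).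

Lemma scoefE f n m mu : projlim (over_b G) f -> (size (val mu) <= n)%N ->
  bcoef (f n) m (xmon n (val mu)) = scoef f m mu.
Proof.
move=> Gf /subnK <-; elim: (n - _)%N => [//|d IH].
by rewrite addSn -IH -(proj2 (Gf (d + size (val mu))%N)) bcoef_xlast0 coef_last0 mmap_xmon // leq_addl.
Qed.

Definition slincomb c m mu : L :=
  \sum_(lam <- slist (sumn (val mu) + deg m)) \sum_(k <- msubs m)
     c lam k * scoef (e lam) (m `\` k)%mset mu.

Lemma lincomb_xmon c n m mu : (size (val mu) <= n)%N ->
  lincomb c m (xmon n (val mu)) = slincomb c m mu.
Proof.
move=> sn; rewrite /lincomb deg_xmon //; apply: eq_bigr => lam _; apply: eq_bigr => k _.
by rewrite (scoefE _ (e_mem lam)).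
Qed.

Lemma scoef_diag mu : scoef (e mu) mset0 mu = w mu.
Proof. by have [H _ _] := e_lead mu (size (val mu)); exact: H. Qed.

(** By the leading form, a nonzero contribution has |lam| + |k| at most |mu| + |m|. On equality,
    either |k| < |m|, or k = m and then lam is mu or has smaller [wsum]. These are the three levels
    of [rank]. *)
Lemma scoef_triangular lam mu m k : (k `<=` m)%mset ->
  scoef (e lam) (m `\` k)%mset mu != 0 ->
  (lam = mu /\ k = m) \/ (rank lam k < rank mu m)%N.
Proof.
move=> /msub_add[l ->]; rewrite msetB_add.
pose n := maxn (size (val lam)) (size (val mu)).
have sl : (size (val lam) <= n)%N by exact: leq_maxl.
have sm : (size (val mu) <= n)%N by exact: leq_maxr.
rewrite -(scoefE _ (e_mem lam) sm) => nz; have [_ H1 H2] := e_lead lam n.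
have := H1 _ _ nz; rewrite deg_xmon // => le.
have [lt|ge] := ltnP (sumn (val lam) + deg k) (sumn (val mu) + deg (k `+` l)%mset).
  by right; exact: rank_lt.
have E : (sumn (val lam) + deg k = sumn (val mu) + deg (k `+` l)%mset)%N.
  by move: ge; rewrite degD; lia.
have [l0|lpos] := posnP (deg l); last by right; apply: rank_lt_deg => //; rewrite degD; lia.
have {}l0 : l = mset0 by apply/eqP; rewrite -deg_eq0 l0.
rewrite {}l0 msetD0 in nz E *; have {}E : sumn (val lam) = sumn (val mu) by lia.
have [|/(xmon_inj sm sl) -> //|] := H2 _ nz; first by rewrite deg_xmon.
  by left.
by rewrite (wt_xmon id sm); right; exact: rank_lt_wsum.
Qed.

Lemma slincomb_diff c c' m mu :
  (forall lam k, (rank lam k < rank mu m)%N -> c lam k = c' lam k) ->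
  slincomb c m mu - slincomb c' m mu = w mu * (c mu m - c' mu m).
Proof.
move=> cc'; rewrite /slincomb -sumrB (bigD1_seq mu) ?slist_uniq ?mem_slist ?leq_addr //=.
rewrite [X in _ + X]big1 ?addr0 => [|lam lm].
  rewrite -sumrB (bigD1_seq m) ?msubs_uniq ?mem_msubs ?msubset_refl //= msetBxx scoef_diag.
  rewrite big_seq_cond big1 ?addr0 => [|k /andP[]]; first by ring.
  rewrite mem_msubs => km nkm; rewrite -mulrBl.
  have [->|/(scoef_triangular km)[[_ e']|/cc' ->]] := eqVneq (scoef (e mu) (m `\` k)%mset mu) 0.
  - by rewrite mulr0.
  - by rewrite e' eqxx in nkm.
  - by rewrite subrr mul0r.
rewrite -sumrB big_seq big1 // => k; rewrite mem_msubs => km; rewrite -mulrBl.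
have [->|/(scoef_triangular km)[[e' _]|/cc' ->]] := eqVneq (scoef (e lam) (m `\` k)%mset mu) 0.
- by rewrite mulr0.
- by rewrite e' eqxx in lm.
- by rewrite subrr mul0r.
Qed.

Section Coefficients.
Variable f : xfamily L.
Hypothesis Gf : projlim (over_b G) f.

(** Stage r + 1 solves the equations of rank r for the unknowns of rank r, the higher unknowns still
    being 0. *)
Fixpoint approx r : strictpart -> fps nat L :=
  if r is r'.+1 then fun lam => Fps (fun k =>
    if rank lam k == r' then
      xget 0 [set z | w lam * z = scoef f k lam - slincomb (approx r') k lam]
    else approx r' lam k)
  else fun=> 0.

Lemma approxS r lam k : approx r.+1 lam k = if rank lam k == r then
    xget 0 [set z | w lam * z = scoef f k lam - slincomb (approx r) k lam]
  else approx r lam k.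
Proof. by []. Qed.

Lemma approx_supp r lam k : (r <= rank lam k)%N -> approx r lam k = 0.
Proof.
elim: r => [//|r IH] lt; rewrite approxS gtn_eqF // IH //; exact: ltnW.
Qed.

Lemma approx_stable r s lam k : (rank lam k < r)%N -> (r <= s)%N ->
  approx s lam k = approx r lam k.
Proof.
move=> kr /subnK <-; elim: (s - r)%N => [//|d IH].
by rewrite addSn approxS ltn_eqF // (leq_trans kr) // leq_addl.
Qed.

(** The residual lies in G and vanishes at x^nu for strict nu with |nu| < |mu|, so by [Gamma_vanish]
    it has order at least |mu|, and [G_div] applies to it. *)
Lemma approx_divisible mu m :
  (forall nu, (rank nu m < rank mu m)%N -> slincomb (approx (rank mu m)) m nu = scoef f m nu) ->
  exists z, w mu * z = scoef f m mu - slincomb (approx (rank mu m)) m mu.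
Proof.
set c := approx _ => H; pose n := size (val mu); pose N := (sumn (val mu) + deg m)%N.
have hE nu : (size (val nu) <= n)%N -> (sumn (val nu) <= sumn (val mu))%N ->
    (bcoef (f n) m - truncated c n N m) (xmon n (val nu)) = scoef f m nu - slincomb c m nu.
  move=> sn le; rewrite fcoefB scoefE // coef_truncated ?lincomb_xmon //.
  by rewrite deg_xmon // leq_add2r.
have Gh : G (bcoef (f n) m - truncated c n N m).
  by apply: G_sub_truncated; exact: (proj1 (Gf n)).
have [||z zE] := G_div (mu := mu) Gh; rewrite ?leqnn //.
  apply: (Gamma_vanish HF (G_Gamma Gh)) => nu sn lt.
  rewrite hE // ?(ltnW lt) // H ?subrr //.
  by apply: rank_lt; rewrite ltn_add2r.
by exists z; rewrite -zE hE.
Qed.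

Lemma slincomb_approx r mu m : (rank mu m < r)%N -> slincomb (approx r) m mu = scoef f m mu.
Proof.
elim: r mu m => [//|r IH] mu m; rewrite ltnS => le.
have D : slincomb (approx r.+1) m mu - slincomb (approx r) m mu =
    w mu * (approx r.+1 mu m - approx r mu m).
  apply: slincomb_diff => lam k kl; rewrite approxS ifN //.
  by rewrite neq_ltn (leq_trans kl le).
move: le; rewrite leq_eqVlt => /orP[/eqP re|lt]; last first.
  by move: D; rewrite approxS ltn_eqF // subrr mulr0 IH // => /eqP; rewrite subr_eq0 => /eqP.
move: D; rewrite approxS re eqxx (approx_supp (r := r)) ?re // subr0.
have [|z zE] := @approx_divisible mu m; first by rewrite re => nu lt; apply: IH.
rewrite re in zE; have /= -> := xgetPex 0 (ex_intro
  [set z | w mu * z = scoef f m mu - slincomb (approx r) m mu] z zE).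
by move=> /eqP; rewrite -subr_eq0 opprB addrA subrK subr_eq0 => /eqP.
Qed.

(** The combination matches f at all strict monomials by construction; [Gamma_vanish], applied to
    the difference with a truncation, extends this to all monomials. *)
Lemma lincomb_spans : exists c, formal_lincomb e c f.
Proof.
(* An unknown of rank s is final from stage s + 1 on. *)
pose c lam := Fps (fun k => approx (rank lam k).+1 lam k).
have cE mu m : slincomb c m mu = scoef f m mu.
  rewrite -(slincomb_approx (ltnSn _)); apply/eqP; rewrite -subr_eq0 slincomb_diff ?subrr ?mulr0 //.
  by move=> lam k lt; apply/esym/approx_stable => //; exact: ltnW.
exists c; apply/formal_lincombP => n m p; set N := (deg p + deg m)%N.
have Gh : G (bcoef (f n) m - truncated c n N m).
  by apply: G_sub_truncated; exact: (proj1 (Gf n)).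
apply/eqP; rewrite -subr_eq0 -(coef_truncated c (leqnn N)) -fcoefB; apply/eqP.
apply: (@Gamma_vanish _ _ HF _ _ (deg p).+1 (G_Gamma Gh)); last by rewrite -degE.
move=> mu sn; rewrite ltnS => le; rewrite fcoefB scoefE // coef_truncated.
  by rewrite lincomb_xmon // cE subrr.
by rewrite deg_xmon // leq_add2r.
Qed.

(** Induction on [rank]: once the unknowns of smaller rank agree, the next equation determines the
    difference of the next unknowns up to the regular factor [w lam]. *)
Lemma lincomb_unique c c' : formal_lincomb e c f -> formal_lincomb e c' f -> c = c'.
Proof.
move=> /formal_lincombP Hc /formal_lincombP Hc'.
have E m mu : slincomb c m mu = slincomb c' m mu.
  by rewrite -!(lincomb_xmon _ _ (leqnn _)) -Hc -Hc'.
suff cc' r : forall lam k, (rank lam k < r)%N -> c lam k = c' lam k.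
  by apply/funext => lam; apply/fpsP => k; exact: (cc' (rank lam k).+1).
elim: r => [//|r IH] lam k; rewrite ltnS => le.
apply/eqP; rewrite -subr_eq0; apply/eqP/(@w_reg lam).
rewrite -(@slincomb_diff c c' k lam) ?E ?subrr // => mu j lt.
by apply: IH; exact: leq_trans lt le.
Qed.

End Coefficients.

Theorem leading_formal_basis : formal_basis (projlim (over_b G)) e.
Proof.
split=> // [|f Gf]; first exact: formal_lincomb_exists.
by have [c Hc] := lincomb_spans Gf; exists c; split=> // c'; exact: lincomb_unique.
Qed.

End Basis.

(** * Linear combinations in the rings Gamma and Gamma_+ *)

Section GammaLinear.
Variables (L : comNzRingType) (F : fps 'I_2 L).
Hypothesis HF : is_fgl F.

Lemma Gamma0 n : Gamma F (0 : fps 'I_n L).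
Proof.
apply/supersymmetricE; split=> [w|i0 i1 _ _]; first by rewrite psub0 //; exact: admissible_pvar.
rewrite !psub0 //; apply: admissible_fin; [exact: nconst_zero2|exact: nconst_minus2].
Qed.

Lemma Gamma_lin n (a : L) (f g : fps 'I_n L) : Gamma F f -> Gamma F g -> Gamma F (f + fpsC _ a * g).
Proof.
have lin s : admissible s -> psub (f + fpsC _ a * g) s = psub f s + fpsC 'I_n a * psub g s.
  by move=> as_; rewrite psubD // psub_mul // psubC.
move=> /supersymmetricE[fs fz] /supersymmetricE[gs gz].
apply/supersymmetricE; split=> [w|i0 i1 i00 i11].
  by rewrite lin ?fs ?gs //; exact: admissible_pvar.
rewrite !lin ?fz ?gz //; apply: admissible_fin; [exact: nconst_zero2|exact: nconst_minus2].
Qed.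

Lemma Gamma_plus0 n : Gamma_plus F (0 : fps 'I_n L).
Proof.
apply/Gamma_plusE; split=> [|i0 _]; first exact: Gamma0.
by exists 0; rewrite psub0 ?subrr ?mulr0 //; exact: admissible_repl.
Qed.

Lemma Gamma_plus_lin n (a : L) (f g : fps 'I_n L) :
  Gamma_plus F f -> Gamma_plus F g -> Gamma_plus F (f + fpsC _ a * g).
Proof.
move=> /Gamma_plusE[sf df] /Gamma_plusE[sg dg]; apply/Gamma_plusE.
split=> [|i0 i00]; first exact: Gamma_lin.
have [f' f'E] := df i0 i00; have [g' g'E] := dg i0 i00.
have ar : admissible (repl i0 (0 : fps 'I_n L)) by exact: admissible_repl.
exists (f' + fpsC _ a * g'); rewrite psubD // psub_mul // psubC // mulrDr mulrCA -f'E -g'E.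
by rewrite mulrBr opprD addrACA.
Qed.

End GammaLinear.

Theorem corollary4p27 (L : comNzRingType) (F : fps 'I_2 L) (HL : lazard F) :
  formal_basis (projlim (over_b (Gamma F))) (PLplus F) /\
  formal_basis (projlim (over_b (Gamma_plus F))) (QL F).
Proof.
have HF : is_fgl F by case: HL.
have [Ltf a11] := lazard_regular HL.
split.
  (* The leading coefficients of P are 1, so divisibility and regularity are immediate. *)
  apply: (@leading_formal_basis L F HF (@Gamma L F) (PLplus F) (fun=> 1)) => //.
  - exact: Gamma0.
  - exact: Gamma_lin.
  - by move=> n f mu _ _ _; exists (f (xmon n (val mu))); rewrite mul1r.
  - by move=> mu z; rewrite mul1r.
  - exact: PLplus_mem.
  - exact: PLplus_leading.
(* Each part of the partition contributes a factor 2 from x +_F x. *)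
apply: (@leading_formal_basis L F HF (@Gamma_plus L F) (QL F)
  (fun lam => (1 *+ 2) ^+ size (val lam))).
- by move=> n f [].
- exact: Gamma_plus0.
- exact: Gamma_plus_lin.
- by move=> n f mu; exact: Gamma_plus_divisible.
- move=> mu; elim: (size _) => [|r IH] z; first by rewrite mul1r.
  by rewrite exprS -mulrA mulr_natl => /Ltf-/(_ isT)/IH.
- exact: QL_mem.
- exact: QL_leading.
Qed.
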